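(* Let $(X,G,m)$ be a dynamical system and let $d$ be a metric on $X$ inducing the topology of $X$. Define $\underline{d}:G\to[0,\infty)$ by $\underline{d}(t)=\int_X d(x,tx)\,dm(x)$. Then the following assertions are equivalent: (i) The dynamical system $(X,G,m)$ has discrete spectrum. (ii) The function $\underline{d}$ is almost periodic (in the sense of Bohr). If one of these equivalent conditions holds, then the group of eigenvalues of $(X,G,m)$ equals the subgroup of $\widehat{G}$ generated by the frequencies of $\underline{d}$.
   Context: Dynamical system: $X$ is a compact space whose topology is induced by a metric, $G$ is a locally compact, $\sigma$-compact, abelian group (written additively, neutral element $0$) acting continuously on $X$ via $G\times X\to X$, $(t,x)\mapsto tx$, and $m$ is a $G$-invariant (Borel) probability measure on $X$. For $t\in G$ the unitary operator $T_t$ on $L^2(X,m)$ is given by $T_tf=f(t\,\cdot)$. Dual group: $\widehat{G}$ is the group of continuous group homomorphisms $\gamma:G\to\{z\in\mathbb{C}:|z|=1\}$ under pointwise multiplication. Eigenfunctions and discrete spectrum: $f\in L^2(X,m)$, $f\neq0$, is an eigenfunction to the eigenvalue $\gamma\in\widehat{G}$ if $T_tf=\gamma(t)f$ for every $t\in G$. The group of eigenvalues is the subgroup of $\widehat{G}$ generated by the set of eigenvalues. The system has discrete spectrum if $L^2(X,m)$ has an orthonormal basis consisting of eigenfunctions. Almost periodicity: A subset $\mathcal{T}\subset G$ is relatively dense if there is a compact $K\subset G$ with $\mathcal{T}+K=G$. A uniformly continuous function $F:G\to\mathbb{C}$ is almost periodic (in the sense of Bohr) if for every $\varepsilon>0$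 the set $\{t\in G:\|F(t+\cdot)-F\|_\infty\le\varepsilon\}$ is relatively dense, where $\|\cdot\|_\infty$ is the supremum norm. Equivalently, the hull $\mathbb{T}(F)$, i.e. the closure of $\{F(t+\cdot):t\in G\}$ with respect to $\|\cdot\|_\infty$, is compact. In this case $\mathbb{T}(F)$ carries a unique structure of a (compact abelian) topological group such that $j:G\to\mathbb{T}(F)$, $t\mapsto F(t+\cdot)$, is a continuous group homomorphism (with dense range). Frequencies: For $F$ almost periodic, every continuous $h$ on $\mathbb{T}(F)$ has a unique $L^2$-convergent Fourier expansion (with respect to normalized Haar measure) $h=\sum_{\gamma\in\widehat{\mathbb{T}(F)}}c^h_\gamma\gamma$. If $H=h\circ j$ with $h$ continuous on $\mathbb{T}(F)$, the set of frequencies of $H$ is $\{\gamma\circ j:c^h_\gamma\neq0\}\subset\widehat{G}$. In particular, the frequencies of an almost periodic $F$ itself are obtained by taking $H=F=\delta\circ j$ with $\delta:\mathbb{T}(F)\to\mathbb{C}$, $\delta(E)=E(0)$. *)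

(* Defs.v *)
From HB Require Import structures.
From mathcomp Require Import all_boot all_order all_algebra.
From mathcomp Require Import all_classical all_reals all_analysis.
From mathcomp Require Import complex.

Set Implicit Arguments.
Unset Strict Implicit.
Unset Printing Implicit Defensive.

Import Order.TTheory GRing.Theory Num.Theory.
Import numFieldNormedType.Exports.

Local Open Scope classical_set_scope.
Local Open Scope ring_scope.
Local Open Scope complex_scope.

(* R[i] itself carries no topology in the libraries; R[i]^o is the same field
   with the topology given by the modulus. *)
Notation Cplx R := (R[i]^o).

Section ComplexL2.
Context (R : realType) (disp : measure_display) (T : measurableType disp).
Variable mu : {measure set T -> \bar R}.
Implicit Types f g : T -> Cplx R.

Definition cintegral f : Cplx R :=
  (\int[mu]_x complex.Re (f x)) +i* (\int[mu]_x complex.Im (f x)).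

Definition cmeasurable f : Prop :=
  measurable_fun [set: T] (fun x => complex.Re (f x)) /\
  measurable_fun [set: T] (fun x => complex.Im (f x)).

Definition L2norm f : \bar R :=
  Lnorm mu 2%:E (fun x => (Normc.normc (f x))%:E).

(* Elements of L^2 are represented by functions; they are only ever compared
   up to equality almost everywhere. *)
Definition memL2 f : Prop := cmeasurable f /\ (L2norm f < +oo)%E.

Definition L2inner f g : Cplx R := cintegral (fun x => f x * (g x)^*%C).

(* An orthonormal family with dense linear span.  Two distinct members are
   orthogonal, so no element of L^2 is represented twice. *)
Definition orthonormal_basis (E : set (T -> Cplx R)) : Prop :=
  [/\ E `<=` memL2,
      forall e, E e -> L2inner e e = 1,
      forall e e', E e -> E e' -> e <> e' -> L2inner e e' = 0 &
      forall f, memL2 f -> forall eps : R, 0 < eps ->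
        exists (n : nat) (c : 'I_n -> Cplx R) (e : 'I_n -> T -> Cplx R),
          (forall i, E (e i)) /\
          (L2norm (fun x => f x - \sum_(i < n) c i * e i x)%R < eps%:E)%E].

End ComplexL2.

Definition borel (T : ptopologicalType) := g_sigma_algebraType (@open T).
HB.instance Definition _ (T : ptopologicalType) :=
  Measurable.on (borel T).

Record abelian_topgroup_law (T : topologicalType) (add : T -> T -> T) : Prop := {
  topgroup_addA : associative add ;
  topgroup_addC : commutative add ;
  topgroup_addNr : exists (zero : T) (opp : T -> T),
    [/\ left_id zero add, left_inverse zero opp add & continuous opp] ;
  topgroup_add_continuous : continuous (fun p : T * T => add p.1 p.2)
}.

Section Characters.
Context (R : realType).

Definition characters (T : topologicalType) (add : T -> T -> T) :
    set (T -> Cplx R) :=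
  [set gam : T -> Cplx R | [/\ continuous gam, forall x, `|gam x| = 1 &
              forall x y, gam (add x y) = gam x * gam y]].

Definition dual (G : topologicalZmodType) : set (G -> Cplx R) :=
  @characters G +%R.

Definition dual_subgroup (G : topologicalZmodType) (H : set (G -> Cplx R)) :
    Prop :=
  [/\ H `<=` @dual G, H (fun=> 1),
      forall a b, H a -> H b -> H (fun t => a t * b t) &
      forall a, H a -> H (fun t => (a t)^-1)].

Definition generated_subgroup (G : topologicalZmodType)
    (S : set (G -> Cplx R)) : set (G -> Cplx R) :=
  smallest (@dual_subgroup G) S.

End Characters.

Section AlmostPeriodicity.
Context (R : realType) (G : topologicalZmodType).
Implicit Type F : G -> Cplx R.

Definition relatively_dense (T : set G) : Prop :=
  exists2 K : set G, compact K & [set t + k | t in T & k in K] = [set: G].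

(* Uniform continuity for the canonical uniformity of the topological group G. *)
Definition group_uniformly_continuous F : Prop :=
  forall eps : R, 0 < eps ->
    \forall u \near (0 : G), forall t, Normc.normc (F (t + u) - F t) < eps.

Definition almost_periodic F : Prop :=
  group_uniformly_continuous F /\
  forall eps : R, 0 < eps ->
    relatively_dense
      [set t | forall s, Normc.normc (F (t + s) - F s) <= eps].

Definition translate F (t : G) : {uniform G -> Cplx R} := fun s => F (t + s).

(* The topology of [{uniform G -> Cplx R}] is that of the supremum norm. *)
Definition hull_set F : set {uniform G -> Cplx R} :=
  closure (range (translate F)).

Lemma translate_hull F t : translate F t \in hull_set F.
Proof. by apply/mem_set/subset_closure; exists t. Qed.

Definition hull F : Type := set_type (hull_set F).

HB.instance Definition _ F := Topological.on (hull F).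

Definition hull_map F (t : G) : hull F :=
  exist _ (translate F t) (translate_hull F t).

HB.instance Definition _ F := isPointed.Build (hull F) (hull_map F 0).

Definition hull_eval0 F (E : hull F) : Cplx R := (\val E : G -> Cplx R) 0.

(* For almost periodic F there is exactly one such law. *)
Definition hull_group_law F (add : hull F -> hull F -> hull F) : Prop :=
  [/\ abelian_topgroup_law add, continuous (hull_map F) &
      forall s t, hull_map F (s + t) = add (hull_map F s) (hull_map F t)].

Definition haar_probability F (add : hull F -> hull F -> hull F)
    (mu : probability (borel (hull F)) R) : Prop :=
  forall (x : hull F) (A : set (borel (hull F))), measurable A ->
    mu (add x @^-1` A) = mu A.

(* The frequencies of H = h \o hull_map F.  The coefficient of h at a character
   gam of the hull is its inner product with gam for the Haar probability,
   which is determined by F like the group law. *)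
Definition frequencies_of F (h : hull F -> Cplx R) : set (G -> Cplx R) :=
  [set gam \o hull_map F | gam in
    [set gam : hull F -> Cplx R |
      exists (add : hull F -> hull F -> hull F)
             (mu : probability (borel (hull F)) R),
        [/\ hull_group_law add, haar_probability add mu,
            characters add gam &
            L2inner mu (h : borel (hull F) -> Cplx R) gam <> 0]]].

Definition frequencies F : set (G -> Cplx R) := frequencies_of (@hull_eval0 F).

End AlmostPeriodicity.

Section DynamicalSystem.
Context (R : realType) (X : ptopologicalType) (G : topologicalZmodType).
Variables (act : G -> X -> X) (m : probability (borel X) R).

Definition metric_inducing_topology (d : X -> X -> R) : Prop :=
  [/\ forall x y, d x y = 0 <-> x = y,
      forall x y, d x y = d y x,
      forall x y z, d x z <= d x y + d y z &
      forall (x : X) (A : set X),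
        nbhs x A <-> exists2 eps : R, 0 < eps & [set y | d x y < eps] `<=` A].

Definition sigma_compact (T : topologicalType) : Prop :=
  exists2 K : nat -> set T, forall n, compact (K n) &
    \bigcup_n K n = [set: T].

Definition continuous_action : Prop :=
  [/\ forall x, act 0 x = x,
      forall s t x, act (s + t) x = act s (act t x) &
      continuous (fun p : G * X => act p.1 p.2)].

Definition invariant_measure : Prop :=
  forall (t : G) (A : set (borel X)), measurable A ->
    m (act t @^-1` A) = m A.

Definition eigenfunction (gam : G -> Cplx R) (f : borel X -> Cplx R) : Prop :=
  [/\ memL2 m f,
      ~ {ae m, forall x, f x = 0} &
      forall t, {ae m, forall x, f (act t x) = gam t * f x}].

Definition eigenvalues : set (G -> Cplx R) :=
  [set gam : G -> Cplx R | dual gam /\ exists f, eigenfunction gam f].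

Definition eigenvalue_group : set (G -> Cplx R) :=
  generated_subgroup eigenvalues.

Definition discrete_spectrum : Prop :=
  exists2 E : set (borel X -> Cplx R), orthonormal_basis m E &
    forall e, E e -> exists2 gam, dual gam & eigenfunction gam e.

Definition mean_displacement (d : X -> X -> R) (t : G) : R :=
  \int[m]_x d x (act t x).

End DynamicalSystem.

(* Main.v *)
Require Import Defs.
From HB Require Import structures.
From mathcomp Require Import all_boot all_order all_algebra.
From mathcomp Require Import all_classical all_reals all_analysis measurable_realfun.
From mathcomp Require Import complex ring lra zify.

Set Implicit Arguments.
Unset Strict Implicit.
Unset Printing Implicit Defensive.

Import Order.TTheory GRing.Theory Num.Theory.
Import numFieldNormedType.Exports.
Local Open Scope classical_set_scope.
Local Open Scope ring_scope.
Local Open Scope complex_scope.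

(** Write [disp t] for the mean displacement.  Since the action preserves the
  measure, [disp (s - t)] is an invariant pseudometric on [G], and the distance
  of two translates of [disp] in the supremum norm is [disp (s - t)]
  ([hull_dist_map]).  The hull [K] is therefore the completion of [G] for this
  pseudometric: a metric abelian group, compact as soon as [disp] is almost
  periodic ([hull_compact], [exists_completion_group]), on which [disp] becomes
  the distance to the neutral element ([hull_eval0E]).  Two facts link this
  group with the dynamical system.

  The first is that the displacement controls the action: for every measurable
  set [A], the measure of the points that leave [A] under [t] is small when
  [disp t] is small ([almost_fixed_measurable]).  Hence the orbit of an
  indicator in [L^2] is uniformly continuous for the metric of [K], and it has
  Fourier coefficients with respect to the characters of [K], which are
  eigenfunctions ([limit_eigen]).  Trigonometric polynomials on [K] that are
  concentrated near the neutral element ([concentrated_polynomial]) show that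
  these eigenfunctions approximate the indicator ([approx_eigenfunctions]).  As
  the measurable sets are generated by a countable pi-system, countably many
  eigenfunctions suffice, and the Gram-Schmidt process gives discrete spectrum
  ([discrete_spectrum_of_approx]).  The control of the action also makes
  every eigenvalue uniformly continuous for the displacement
  ([eigenvalue_ucont]), so that it extends to a character of [K]
  ([extend_eigenvalue]).

  The second is that discrete spectrum makes [disp] a uniform limit of linear
  combinations of eigenvalues ([disp_approx]): approximate [d x y] by finite
  sums of products of a function of [x] and a function of [y], and expand the
  latter into eigenfunctions.  Such limits are almost periodic
  ([almost_periodic_of_span]), and their frequencies are eigenvalues, because a
  character of [K] that is not an eigenvalue is orthogonal to all extended
  eigenvalues ([frequency_eigenvalue]).

  Conversely the frequencies separate the points of [K]: if every frequency is
  1 at [k], then the distance to the neutral element and its translate by [k]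
  have the same Fourier coefficients, which forces [k] to be neutral
  ([frequencies_separate]).  A group of characters that separates points
  contains all characters ([separating_group_full]), hence every eigenvalue lies
  in the group generated by the frequencies.

  The harmonic analysis on [K] is developed for compact metric abelian groups:
  the invariant probability is built from covering numbers
  ([exists_isometry_invariant_probability]), and characters are obtained from
  the eigenspaces of convolution operators, on which translations act by
  commuting matrices ([exists_character_not_orthogonal]). *)

(** * Limits along an ultrafilter *)

Section UltraLimit.
Context (R : realType).
Implicit Types u v : nat -> R.

Definition bounded_seq u := exists M : R, forall n, `|u n| <= M.

(** A free ultrafilter gives every bounded sequence a limit that is additive
  and monotone, so that no subsequences have to be extracted. *)
Definition ultra : set_system nat :=
  sval (cid (ultraFilterLemma (@eventually_filter))).

#[local] Instance ultra_ultra : UltraFilter ultra.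
Proof. by rewrite /ultra; case: cid => F []. Qed.

Lemma near_ultra (P : nat -> Prop) : (\forall n \near \oo, P n) -> ultra P.
Proof. by rewrite /ultra; case: cid => F /= [_]; apply. Qed.

Definition ulim u : R := lim (u @ ultra).

(** A segment is compact, so the image ultrafilter has a cluster point, and
  an ultrafilter converges to its cluster points. *)
Lemma ulim_cvg u : bounded_seq u -> u @ ultra --> ulim u.
Proof.
move=> [M uM]; suff : cvg (u @ ultra) by [].
have [] := @segment_compact R (- M) M (u @ ultra) _.
  rewrite nbhs_filterE /fmap; apply: filterS (@filterT _ ultra _) => n _ /=.
  by rewrite in_itv/= -ler_norml.
move=> l [_ lu]; apply/cvg_ex; exists l => B lB; rewrite nbhs_filterE /fmap/=.
have [//|nB] := in_ultra_setVsetC (u @^-1` B) ultra_ultra.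
by have [y [/= ? ?]] := lu (~` B) B nB lB.
Qed.

Lemma ulim_near u (e : R) : bounded_seq u -> 0 < e ->
  ultra [set n | `|u n - ulim u| < e].
Proof.
by move=> /ulim_cvg/cvgrPdist_lt /[apply]; apply: filterS => n /=; rewrite distrC.
Qed.

Lemma ulim_unique u l : u @ ultra --> l -> ulim u = l.
Proof. by move/cvg_lim; apply; exact: Rhausdorff. Qed.

Lemma ulim_le u v : bounded_seq u -> bounded_seq v ->
  (\forall n \near \oo, u n <= v n) -> ulim u <= ulim v.
Proof.
move=> /ulim_cvg hu /ulim_cvg hv uv.
exact: (ler_cvg_to hu hv (near_ultra uv)).
Qed.

Lemma bounded_seqD u v : bounded_seq u -> bounded_seq v ->
  bounded_seq (fun n => u n + v n).
Proof.
move=> [M uM] [N vN]; exists (M + N) => n.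
by rewrite (le_trans (ler_normD _ _))// lerD.
Qed.

Lemma ulimD u v : bounded_seq u -> bounded_seq v ->
  ulim (fun n => u n + v n) = ulim u + ulim v.
Proof. by move=> /ulim_cvg hu /ulim_cvg hv; apply: ulim_unique; exact: cvgD. Qed.

Lemma ulim_cst (c : R) : ulim (fun=> c) = c.
Proof. by apply: ulim_unique; exact: cvg_cst. Qed.

End UltraLimit.
#[global] Existing Instance ultra_ultra.

(** * Compact metric spaces *)

Section Metric.
Context (R : realType) (X : ptopologicalType) (d : X -> X -> R).
Hypothesis dm : metric_inducing_topology d.

Lemma dxx x : d x x = 0.
Proof. by case: dm => h _ _ _; apply/h. Qed.

Lemma d_eq0 x y : d x y = 0 -> x = y.
Proof. by case: dm => h _ _ _ /h. Qed.

Lemma d_sym x y : d x y = d y x.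
Proof. by case: dm. Qed.

Lemma d_tri x y z : d x z <= d x y + d y z.
Proof. by case: dm. Qed.

Lemma d_ge0 x y : 0 <= d x y.
Proof. have := d_tri x y x; rewrite dxx (d_sym y x); lra. Qed.

Lemma d_lip x x' y y' : `|d x y - d x' y'| <= d x x' + d y y'.
Proof.
have := d_tri x x' y; have := d_tri x' y' y; have := d_tri x' x y'.
have := d_tri x y y'; rewrite (d_sym x' x) (d_sym y' y) => *.
by rewrite ler_norml; apply/andP; split; lra.
Qed.

Definition mball x (e : R) := [set y | d x y < e].

Lemma nbhs_mball x (e : R) : 0 < e -> nbhs x (mball x e).
Proof. by case: dm => _ _ _ h e0; apply/h; exists e. Qed.

Lemma mopenP (A : set X) :
  open A <-> forall x, A x -> exists2 e : R, 0 < e & mball x e `<=` A.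
Proof.
rewrite openE; case: dm => _ _ _ h.
by split => [Ao x /Ao /h|Ao x /Ao ?]; [exact | apply/h].
Qed.

Lemma open_mball x (e : R) : open (mball x e).
Proof.
apply/mopenP => y /= xy; exists (e - d x y) => [|z /= yz].
  by rewrite subr_gt0.
by have := d_tri x y z; move: yz; rewrite /mball/=; lra.
Qed.

(** On a compact space this is continuity. The metric is an explicit argument
  because the same space of functions is used on the hull, whose metric is
  constructed. *)
Definition ucont (f : X -> R) := forall e : R, 0 < e ->
  exists2 del : R, 0 < del & forall x y, d x y < del -> `|f x - f y| < e.

Lemma ucont_measurable (f : X -> R) : ucont f ->
  measurable_fun [set: borel X] (f : borel X -> R).
Proof.
move=> fc _; apply: (measurability _ (@measurable_realfun.RGenOInfty.measurableE R)) => // _ [_ [a ->] <-].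
rewrite setTI; apply: sub_sigma_algebra; apply/mopenP => x /=.
rewrite in_itv/= andbT => ax.
have [|del del0 h] := fc (f x - a); first by rewrite subr_gt0.
exists del => // y /h; rewrite ltr_norml => /andP[_ ?] /=.
by rewrite in_itv/= andbT; lra.
Qed.

Lemma borel_open (A : set X) : open A -> measurable (A : set (borel X)).
Proof. by move=> ?; apply: sub_sigma_algebra. Qed.

Hypothesis Xc : compact [set: X].

Lemma compact_ball_cover (r : X -> R) : (forall x, 0 < r x) ->
  exists s : seq X, forall y, exists2 x, x \in s & d x y < r x.
Proof.
move=> r0; move: Xc; rewrite compact_cover.
move=> /(_ X setT (fun x => mball x (r x))) [].
- by move=> *; exact: open_mball.
- by move=> x _; exists x => //=; rewrite /mball/= dxx.
- move=> D _ Dcov; exists (finmap.enum_fset D) => y.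
  by have [x xD xy] := Dcov y I; exists x.
Qed.

Lemma finite_net (e : R) : 0 < e ->
  exists (n : nat) (c : nat -> X), forall y, exists2 i, (i < n)%N & d (c i) y < e.
Proof.
move=> e0; have [s sP] := compact_ball_cover (fun=> e0).
exists (size s), (nth point s) => y; have [x xs xy] := sP y.
by exists (index x s); rewrite ?index_mem// nth_index.
Qed.

(** The first net point within distance [e] labels the cell of [x]. *)
Lemma measurable_cells (e : R) : 0 < e ->
  exists (n : nat) (c : nat -> X) (cell : X -> 'I_n.+1),
    (forall x, d (c (cell x)) x < e) /\
    (forall i, measurable (cell @^-1` [set i] : set (borel X))).
Proof.
move=> /finite_net[n [c cP]].
case: n cP => [|n] cP; first by have [] := cP point.
have P x : exists i : nat, d (c i) x < e by have [i _] := cP x; exists i.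
pose f x := ex_minn (P x).
have fP x : (f x < n.+1)%N /\ d (c (f x)) x < e.
  rewrite /f; case: ex_minnP => m mP mm; split => //.
  by have [i ilt /mm] := cP x; move/leq_ltn_trans; exact.
pose cell x : 'I_n.+1 := Ordinal (fP x).1.
exists n, c, cell; split=> [x|i]; first exact: (fP x).2.
have -> : cell @^-1` [set i] =
    mball (c i) e `\` \bigcup_(j in [set j | (j < i)%N]) mball (c j) e.
  apply/seteqP; split => x /=.
    move=> <-; split; first exact: (fP x).2.
    move=> [j /= ji]; rewrite /mball/= => jx.
    move: ji; rewrite /f/=; case: ex_minnP => m _ /(_ _ jx) + ?; lia.
  move=> [xi xj]; apply/val_inj => /=; rewrite /f; case: ex_minnP => m mP mm.
  apply/eqP; rewrite eqn_leq mm//= leqNgt; apply/negP => mi; apply: xj.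
  by exists m.
apply: measurableD; first by apply: borel_open; exact: open_mball.
by apply: bigcup_measurable => j _; apply: borel_open; exact: open_mball.
Qed.

(** Heine's theorem. *)
Lemma compact_ucont (f : X -> R) :
  (forall x (e : R), 0 < e -> exists2 del : R, 0 < del &
     forall y, d x y < del -> `|f x - f y| < e) -> ucont f.
Proof.
move=> fc e e0.
have e20 : 0 < e / 2 by lra.
pose r x := sval (cid2 (fc x _ e20)) / 2.
have r0 x : 0 < r x by rewrite /r; case: cid2 => /= *; lra.
have rP x y : d x y < r x + r x -> `|f x - f y| < e / 2.
  by rewrite /r; case: cid2 => /= del del0 h ?; apply: h; lra.
have [s sP] := compact_ball_cover r0.
exists (\big[Order.min/1]_(x <- s) r x).
  by apply: lt_bigmin => // x _; exact: r0.
move=> x y xy; have [z zs zx] := sP x.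
have zxy : d x y < r z by rewrite (lt_le_trans xy)// ge_bigmin_seq.
have zy : d z y < r z + r z by rewrite (le_lt_trans (d_tri _ x _))// ltrD.
have zx' : d z x < r z + r z by rewrite (lt_trans zx)// ltrDl.
have := rP _ _ zx'; have := rP _ _ zy; rewrite !ltr_norml; lra.
Qed.

Lemma ucont_bounded (f : X -> R) : ucont f ->
  exists2 M : R, 0 < M & forall x, `|f x| <= M.
Proof.
move=> /(_ 1 ltr01)[del del0 h].
have [n [c cP]] := finite_net del0.
exists (\sum_(i < n) `|f (c i)| + 1) => [|x].
  by rewrite ltr_wpDl// sumr_ge0.
have [i ilt /h fx] := cP x.
have -> : f x = f (c i) - (f (c i) - f x) by ring.
rewrite (le_trans (ler_normB _ _))// lerD//; last exact: ltW.
rewrite (bigD1 (Ordinal ilt))//= lerDl sumr_ge0//.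
Qed.

End Metric.

(** * A measure invariant under all isometries *)

Section Haar.
Context (R : realType) (K : ptopologicalType) (d : K -> K -> R).
Hypothesis dm : metric_inducing_topology d.
Hypothesis Kc : compact [set: K].

Definition covers (r : R) (A : set K) (n : nat) :=
  exists2 s : seq K, size s = n & forall a, A a -> exists2 c, c \in s & d c a < r.

Lemma ex_covers (r : R) A : 0 < r -> exists n, `[< covers r A n >].
Proof.
move=> r0; have [s sP] := compact_ball_cover dm Kc (fun=> r0).
by exists (size s); apply/asboolP; exists s.
Qed.

Definition covnum (r : R) A : nat :=
  match pselect (0 < r) with
  | left r0 => ex_minn (ex_covers A r0)
  | right _ => 0
  end.

Lemma covnumP (r : R) A : 0 < r -> covers r A (covnum r A).
Proof.
by rewrite /covnum; case: pselect => // r0 _; case: ex_minnP => m /asboolP.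
Qed.

Lemma covnum_min (r : R) A n : covers r A n -> (covnum r A <= n)%N.
Proof.
rewrite /covnum; case: pselect => // r0 cn; case: ex_minnP => m _; apply.
exact/asboolP.
Qed.

Lemma le_covnum (r : R) A B : 0 < r -> A `<=` B -> (covnum r A <= covnum r B)%N.
Proof.
move=> r0 AB; apply: covnum_min; have [s <- sP] := covnumP B r0.
by exists s => // a /AB /sP.
Qed.

Lemma covnum0 (r : R) : covnum r set0 = 0%N.
Proof. by apply/eqP; rewrite -leqn0; apply: covnum_min; exists [::]. Qed.

Lemma covnumT_gt0 (r : R) : 0 < r -> (0 < covnum r setT)%N.
Proof.
move=> r0; have [s <- sP] := covnumP setT r0.
by have [c + _] := sP point I; case: s {sP}.
Qed.

Lemma covnumU (r : R) A B : 0 < r ->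
  (covnum r (A `|` B) <= covnum r A + covnum r B)%N.
Proof.
move=> r0; apply: covnum_min.
have [s <- sP] := covnumP A r0; have [t <- tP] := covnumP B r0.
exists (s ++ t); first by rewrite size_cat.
by move=> a [/sP|/tP] [c cs ca]; exists c => //; rewrite mem_cat cs ?orbT.
Qed.

(** No ball of radius [r] meets two sets at distance at least [2 r]. *)
Lemma covnum_separated (r : R) A B : 0 < r ->
  (forall a b, A a -> B b -> r + r <= d a b) ->
  (covnum r A + covnum r B <= covnum r (A `|` B))%N.
Proof.
move=> r0 AB; have [s <- sP] := covnumP (A `|` B) r0.
pose p (C : set K) c := `[< exists2 a, C a & d c a < r >].
have h C : C `<=` A `|` B -> (covnum r C <= count (p C) s)%N.
  move=> CAB; apply: covnum_min; exists [seq c <- s | p C c].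
    by rewrite size_filter.
  move=> a Ca; have [c cs ca] := sP _ (CAB _ Ca).
  by exists c => //; rewrite mem_filter cs andbT; apply/asboolP; exists a.
apply: (leq_trans (leq_add (h A _) (h B _))).
- exact: subsetUl.
- exact: subsetUr.
rewrite -count_predUI [X in (_ + X)%N](_ : _ = 0%N).
  by rewrite addn0 count_size.
apply/eqP; rewrite -leqn0 leqNgt -has_count; apply/negP => /hasP[c _ /=].
move=> /andP[/asboolP[a Aa ca] /asboolP[b Bb cb]].
have := d_tri dm a c b; rewrite (d_sym dm a c); have := AB _ _ Aa Bb; lra.
Qed.

Lemma covnum_isometry (r : R) f g A : 0 < r -> cancel f g -> cancel g f ->
  (forall x y, d (f x) (f y) = d x y) -> covnum r (f @^-1` A) = covnum r A.
Proof.
move=> r0 fg gf df.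
have dg x y : d (g x) (g y) = d x y by rewrite -df !gf.
have h (u v : K -> K) B : cancel u v -> cancel v u ->
    (forall x y, d (u x) (u y) = d x y) -> (covnum r (u @^-1` B) <= covnum r B)%N.
  move=> uv vu du; apply: covnum_min; have [s <- sP] := covnumP B r0.
  exists (map v s); first by rewrite size_map.
  move=> a /= /sP[c cs ca]; exists (v c); first exact: map_f.
  by rewrite -du vu.
apply/eqP; rewrite eqn_leq (h f g)//=.
have {1}-> : covnum r A = covnum r (g @^-1` (f @^-1` A)).
  by congr covnum; apply/seteqP; split => x /=; rewrite gf.
exact: h.
Qed.

Definition mesh n : R := n.+1%:R^-1.

Lemma mesh_gt0 n : 0 < mesh n. Proof. by rewrite invr_gt0 ltr0n. Qed.

Lemma near_mesh (e : R) : 0 < e -> \forall n \near \oo, mesh n + mesh n <= e.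
Proof.
move=> e0; have e20 : 0 < e / 2 by lra.
near=> n; have : mesh n < e / 2; last by lra.
near: n; exact: (near_infty_natSinv_lt (PosNum e20)).
Unshelve. all: by end_near. Qed.

(** The normalised covering numbers need not converge; an ultrafilter limit
  keeps their monotonicity, subadditivity, additivity on separated sets and
  isometry invariance. *)
Definition ratio (A : set K) n : R :=
  (covnum (mesh n) A)%:R / (covnum (mesh n) setT)%:R.

Definition content A : R := ulim (ratio A).

Lemma covnumT_posr n : 0 < (covnum (mesh n) setT)%:R :> R.
Proof. by rewrite ltr0n covnumT_gt0// mesh_gt0. Qed.

Lemma ratio_bounded A : bounded_seq (ratio A).
Proof.
exists 1 => n; rewrite ger0_norm ?divr_ge0 ?ler0n//.
by rewrite ler_pdivrMr ?covnumT_posr// mul1r ler_nat le_covnum// mesh_gt0.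
Qed.
Hint Resolve ratio_bounded : core.

Lemma le_ratio A B n : A `<=` B -> ratio A n <= ratio B n.
Proof.
move=> AB; rewrite ler_pM2r ?invr_gt0 ?covnumT_posr//.
by rewrite ler_nat le_covnum// mesh_gt0.
Qed.

Lemma le_content A B : A `<=` B -> content A <= content B.
Proof. by move=> AB; apply: ulim_le => //; near=> n; exact: le_ratio.
Unshelve. all: by end_near. Qed.

Lemma content0 : content set0 = 0.
Proof.
rewrite /content (_ : ratio _ = fun=> 0) ?ulim_cst//.
by apply/funext => n; rewrite /ratio covnum0 mul0r.
Qed.

Lemma contentT : content setT = 1.
Proof.
rewrite /content (_ : ratio _ = fun=> 1) ?ulim_cst//.
by apply/funext => n; rewrite /ratio divff// gt_eqF ?covnumT_posr.
Qed.

Lemma content_le1 A : content A <= 1.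
Proof. by rewrite -contentT le_content. Qed.

Lemma contentU A B : content (A `|` B) <= content A + content B.
Proof.
rewrite -ulimD//; apply: ulim_le => //; first exact: bounded_seqD.
near=> n; rewrite /ratio -mulrDl ler_pM2r ?invr_gt0 ?covnumT_posr//.
by rewrite -natrD ler_nat covnumU// mesh_gt0.
Unshelve. all: by end_near. Qed.

Lemma content_separated (e : R) A B : 0 < e ->
  (forall a b, A a -> B b -> e <= d a b) ->
  content A + content B <= content (A `|` B).
Proof.
move=> e0 AB; rewrite -ulimD//; apply: ulim_le => //; first exact: bounded_seqD.
near=> n; rewrite /ratio -mulrDl ler_pM2r ?invr_gt0 ?covnumT_posr//.
rewrite -natrD ler_nat covnum_separated// ?mesh_gt0// => a b Aa Bb.
by rewrite (le_trans _ (AB _ _ Aa Bb))//; near: n; exact: near_mesh.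
Unshelve. all: by end_near. Qed.

Lemma content_isometry f g A : cancel f g -> cancel g f ->
  (forall x y, d (f x) (f y) = d x y) -> content (f @^-1` A) = content A.
Proof.
move=> fg gf df; congr ulim; apply/funext => n; rewrite /ratio.
by rewrite (covnum_isometry _ _ fg gf)// mesh_gt0.
Qed.

Lemma content_bigcup (P : nat -> set K) n :
  content (\bigcup_(i < n) P i) <= \sum_(i < n) content (P i).
Proof.
rewrite bigcup_mkord; elim: n => [|n ih]; first by rewrite !big_ord0 content0.
by rewrite !big_ord_recr/= (le_trans (contentU _ _))// lerD2r.
Qed.

(** [W] lies well inside [V]: this is the metric substitute for compact
  inclusion in the inner regular extension of [content] to open sets. *)
Definition inside (W V : set K) :=
  exists2 e : R, 0 < e & forall w, W w -> mball d w e `<=` V.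

Lemma inside_sub W V : inside W V -> W `<=` V.
Proof. by move=> [e e0 h] w /h; apply; rewrite /mball/= (dxx dm). Qed.

Definition open_content V : R := sup [set content W | W in inside ^~ V].

Let oc_sup V : has_sup [set content W | W in inside ^~ V].
Proof.
split; first by exists (content set0), set0 => //; exists 1.
by exists 1 => _ [W _ <-]; exact: content_le1.
Qed.

Lemma open_content_ge W V : inside W V -> content W <= open_content V.
Proof. by move=> WV; apply: ub_le_sup; [case: (oc_sup V) | exists W]. Qed.

Lemma open_content_le V x : (forall W, inside W V -> content W <= x) ->
  open_content V <= x.
Proof. by move=> h; apply: ge_sup; [case: (oc_sup V)|move=> _ [W /h ? <-]]. Qed.

Lemma open_content_adherent V (e : R) : 0 < e ->
  exists2 W, inside W V & open_content V - e < content W.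
Proof. by move=> e0; have [_ [W WV <-] ?] := sup_adherent e0 (oc_sup V); exists W. Qed.

Lemma open_content_ge0 V : 0 <= open_content V.
Proof. by rewrite -content0 open_content_ge//; exists 1. Qed.

Lemma le_open_content V V' : V `<=` V' -> open_content V <= open_content V'.
Proof.
move=> VV'; apply: open_content_le => W [e e0 We].
by apply: open_content_ge; exists e => // w /We /subset_trans; exact.
Qed.

Lemma open_contentT : open_content setT = 1.
Proof.
apply/eqP; rewrite eq_le; apply/andP; split.
  by apply: open_content_le => W _; exact: content_le1.
by rewrite -contentT open_content_ge//; exists 1.
Qed.

Lemma open_content0 : open_content set0 = 0.
Proof.
apply/eqP; rewrite eq_le open_content_ge0 andbT.
apply: open_content_le => W /inside_sub; rewrite subset0 => ->.
by rewrite content0.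
Qed.

(** By compactness a set well inside a countable union of open sets splits into
  finitely many pieces, each well inside one of them. *)
Lemma open_content_bigcup (V : nat -> set K) W : (forall i, open (V i)) ->
  inside W (\bigcup_i V i) ->
  exists n, content W <= \sum_(i < n) open_content (V i).
Proof.
move=> Vo [e e0 We].
have P x : exists ir : nat * R, 0 < ir.2 /\
   forall w, W w -> d x w < ir.2 -> mball d x (ir.2 + ir.2) `<=` V ir.1.
  have [[w Ww xw]|nW] := pselect (exists2 w, W w & d x w < e).
    have [|i _ Vix] := We _ Ww x; first by rewrite /mball/= (d_sym dm).
    have /(mopenP dm) /(_ _ Vix) [e' e'0 h] := Vo i.
    exists (i, e' / 2); split => /=; first lra.
    by move=> _ _ _; rewrite -splitr.
  exists (0%N, e); split => //= w Ww xw; case: nW; by exists w.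
have [ir irP] := choice P.
have [s sP] := compact_ball_cover dm Kc (fun x => (irP x).1).
pose n := (\max_(x <- s) (ir x).1).+1; exists n.
pose r0 := \big[Order.min/1]_(x <- s) (ir x).2.
have r00 : 0 < r0 by apply: lt_bigmin => // x _; exact: (irP x).1.
pose P' i := [set w | W w /\ mball d w r0 `<=` V i].
apply: (@le_trans _ _ (content (\bigcup_(i < n) P' i))).
  apply: le_content => w Ww.
  have [x xs xw] := sP w; exists (ir x).1 => /=.
    by rewrite ltnS /n; exact: leq_bigmax_seq.
  split => // y; rewrite /mball/= => wy; apply: ((irP x).2 w Ww xw) => /=.
  have : d w y < (ir x).2 by rewrite (lt_le_trans wy)// ge_bigmin_seq.
  by move: xw; rewrite /mball/=; have := d_tri dm x w y; lra.
rewrite (le_trans (content_bigcup _ _))// ler_sum// => i _.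
by apply: open_content_ge; exists r0 => // w [].
Qed.

Definition outer (A : set K) : R :=
  inf [set open_content V | V in [set V | open V /\ A `<=` V]].

Let outer_inf A : has_inf [set open_content V | V in [set V | open V /\ A `<=` V]].
Proof.
split; first by exists (open_content setT), setT => //; split => //; exact: openT.
by exists 0 => _ [V _ <-]; exact: open_content_ge0.
Qed.

Lemma outer_le A V : open V -> A `<=` V -> outer A <= open_content V.
Proof. by move=> Vo AV; apply: ge_inf; [case: (outer_inf A)|exists V]. Qed.

Lemma outer_adherent A (e : R) : 0 < e ->
  exists V, [/\ open V, A `<=` V & open_content V < outer A + e].
Proof.
by move=> e0; have [_ [V [Vo AV] <-] ?] := inf_adherent e0 (outer_inf A); exists V.
Qed.

Lemma outer_ge A x : (forall V, open V -> A `<=` V -> x <= open_content V) ->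
  x <= outer A.
Proof. by move=> h; apply: lb_le_inf; [case: (outer_inf A)|move=> _ [V [? ?] <-]; exact: h]. Qed.

Lemma outer_open V : open V -> outer V = open_content V.
Proof.
move=> Vo; apply/eqP; rewrite eq_le outer_le//=.
by apply: outer_ge => V' _; exact: le_open_content.
Qed.

Lemma outer_ge0 A : 0 <= outer A.
Proof. by apply: outer_ge => V _ _; exact: open_content_ge0. Qed.

Lemma le_outer A B : A `<=` B -> outer A <= outer B.
Proof.
move=> AB; apply: outer_ge => V Vo BV; apply: outer_le => //.
exact: subset_trans BV.
Qed.

Lemma outer0 : outer set0 = 0.
Proof. by rewrite outer_open ?open_content0//; exact: open0. Qed.

Lemma outerT : outer setT = 1.
Proof. by rewrite outer_open ?open_contentT//; exact: openT. Qed.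

Lemma outer_isometry f g A : cancel f g -> cancel g f ->
  (forall x y, d (f x) (f y) = d x y) -> outer (f @^-1` A) = outer A.
Proof.
have h u v B : cancel u v -> cancel v u -> (forall x y, d (u x) (u y) = d x y) ->
    outer (u @^-1` B) <= outer B.
  move=> uv vu du; apply: outer_ge => V Vo BV.
  have dv x y : d (v x) (v y) = d x y by rewrite -du !vu.
  apply: (@le_trans _ _ (open_content (u @^-1` V))).
    apply: outer_le; last by move=> x /BV.
    apply/(mopenP dm) => x /= Vux; have /(mopenP dm)/(_ _ Vux)[e e0 eV] := Vo.
    by exists e => // y xy; apply: eV; rewrite /mball/= du.
  apply: open_content_le => W [e e0 We].
  rewrite -(content_isometry W vu uv dv); apply: open_content_ge; exists e => //.
  move=> w /= /We wV y wy; rewrite -(vu y); apply: wV => /=.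
  by rewrite /mball/= dv.
move=> fg gf df; have dg x y : d (g x) (g y) = d x y by rewrite -df !gf.
apply/eqP; rewrite eq_le (h f g)//=.
have {1}-> : A = g @^-1` (f @^-1` A) by apply/seteqP; split => x /=; rewrite gf.
exact: (h g f).
Qed.

Definition eouter (A : set K) : \bar R := (outer A)%:E.

(** Open sets that exceed the outer measure of [F i] by less than [e / 2 ^
  i.+1] reduce this to [open_content_bigcup]. *)
Lemma eouter_sigma_subadditive : sigma_subadditive eouter.
Proof.
move=> F; apply/lee_addgt0Pr => e e0.
have ei i : 0 < e / 2 ^+ i.+1 by rewrite divr_gt0 ?exprn_gt0.
pose V i := sval (cid (outer_adherent (F i) (ei i))).
have VP i : [/\ open (V i), F i `<=` V i &
    open_content (V i) < outer (F i) + e / 2 ^+ i.+1].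
  by rewrite /V; case: cid.
have Vo i : open (V i) by case: (VP i).
have -> : eouter (\bigcup_n F n) = (outer (\bigcup_n F n))%:E by [].
set S := limn _; have [->|Snoo] := eqVneq S +oo%E.
  by rewrite addye// leey.
have S0 : (0 <= S)%E by apply: nneseries_ge0 => n _ _; rewrite lee_fin outer_ge0.
have Sfin : S \is a fin_num by rewrite ge0_fin_numE// ltey.
rewrite -(fineK Sfin) -EFinD lee_fin.
have SP n : \sum_(i < n) outer (F i) <= fine S.
  rewrite -lee_fin fineK// -sumEFin -(big_mkord xpredT (fun i => (outer (F i))%:E)).
  by apply: nneseries_lim_ge => i _ _; rewrite lee_fin outer_ge0.
apply: (@le_trans _ _ (open_content (\bigcup_i V i))).
  apply: outer_le; first exact: bigcup_open.
  by move=> x [i _ Fx]; exists i => //; have [_ h _] := VP i; exact: h.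
apply: open_content_le => W WV.
have [n hn] := open_content_bigcup Vo WV; apply: (le_trans hn).
apply: (@le_trans _ _ (\sum_(i < n) (outer (F i) + e / 2 ^+ i.+1))).
  by apply: ler_sum => i _; have [_ _ /ltW] := VP i.
rewrite big_split/= lerD ?SP// [leLHS](_ : _ = e * (1 - 2^-1 ^+ n)); last first.
  elim: n {hn} => [|n ih]; first by rewrite big_ord0 expr0 subrr mulr0.
  by rewrite big_ord_recr/= ih -exprVn exprS; field.
rewrite -[leRHS]mulr1 ler_pM2l// gerBl exprn_ge0//.
Qed.

HB.instance Definition _ := isOuterMeasure.Build R K eouter
  (congr1 EFin outer0) (fun A => outer_ge0 A)
  (fun A B AB => le_outer AB) eouter_sigma_subadditive.

(** A set well inside [V `&` U] and a set well inside the part of [V] that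
  keeps a positive distance from the first one are separated, so [content]
  adds up on them; both can be chosen to exhaust the two parts of [V]. *)
Lemma open_caratheodory U : open U -> caratheodory_measurable eouter U.
Proof.
move=> Uo; apply: le_caratheodory_measurable => A.
rewrite -EFinD lee_fin; apply: outer_ge => V Vo AV.
apply/ler_addgt0Pr => e e0; have e20 : 0 < e / 2 by lra.
have VUo : open (V `&` U) by exact: openI.
have [W [h h0 WVU] Wc] := open_content_adherent (V `&` U) e20.
pose V' := [set v | V v /\ exists2 r : R, h / 2 < r & forall w, W w -> r <= d w v].
have V'o : open V'.
  apply/(mopenP dm) => v [Vv [r hr rW]].
  have /(mopenP dm) /(_ _ Vv) [r' r'0 r'V] := Vo.
  exists (Num.min r' ((r - h / 2) / 2)).
    by rewrite lt_min r'0/=; lra.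
  move=> y; rewrite /mball/= lt_min => /andP[vy vy2]; split; first exact: r'V.
  exists ((r + h / 2) / 2); first lra.
  by move=> w /rW; have := d_tri dm w y v; rewrite (d_sym dm y v); lra.
have [W' WV' W'c] := open_content_adherent V' e20.
have AU : outer (A `&` U) <= open_content (V `&` U).
  by apply: outer_le => // x [/AV].
have AU' : outer (A `&` ~` U) <= open_content V'.
  apply: outer_le => // x [/AV Vx Ux]; split => //; exists h; first lra.
  by move=> w /WVU wU; rewrite leNgt; apply/negP => /wU [_].
have : content W + content W' <= content (W `|` W').
  apply: (@content_separated (h / 2)); first lra.
  by move=> w w' Ww /(inside_sub WV')[_ [r hr]] /(_ _ Ww); lra.
have : content (W `|` W') <= open_content V.
  apply: open_content_ge; case: WV' => h' h'0 W'V'.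
  exists (Num.min h h'); first by rewrite lt_min h0.
  move=> w ww y; rewrite /mball/= lt_min => /andP[wy wy'].
  by case: ww => [/WVU/(_ _ wy)[]|/W'V'/(_ _ wy')[]].
lra.
Qed.

Definition iso_measure (A : set (borel K)) : \bar R := eouter A.

Lemma borel_caratheodory (A : set (borel K)) :
  measurable A -> caratheodory_measurable eouter (A : set K).
Proof.
apply: smallest_sub; last by move=> U; exact: open_caratheodory.
split.
- exact: caratheodory_measurable_set0.
- by move=> B mB; rewrite setTD; exact: caratheodory_measurable_setC.
- by move=> F mF; exact: caratheodory_measurable_bigcup.
Qed.

Lemma iso_measure_sigma_additive : semi_sigma_additive iso_measure.
Proof.
move=> F mF tF mUF; apply: (@caratheodory_measure_sigma_additive R K eouter) => //.
by move=> i; exact: borel_caratheodory.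
exact: borel_caratheodory.
Qed.

Lemma iso_measure0 : iso_measure set0 = 0%E.
Proof. by rewrite /iso_measure /eouter outer0. Qed.

Lemma iso_measure_ge0 A : (0 <= iso_measure A)%E.
Proof. by rewrite lee_fin outer_ge0. Qed.

HB.instance Definition _ := isMeasure.Build _ (borel K) R iso_measure
  iso_measure0 iso_measure_ge0 iso_measure_sigma_additive.

Lemma iso_measureT : iso_measure setT = 1%E.
Proof. by rewrite /iso_measure /eouter outerT. Qed.

HB.instance Definition _ := Measure_isProbability.Build _ (borel K) R iso_measure
  iso_measureT.

(** Covering numbers do not change under isometries, and this passes to every
  later stage of the construction. On a group with an invariant metric the
  result is the Haar probability. *)
Lemma exists_isometry_invariant_probability :
  exists mu : probability (borel K) R, forall f g : K -> K,
    cancel f g -> cancel g f -> (forall x y, d (f x) (f y) = d x y) ->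
    forall A : set (borel K), mu (f @^-1` A) = mu A.
Proof.
exists iso_measure => f g fg gf df A.
by rewrite /= /iso_measure /eouter (outer_isometry _ fg gf).
Qed.

End Haar.

(** * Complex numbers and integrals of complex functions *)

Section ComplexNumbers.
Context (R : realType).
Implicit Types (x y z : Cplx R) (r : R).
Notation Re := complex.Re.
Notation Im := complex.Im.
Notation normc := Normc.normc.

Lemma cplx_eq x y : Re x = Re y -> Im x = Im y -> x = y.
Proof. by case: x y => [a b] [c e] /= -> ->. Qed.

Lemma ReD x y : Re (x + y) = Re x + Re y. Proof. by case: x y => [? ?] [? ?]. Qed.
Lemma ImD x y : Im (x + y) = Im x + Im y. Proof. by case: x y => [? ?] [? ?]. Qed.
Lemma ReN x : Re (- x) = - Re x. Proof. by case: x. Qed.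
Lemma ImN x : Im (- x) = - Im x. Proof. by case: x. Qed.
Lemma ReB x y : Re (x - y) = Re x - Re y. Proof. by rewrite ReD ReN. Qed.
Lemma ImB x y : Im (x - y) = Im x - Im y. Proof. by rewrite ImD ImN. Qed.
Lemma ReM x y : Re (x * y) = Re x * Re y - Im x * Im y.
Proof. by case: x y => [? ?] [? ?]. Qed.
Lemma ImM x y : Im (x * y) = Re x * Im y + Im x * Re y.
Proof. by case: x y => [? ?] [? ?]. Qed.
Lemma ReJ x : Re (x^*)%C = Re x. Proof. by case: x. Qed.
Lemma ImJ x : Im (x^*)%C = - Im x. Proof. by case: x. Qed.
Definition ReImE := (ReB, ImB, ReD, ImD, ReN, ImN, ReM, ImM, ReJ, ImJ).

Lemma Re_sum I (s : seq I) (P : pred I) (F : I -> Cplx R) :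
  Re (\sum_(i <- s | P i) F i) = \sum_(i <- s | P i) Re (F i).
Proof. exact: (big_morph (fun x : Cplx R => Re x) ReD). Qed.

Lemma Im_sum I (s : seq I) (P : pred I) (F : I -> Cplx R) :
  Im (\sum_(i <- s | P i) F i) = \sum_(i <- s | P i) Im (F i).
Proof. exact: (big_morph (fun x : Cplx R => Im x) ImD). Qed.

Lemma normc_ge0 x : 0 <= normc x. Proof. by case: x => a b; exact: sqrtr_ge0. Qed.

Lemma sqr_normcE x : normc x ^+ 2 = Re x ^+ 2 + Im x ^+ 2.
Proof. by case: x => a b; rewrite /= sqr_sqrtr ?addr_ge0 ?sqr_ge0. Qed.

Lemma normrE x : `|x| = (normc x)%:C :> R[i].
Proof. by rewrite (@normc_def R x); case: x. Qed.

Lemma normc_triangle x y : normc (x + y) <= normc x + normc y.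
Proof. exact: le_normcD. Qed.

Lemma normc_opp x : normc (- x) = normc x. Proof. exact: normcN. Qed.

Lemma normc_distC x y : normc (x - y) = normc (y - x).
Proof. by rewrite -normc_opp opprB. Qed.

Lemma normc_mul x y : normc (x * y) = normc x * normc y.
Proof. exact: Normc.normcM. Qed.

Lemma normc_conj x : normc (x^*)%C = normc x.
Proof. by case: x => a b; rewrite /= sqrrN. Qed.

Lemma normc_eq0P x : normc x = 0 -> x = 0. Proof. exact: Normc.eq0_normc. Qed.

Lemma normc_gt0 x : x != 0 -> 0 < normc x.
Proof.
move=> x0; rewrite lt_def normc_ge0 andbT; apply: contra_neq x0.
exact: normc_eq0P.
Qed.

Lemma normc_real r : normc (r%:C : Cplx R) = `|r|.
Proof. by rewrite /= expr0n/= addr0 sqrtr_sqr. Qed.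

Lemma normc_one : normc (1 : Cplx R) = 1. Proof. exact: Normc.normc1. Qed.
Lemma normc_zero : normc (0 : Cplx R) = 0. Proof. exact: Normc.normc0. Qed.

Lemma le_Re_normc x : `|Re x| <= normc x.
Proof.
rewrite -(@ler_pXn2r _ 2) ?nnegrE ?normr_ge0 ?normc_ge0//.
by rewrite real_normK ?num_real// sqr_normcE lerDl sqr_ge0.
Qed.

Lemma le_Im_normc x : `|Im x| <= normc x.
Proof.
rewrite -(@ler_pXn2r _ 2) ?nnegrE ?normr_ge0 ?normc_ge0//.
by rewrite real_normK ?num_real// sqr_normcE lerDr sqr_ge0.
Qed.

Lemma normc_le_ReIm x : normc x <= `|Re x| + `|Im x|.
Proof.
rewrite -(@ler_pXn2r _ 2) ?nnegrE ?addr_ge0 ?normr_ge0 ?normc_ge0//.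
rewrite sqr_normcE sqrrD !real_normK ?num_real//.
have : 0 <= `|Re x| * `|Im x| by rewrite mulr_ge0.
by rewrite mulr2n; lra.
Qed.

Lemma normc_sum I (s : seq I) (P : pred I) (F : I -> Cplx R) :
  normc (\sum_(i <- s | P i) F i) <= \sum_(i <- s | P i) normc (F i).
Proof.
elim/big_rec2: _ => [|i y x _ h]; first by rewrite normc_zero.
by rewrite (le_trans (normc_triangle _ _))// lerD2l.
Qed.

Lemma mulcJ x : x * (x^*)%C = (normc x ^+ 2)%:C.
Proof.
rewrite sqr_normcE; apply: cplx_eq; rewrite !ReImE /=; ring.
Qed.

Lemma normc1_inv x : normc x = 1 -> x^-1 = (x^*)%C.
Proof.
move=> x1; have x0 : x != 0.
  by apply/eqP => x0; move: x1; rewrite x0 normc_zero; lra.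
apply: (mulfI x0); rewrite mulfV// mulcJ x1 expr1n.
by apply: cplx_eq.
Qed.

Lemma normc_sqrD x y :
  normc (x + y) ^+ 2 <= 2 * normc x ^+ 2 + 2 * normc y ^+ 2.
Proof.
rewrite !sqr_normcE !ReImE.
have := sqr_ge0 (Re x - Re y); have := sqr_ge0 (Im x - Im y); lra.
Qed.

End ComplexNumbers.

Section Integrals.
Context (R : realType) (dT : measure_display) (T : measurableType dT).
Variable P : probability T R.
Notation Re := complex.Re.
Notation Im := complex.Im.
Notation normc := Normc.normc.
Implicit Types (f g : T -> R) (h k : T -> Cplx R).

Definition rint f := P.-integrable setT (EFin \o f).
Definition mean f : R := \int[P]_x f x.

Lemma rintD f g : rint f -> rint g -> rint (fun x => f x + g x).
Proof. exact: integrableD. Qed.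

Lemma rintZ (c : R) f : rint f -> rint (fun x => c * f x).
Proof. exact: integrableZl. Qed.

Lemma rintN f : rint f -> rint (fun x => - f x).
Proof. exact: integrableN. Qed.

Lemma rintB f g : rint f -> rint g -> rint (fun x => f x - g x).
Proof. by move=> hf hg; apply: rintD => //; exact: rintN. Qed.

Lemma rint_sum I (s : seq I) (F : I -> T -> R) : (forall i, rint (F i)) ->
  rint (fun x => \sum_(i <- s) F i x).
Proof.
move=> hF; have := @integrable_sum _ T R P setT measurableT I s
  xpredT (fun i => EFin \o F i) (fun i _ => hF i).
by apply: eq_integrable => // x _; rewrite /= sumEFin.
Qed.

Lemma meanD f g : rint f -> rint g ->
  mean (fun x => f x + g x) = mean f + mean g.
Proof. exact: RintegralD. Qed.

Lemma meanZ (c : R) f : rint f -> mean (fun x => c * f x) = c * mean f.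
Proof. exact: RintegralZl. Qed.

Lemma meanN f : rint f -> mean (fun x => - f x) = - mean f.
Proof.
move=> hf; rewrite -mulN1r -meanZ//.
by congr mean; apply/funext => x; rewrite mulN1r.
Qed.

Lemma meanB f g : rint f -> rint g ->
  mean (fun x => f x - g x) = mean f - mean g.
Proof. exact: RintegralB. Qed.

Lemma mean_cst (c : R) : mean (fun=> c) = c.
Proof. by rewrite /mean Rintegral_cst// [X in fine X]probability_setT mulr1. Qed.

Lemma le_mean f g : rint f -> rint g -> (forall x, f x <= g x) ->
  mean f <= mean g.
Proof. by move=> hf hg fg; apply: le_Rintegral. Qed.

Lemma mean_ge0 f : (forall x, 0 <= f x) -> 0 <= mean f.
Proof. by move=> f0; apply: Rintegral_ge0. Qed.

Lemma rint_cst (c : R) : rint (fun=> c).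
Proof. exact: finite_measure_integrable_cst. Qed.

Lemma mean_sum I (s : seq I) (F : I -> T -> R) : (forall i, rint (F i)) ->
  mean (fun x => \sum_(i <- s) F i x) = \sum_(i <- s) mean (F i).
Proof.
move=> hF; elim: s => [|i s ih].
  rewrite big_nil -[RHS](mean_cst 0); congr mean; apply/funext => x.
  by rewrite big_nil.
rewrite big_cons -ih -meanD//; last exact: rint_sum.
by congr mean; apply/funext => x; rewrite big_cons.
Qed.

Definition bmeas f := measurable_fun setT f /\ exists M : R, forall x, `|f x| <= M.

Lemma bmeas_rint f : bmeas f -> rint f.
Proof.
move=> [mf [M fM]]; apply: measurable_bounded_integrable => //.
  by rewrite (le_lt_trans (probability_le1 _ _))// ltry.
exists M; split; first exact: num_real.
by move=> x Mx y _ /=; rewrite (le_trans (fM _))// ltW.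
Qed.

Lemma bmeasD f g : bmeas f -> bmeas g -> bmeas (fun x => f x + g x).
Proof.
move=> [mf [M fM]] [mg [N gN]]; split; first exact: measurable_funD.
by exists (M + N) => x; rewrite (le_trans (ler_normD _ _))// lerD.
Qed.

Lemma bmeasM f g : bmeas f -> bmeas g -> bmeas (fun x => f x * g x).
Proof.
move=> [mf [M fM]] [mg [N gN]]; split; first exact: measurable_funM.
by exists (M * N) => x; rewrite normrM ler_pM.
Qed.

Lemma bmeas_cst (c : R) : bmeas (fun=> c).
Proof. by split; [exact: measurable_cst|exists `|c|]. Qed.

Lemma bmeasN f : bmeas f -> bmeas (fun x => - f x).
Proof.
move=> hf; have -> : (fun x => - f x) = (fun x => -1 * f x).
  by apply/funext => x; rewrite mulN1r.
exact: bmeasM (bmeas_cst _) hf.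
Qed.

Lemma bmeasB f g : bmeas f -> bmeas g -> bmeas (fun x => f x - g x).
Proof. by move=> hf hg; apply: bmeasD => //; exact: bmeasN. Qed.

Lemma bmeasX f n : bmeas f -> bmeas (fun x => f x ^+ n).
Proof.
move=> hf; elim: n => [|n ih]; first exact: bmeas_cst.
have -> : (fun x => f x ^+ n.+1) = (fun x => f x * f x ^+ n).
  by apply/funext => x; rewrite exprS.
exact: bmeasM.
Qed.

Lemma bmeas_sum I (s : seq I) (F : I -> T -> R) : (forall i, bmeas (F i)) ->
  bmeas (fun x => \sum_(i <- s) F i x).
Proof.
move=> hF; elim: s => [|i s ih].
  have -> : (fun x => \sum_(i <- [::]) F i x) = (fun=> 0).
    by apply/funext => x; rewrite big_nil.
  exact: bmeas_cst.
have -> : (fun x => \sum_(i <- i :: s) F i x)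
    = (fun x => F i x + \sum_(i <- s) F i x).
  by apply/funext => x; rewrite big_cons.
exact: bmeasD.
Qed.

Lemma bmeas_ind (A : set T) : measurable A -> bmeas (\1_A).
Proof.
move=> mA; split; first exact: measurable_indic.
by exists 1 => x; rewrite indicE normr_nat; case: (_ \in _).
Qed.

Lemma norm_mean_le f (M : R) : rint f -> (forall x, `|f x| <= M) -> `|mean f| <= M.
Proof.
move=> hf fM; rewrite -(mean_cst M).
apply: le_trans (le_normr_Rintegral _ hf) _ => //.
apply: le_mean => //; last exact: rint_cst.
exact: integrable_norm.
Qed.

Lemma cauchy_schwarz_mean f g : bmeas f -> bmeas g ->
  mean (fun x => f x * g x) ^+ 2
    <= mean (fun x => f x ^+ 2) * mean (fun x => g x ^+ 2).
Proof.
move=> hf hg.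
set a := mean (fun x => f x ^+ 2); set b := mean (fun x => f x * g x).
set c := mean (fun x => g x ^+ 2).
have q t : 0 <= a + t * b *+ 2 + t ^+ 2 * c.
  have -> : a + t * b *+ 2 + t ^+ 2 * c = mean (fun x => (f x + t * g x) ^+ 2).
    rewrite /a /b /c -mulrnAl -!meanZ -?meanD.
    - by congr mean; apply/funext => x; ring.
    1-6: apply: bmeas_rint; repeat first [exact: hf | exact: hg | exact: bmeas_cst |
      apply: bmeasX | apply: bmeasD | apply: bmeasM].
  by apply: mean_ge0 => x; exact: sqr_ge0.
have c0 : 0 <= c by apply: mean_ge0 => x; exact: sqr_ge0.
have [c00|cn0] := eqVneq c 0.
  rewrite c00 mulr0; have [-> |b0] := eqVneq b 0; first by rewrite expr0n.
  have := q (- (a + 1) / (2 * b)); rewrite c00 mulr0 addr0.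
  have -> : a + - (a + 1) / (2 * b) * b *+ 2 = -1 by field.
  by rewrite oppr_ge0 leNgt ltr01.
have cp : 0 < c by rewrite lt_def cn0.
have := q (- b / c).
have -> : a + - b / c * b *+ 2 + (- b / c) ^+ 2 * c = (a * c - b ^+ 2) / c by field.
by rewrite pmulr_lge0 ?invr_gt0// subr_ge0.
Qed.

Definition cint h := rint (fun x => Re (h x)) /\ rint (fun x => Im (h x)).
Definition cbmeas h := bmeas (fun x => Re (h x)) /\ bmeas (fun x => Im (h x)).

Lemma cbmeas_cint h : cbmeas h -> cint h.
Proof. by move=> [? ?]; split; exact: bmeas_rint. Qed.

Lemma cbmeas_bounded h : cbmeas h -> exists M : R, forall x, normc (h x) <= M.
Proof.
move=> [[_ [M hM]] [_ [N hN]]]; exists (M + N) => x.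
by rewrite (le_trans (normc_le_ReIm _))// lerD.
Qed.

Lemma cbmeasP h (M : R) : cmeasurable h -> (forall x, normc (h x) <= M) -> cbmeas h.
Proof.
move=> [mr mi] hM; split; split => //; exists M => x; apply: le_trans (hM x).
  exact: le_Re_normc.
exact: le_Im_normc.
Qed.

Lemma cbmeas_measurable h : cbmeas h -> cmeasurable h.
Proof. by move=> [[? _] [? _]]. Qed.

Lemma cintegralE h : cintegral P h =
  mean (fun x => Re (h x)) +i* mean (fun x => Im (h x)).
Proof. by []. Qed.

Lemma eq_cint h k : h =1 k -> cint h -> cint k.
Proof. by move=> /funext ->. Qed.

Lemma cintD h k : cint h -> cint k -> cint (fun x => h x + k x).
Proof.
move=> [? ?] [? ?]; split.
- by under eq_fun do rewrite ReD; exact: rintD.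
- by under eq_fun do rewrite ImD; exact: rintD.
Qed.

Lemma cintZ (c : Cplx R) h : cint h -> cint (fun x => c * h x).
Proof.
move=> [? ?]; split.
- by under eq_fun do rewrite ReM; apply: rintB; exact: rintZ.
- by under eq_fun do rewrite ImM; apply: rintD; exact: rintZ.
Qed.

Lemma cintegralD h k : cint h -> cint k ->
  cintegral P (fun x => h x + k x) = cintegral P h + cintegral P k.
Proof.
move=> [? ?] [? ?]; apply: cplx_eq; rewrite ReImE !cintegralE /=.
- by under eq_fun do rewrite ReD; rewrite meanD.
- by under eq_fun do rewrite ImD; rewrite meanD.
Qed.

Lemma cintegralZ (c : Cplx R) h : cint h ->
  cintegral P (fun x => c * h x) = c * cintegral P h.
Proof.
move=> [? ?]; apply: cplx_eq; rewrite ReImE !cintegralE /=.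
- by under eq_fun do rewrite ReM; rewrite meanB ?meanZ//; exact: rintZ.
- by under eq_fun do rewrite ImM; rewrite meanD ?meanZ//; exact: rintZ.
Qed.

Lemma cintegral_cst (c : Cplx R) : cintegral P (fun=> c) = c.
Proof. by rewrite cintegralE !mean_cst; case: c. Qed.

Lemma cintegralB h k : cint h -> cint k ->
  cintegral P (fun x => h x - k x) = cintegral P h - cintegral P k.
Proof.
move=> hh hk; rewrite -[in RHS]mulN1r -cintegralZ// -cintegralD//; last exact: cintZ.
by congr cintegral; apply/funext => x; rewrite mulN1r.
Qed.

Lemma cintB h k : cint h -> cint k -> cint (fun x => h x - k x).
Proof.
move=> hh hk; apply: cintD => //; apply: (@eq_cint (fun x => -1 * k x)).
  by move=> x; rewrite mulN1r.
exact: cintZ.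
Qed.

Lemma cint_sum I (s : seq I) (F : I -> T -> Cplx R) : (forall i, cint (F i)) ->
  cint (fun x => \sum_(i <- s) F i x).
Proof.
move=> hF; split.
- by under eq_fun do rewrite Re_sum; apply: rint_sum => i; case: (hF i).
- by under eq_fun do rewrite Im_sum; apply: rint_sum => i; case: (hF i).
Qed.

Lemma cintegral_sum I (s : seq I) (F : I -> T -> Cplx R) : (forall i, cint (F i)) ->
  cintegral P (fun x => \sum_(i <- s) F i x) = \sum_(i <- s) cintegral P (F i).
Proof.
move=> hF; apply: cplx_eq; rewrite ?Re_sum ?Im_sum !cintegralE/=.
- by under eq_fun do rewrite Re_sum; rewrite mean_sum// => i; case: (hF i).
- by under eq_fun do rewrite Im_sum; rewrite mean_sum// => i; case: (hF i).
Qed.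

Lemma cintegral_conj h : cint h ->
  cintegral P (fun x => (h x)^*)%C = ((cintegral P h)^*)%C.
Proof.
move=> [? ?]; apply: cplx_eq; rewrite ReImE !cintegralE /=.
- by under eq_fun do rewrite ReJ.
- by under eq_fun do rewrite ImJ; rewrite meanN.
Qed.

(** Rotating the integral onto the positive real axis reduces this to the
  monotonicity of real integrals. *)
Lemma normc_cintegral_le h f : cint h -> rint f -> (forall x, normc (h x) <= f x) ->
  normc (cintegral P h) <= mean f.
Proof.
move=> hh hf hM; set z := cintegral P h.
have [->|z0] := eqVneq z 0.
  rewrite normc_zero; apply: mean_ge0 => x.
  exact: le_trans (normc_ge0 _) (hM x).
have zn0 := normc_gt0 z0.
pose u : Cplx R := (normc z)^-1%:C * (z^*)%C.
have u1 : normc u = 1.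
  by rewrite normc_mul normc_conj normc_real ger0_norm ?invr_ge0 ?mulVf ?ltW ?gt_eqF.
have -> : normc z = Re (cintegral P (fun x => u * h x)).
  rewrite cintegralZ// -/z /u -mulrA [X in _ * X]mulrC mulcJ -rmorphM/=.
  by rewrite expr2 mulKf// gt_eqF.
rewrite cintegralE/=; apply: le_mean => //.
  by have [] := cintZ u hh.
move=> x; apply: le_trans (ler_norm _) _; apply: le_trans (le_Re_normc _) _.
by rewrite normc_mul u1 mul1r.
Qed.

Lemma cbmeasD h k : cbmeas h -> cbmeas k -> cbmeas (fun x => h x + k x).
Proof.
move=> [? ?] [? ?]; split.
- by under eq_fun do rewrite ReD; exact: bmeasD.
- by under eq_fun do rewrite ImD; exact: bmeasD.
Qed.

Lemma cbmeasM h k : cbmeas h -> cbmeas k -> cbmeas (fun x => h x * k x).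
Proof.
move=> [? ?] [? ?]; split.
- by under eq_fun do rewrite ReM; apply: bmeasB; exact: bmeasM.
- by under eq_fun do rewrite ImM; apply: bmeasD; exact: bmeasM.
Qed.

Lemma cbmeas_conj h : cbmeas h -> cbmeas (fun x => (h x)^*)%C.
Proof.
move=> [? ?]; split.
- by under eq_fun do rewrite ReJ.
- by under eq_fun do rewrite ImJ; exact: bmeasN.
Qed.

Lemma cbmeas_cst (c : Cplx R) : cbmeas (fun=> c).
Proof. by split; exact: bmeas_cst. Qed.

Lemma cbmeasZ (c : Cplx R) h : cbmeas h -> cbmeas (fun x => c * h x).
Proof. by apply: cbmeasM; exact: cbmeas_cst. Qed.

Lemma cbmeasB h k : cbmeas h -> cbmeas k -> cbmeas (fun x => h x - k x).
Proof.
move=> [? ?] [? ?]; split.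
- by under eq_fun do rewrite ReB; exact: bmeasB.
- by under eq_fun do rewrite ImB; exact: bmeasB.
Qed.

Lemma cbmeas_sum I (s : seq I) (F : I -> T -> Cplx R) : (forall i, cbmeas (F i)) ->
  cbmeas (fun x => \sum_(i <- s) F i x).
Proof.
move=> hF; split.
- by under eq_fun do rewrite Re_sum; apply: bmeas_sum => i; case: (hF i).
- by under eq_fun do rewrite Im_sum; apply: bmeas_sum => i; case: (hF i).
Qed.

Lemma cbmeas_real f : bmeas f -> cbmeas (fun x => (f x)%:C).
Proof. by move=> hf; split => //; exact: bmeas_cst. Qed.

Lemma bmeas_normc2 h : cbmeas h -> bmeas (fun x => normc (h x) ^+ 2).
Proof.
move=> [? ?]; under eq_fun do rewrite sqr_normcE.
by apply: bmeasD; exact: bmeasX.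
Qed.

End Integrals.

(** * Integration on a compact abelian metric group *)

(** The operations are continuous because the metric is invariant. *)
Record metric_group (R : realType) (K : Type) (d : K -> K -> R)
    (add : K -> K -> K) (zero : K) (opp : K -> K) : Prop := {
  mg_addA : associative add ;
  mg_addC : commutative add ;
  mg_add0 : left_id zero add ;
  mg_addN : left_inverse zero opp add ;
  mg_dist : forall a x y, d (add a x) (add a y) = d x y
}.

Section Ucont.
Context (R : realType) (K : ptopologicalType) (d : K -> K -> R).
Hypothesis dm : metric_inducing_topology d.
Hypothesis Kc : compact [set: K].
Implicit Types f g : K -> R.

Lemma ucont_cst (c : R) : ucont d (fun=> c).
Proof. by move=> e e0; exists 1 => // x y _; rewrite subrr normr0. Qed.

Lemma ucontD f g : ucont d f -> ucont d g -> ucont d (fun x => f x + g x).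
Proof.
move=> hf hg e e0; have e2 : 0 < e / 2 by lra.
have [a a0 fa] := hf _ e2; have [b b0 gb] := hg _ e2.
exists (Num.min a b); first by rewrite lt_min a0.
move=> x y; rewrite lt_min => /andP[/fa h1 /gb h2].
have -> : f x + g x - (f y + g y) = (f x - f y) + (g x - g y) by ring.
by rewrite (le_lt_trans (ler_normD _ _))//; lra.
Qed.

Lemma ucontZ (c : R) f : ucont d f -> ucont d (fun x => c * f x).
Proof.
move=> hf e e0; have c0 : 0 < `|c| + 1 by have := normr_ge0 c; lra.
have [|a a0 fa] := hf (e / (`|c| + 1)); first exact: divr_gt0.
exists a => // x y /fa h; rewrite -mulrBr normrM.
rewrite ltr_pdivlMr// mulrC in h; apply: le_lt_trans h.
by rewrite ler_wpM2r//; have := normr_ge0 c; lra.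
Qed.

Lemma ucontN f : ucont d f -> ucont d (fun x => - f x).
Proof.
move=> /(ucontZ (-1)); congr ucont; apply/funext => x; by rewrite mulN1r.
Qed.

Lemma ucontB f g : ucont d f -> ucont d g -> ucont d (fun x => f x - g x).
Proof. by move=> hf hg; apply: ucontD => //; exact: ucontN. Qed.

Lemma ucontM f g : ucont d f -> ucont d g -> ucont d (fun x => f x * g x).
Proof.
move=> hf hg; have [M M0 fM] := ucont_bounded dm Kc hf.
have [N N0 gN] := ucont_bounded dm Kc hg.
move=> e e0; have MN : 0 < M + N by lra.
have e' : 0 < e / (M + N) by exact: divr_gt0.
have [a a0 fa] := hf _ e'; have [b b0 gb] := hg _ e'.
exists (Num.min a b); first by rewrite lt_min a0.
move=> x y; rewrite lt_min => /andP[/fa h1 /gb h2].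
have -> : f x * g x - f y * g y = (f x - f y) * g x + f y * (g x - g y) by ring.
rewrite (le_lt_trans (ler_normD _ _))// !normrM.
have -> : e = e / (M + N) * N + M * (e / (M + N)) by field; lra.
apply: ler_ltD.
  by rewrite ler_pM// ltW.
rewrite (@le_lt_trans _ _ (M * `|g x - g y|))// ?ler_wpM2r//.
by rewrite ltr_pM2l.
Qed.

Lemma ucont_sum n (F : 'I_n -> K -> R) : (forall i, ucont d (F i)) ->
  ucont d (fun x => \sum_i F i x).
Proof.
elim: n F => [|n ih] F hF.
  have -> : (fun x => \sum_i F i x) = (fun=> 0).
    by apply/funext => x; rewrite big_ord0.
  exact: ucont_cst.
have -> : (fun x => \sum_i F i x) =
    (fun x => F ord0 x + \sum_i F (lift ord0 i) x).
  by apply/funext => x; rewrite big_ord_recl.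
by apply: ucontD => //; apply: ih => i.
Qed.

Lemma ucont_comp f (u : K -> K) : (forall x y, d (u x) (u y) = d x y) ->
  ucont d f -> ucont d (fun x => f (u x)).
Proof.
by move=> du hf e /hf[a a0 fa]; exists a => // x y xy; apply: fa; rewrite du.
Qed.

Lemma ucont_dist x0 : ucont d (fun x => d x x0).
Proof.
move=> e e0; exists e => // x y xy.
by apply: le_lt_trans (d_lip dm _ _ _ _) _; rewrite (dxx dm) addr0.
Qed.

Lemma ucont_max f g : ucont d f -> ucont d g -> ucont d (fun x => Num.max (f x) (g x)).
Proof.
move=> hf hg e e0.
have [a a0 fa] := hf _ e0; have [b b0 gb] := hg _ e0.
exists (Num.min a b); first by rewrite lt_min a0.
move=> x y; rewrite lt_min => /andP[/fa + /gb]; rewrite !ltr_norml.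
by rewrite /Num.max; case: ifPn; case: ifPn; rewrite -?leNgt; lra.
Qed.

Lemma ucont_bmeas f : ucont d f -> bmeas (f : borel K -> R).
Proof.
move=> hf; split; first exact: (ucont_measurable dm).
by have [M _ fM] := ucont_bounded dm Kc hf; exists M.
Qed.

End Ucont.

Section HaarIntegral.
Context (R : realType) (K : ptopologicalType) (d : K -> K -> R).
Hypothesis dm : metric_inducing_topology d.
Hypothesis Kc : compact [set: K].
Variables (add : K -> K -> K) (zero : K) (opp : K -> K).
Hypothesis gK : metric_group d add zero opp.
Variable mu : probability (borel K) R.
Hypothesis muK : forall x (A : set (borel K)), measurable A ->
  mu (add x @^-1` A) = mu A.
Implicit Types f g : K -> R.
Local Notation "x +' y" := (add x y) (at level 50, left associativity).
Local Notation I := (@mean R _ (borel K) mu).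

Let addA := mg_addA gK.
Let addC := mg_addC gK.
Let add0 := mg_add0 gK.
Let addN := mg_addN gK.
Let dist := mg_dist gK.

Lemma gaddr0 x : x +' zero = x. Proof. by rewrite addC add0. Qed.
Lemma gaddrN x : x +' opp x = zero. Proof. by rewrite addC addN. Qed.
Lemma gaddK a : cancel (add a) (add (opp a)).
Proof. by move=> x; rewrite addA addN add0. Qed.
Lemma gaddNK a : cancel (add (opp a)) (add a).
Proof. by move=> x; rewrite addA gaddrN add0. Qed.
Lemma gaddCA x y z : x +' (y +' z) = y +' (x +' z).
Proof. by rewrite !addA (addC x). Qed.
Lemma gdist_r a x y : d (x +' a) (y +' a) = d x y.
Proof. by rewrite !(addC _ a) dist. Qed.
Lemma gopp_unique x y : x +' y = zero -> y = opp x.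
Proof. by move=> xy; rewrite -(gaddK x y) xy gaddr0. Qed.
Lemma goppK : involutive opp.
Proof. by move=> x; rewrite -(gopp_unique (addN x)). Qed.
Lemma goppD x y : opp (x +' y) = opp x +' opp y.
Proof.
apply/esym/gopp_unique; rewrite -addA (gaddCA y) !addA gaddrN add0.
exact: gaddrN.
Qed.
Lemma gopp0 : opp zero = zero. Proof. by rewrite -{2}(addN zero) gaddr0. Qed.
Lemma gopp_dist x y : d (opp x) (opp y) = d x y.
Proof.
rewrite -(dist (x +' y)) -addA (gaddCA x) gaddrN gaddr0.
by rewrite -addA gaddrN gaddr0 (d_sym dm).
Qed.

Let uB f (uf : ucont d f) : bmeas (f : borel K -> R) := ucont_bmeas dm Kc uf.

Let uR f (uf : ucont d f) : rint mu (f : borel K -> R) := bmeas_rint mu (uB uf).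

Lemma addr_measurable a (A : set (borel K)) :
  measurable A -> measurable (add a @^-1` A : set (borel K)).
Proof.
have h : measurable_fun [set: borel K] (add a : borel K -> borel K).
  apply: (@measurability _ _ (borel K) (borel K) setT _ open erefl) => // _ [B Bo <-]; rewrite setTI.
  apply: borel_open; apply/(mopenP dm) => x Bx.
  have /(mopenP dm)/(_ _ Bx)[e e0 eB] := Bo.
  by exists e => // y xy; apply: eB; rewrite /mball/= dist.
by move=> mA; rewrite -[X in measurable X]setTI; exact: h.
Qed.

Lemma mean_translate f a : bmeas (f : borel K -> R) ->
  I (fun x => f (a +' x)) = I f.
Proof.
move=> hf; rewrite /mean /Rintegral; congr fine.
have mA : measurable_fun [set: borel K] (add a : borel K -> borel K).
  by move=> _ B mB; rewrite setTI; exact: addr_measurable.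
transitivity (\int[pushforward mu (add a : borel K -> borel K)]_y (f y)%:E)%E.
  rewrite (@integral_pushforward _ _ (borel K) (borel K) R _ mA mu setT
    (fun y => (f y)%:E))//=.
  - apply/measurable_EFinP; by case: hf.
  - rewrite preimage_setT; apply: bmeas_rint; case: hf => mf [M fM]; split.
      by apply: (@measurableT_comp _ _ _ (borel K) (borel K) R).
    by exists M => x /=.
by apply: eq_measure_integral => A mA' _; exact: muK.
Qed.

(** Finitely many balls of the same radius cover the group, and all of them
  have the same measure. *)
Lemma mu_ball_gt0 x (e : R) : 0 < e -> 0 < fine (mu (mball d x e)).
Proof.
move=> e0; have mB y : measurable (mball d y e : set (borel K)).
  by apply: borel_open; exact: open_mball.
have ballE y : mu (mball d y e) = mu (mball d x e).
  rewrite -(@muK (y +' opp x) (mball d y e))//; congr (mu _).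
  have cx : y +' opp x +' x = y by rewrite -addA addN gaddr0.
  by apply/seteqP; split=> z; rewrite /mball/= -{1}cx dist.
rewrite fine_gt0// (le_lt_trans (probability_le1 _ (mB _))) ?ltry// andbT.
rewrite lt0e measure_ge0 andbT; apply/eqP => mu0.
have [n [c cP]] := finite_net dm Kc e0.
have : (mu setT <= 0)%E.
  rewrite (_ : setT = \big[setU/set0]_(i < n) mball d (c i) e).
    apply: (le_trans (Boole_inequality mu (fun i _ => mB (c i)))).
    by rewrite [leLHS]big1// => i _; exact: (etrans (ballE _) mu0).
  rewrite -(bigcup_mkord n (fun i => mball d (c i) e)).
  apply/seteqP; split => // y _.
  by have [i ? ?] := cP y; exists i.
by rewrite probability_setT lee_fin leNgt ltr01.
Qed.

(** Where [f] is positive it is bounded below on a ball, which is not null. *)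
Lemma mean_eq0 f : ucont d f -> (forall x, 0 <= f x) -> I f = 0 -> forall x, f x = 0.
Proof.
move=> hf f0 If x; apply/eqP; rewrite eq_le f0 andbT leNgt; apply/negP => fx.
have [|e e0 fe] := hf (f x / 2); first lra.
have mB : measurable (mball d x e : set (borel K)).
  by apply: borel_open; exact: open_mball.
have h : I (fun y => f x / 2 * \1_(mball d x e) y) <= I f.
  apply: le_mean => [||y]; try apply: bmeas_rint.
  - by apply: bmeasM; [exact: bmeas_cst | exact: bmeas_ind].
  - exact: uB.
  rewrite indicE; have [|_] := boolP (y \in _); last by rewrite mulr0.
  rewrite inE => /fe; rewrite ltr_norml mulr1 => /andP[_]; lra.
move: h; rewrite If meanZ; last by apply: bmeas_rint; exact: bmeas_ind.
rewrite /mean /Rintegral integral_indic// setIT leNgt.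
by rewrite mulr_gt0// ?mu_ball_gt0//; lra.
Qed.

Lemma mean_cells (J : finType) (cell : K -> J) (w : J -> R) :
  (forall i, measurable (cell @^-1` [set i] : set (borel K))) ->
  bmeas (fun x : borel K => w (cell x)) /\
  I (fun x => w (cell x)) = \sum_i I (\1_(cell @^-1` [set i])) * w i.
Proof.
move=> mc; have E : (fun x : borel K => w (cell x)) =
    (fun x => \sum_i w i * \1_(cell @^-1` [set i]) x).
  apply/funext => x; rewrite (bigD1 (cell x))//= big1 => [|i ix].
    by rewrite indicE mem_set// mulr1 addr0.
  rewrite indicE memNset ?mulr0// => /= xi; by rewrite xi eqxx in ix.
have h i : bmeas (\1_(cell @^-1` [set i]) : borel K -> R) by exact: bmeas_ind.
have h' i : bmeas (fun x : borel K => w i * \1_(cell @^-1` [set i]) x).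
  by apply: bmeasM => //; exact: bmeas_cst.
rewrite E; split; first exact: bmeas_sum.
rewrite mean_sum => [|i]; last exact: bmeas_rint.
by apply: eq_bigr => i _; rewrite mulrC -meanZ//; exact: bmeas_rint.
Qed.

Lemma riemann_sum n (c : nat -> K) (cell : K -> 'I_n) f (e : R) :
  (forall i, measurable (cell @^-1` [set i] : set (borel K))) ->
  bmeas (f : borel K -> R) -> (forall x, `|f x - f (c (cell x))| <= e) ->
  `|I f - \sum_i I (\1_(cell @^-1` [set i])) * f (c i)| <= e.
Proof.
move=> mc hf fe; have [hb <-] := mean_cells (fun i : 'I_n => f (c i)) mc.
rewrite -meanB; try exact: bmeas_rint.
by apply: norm_mean_le => //; apply: bmeas_rint; exact: bmeasB.
Qed.

Definition ucont2 (F : K -> K -> R) := forall e : R, 0 < e ->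
  exists2 del : R, 0 < del & forall x x' y y', d x x' < del -> d y y' < del ->
    `|F x y - F x' y'| < e.

Lemma ucont2_r F : ucont2 F -> forall x, ucont d (F x).
Proof.
by move=> hF y e /hF[a a0 h]; exists a => // x x' xx'; apply: h; rewrite ?(dxx dm).
Qed.

Lemma ucont2C F : ucont2 F -> ucont2 (fun x y => F y x).
Proof. by move=> hF e /hF[a a0 h]; exists a => // x x' y y' ? ?; exact: h. Qed.

Lemma ucont2_mean F : ucont2 F -> ucont d (fun x => I (F x)).
Proof.
move=> hF e e0; have [|a a0 h] := hF (e / 2); first lra.
exists a => // x x' xx'; rewrite -meanB; try by apply: uR;
  exact: ucont2_r.
apply: (@le_lt_trans _ _ (e / 2)); last lra.
apply: norm_mean_le => [|y].
  by apply: uR; apply: ucontB; exact: ucont2_r.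
by apply/ltW/h => //; rewrite (dxx dm).
Qed.

(** Both iterated integrals are within [2 e] of the same double Riemann sum. *)
Lemma mean_swap F : ucont2 F -> I (fun x => I (F x)) = I (fun y => I (F ^~ y)).
Proof.
have h G (e : R) n (c : nat -> K) (cell : K -> 'I_n) : 0 < e -> ucont2 G ->
    (forall i, measurable (cell @^-1` [set i] : set (borel K))) ->
    (forall x y, `|G x y - G x (c (cell y))| <= e) ->
    (forall x y, `|G x y - G (c (cell x)) y| <= e) ->
    `|I (fun x => I (G x)) - \sum_i \sum_j I (\1_(cell @^-1` [set i])) *
      I (\1_(cell @^-1` [set j])) * G (c i) (c j)| <= e + e.
  move=> e0 hG mc h1 h2; set w := fun i => I (\1_(cell @^-1` [set i])).
  have w0 i : 0 <= w i by apply: mean_ge0.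
  have w1 : \sum_i w i = 1.
    have [_] := mean_cells (fun=> 1) mc; rewrite mean_cst => ->.
    by apply: eq_bigr => i _; rewrite mulr1.
  have A : `|I (fun x => I (G x)) - \sum_i w i * I (G (c i))| <= e.
    apply: riemann_sum => //.
      by apply: uB; exact: ucont2_mean.
    move=> x; rewrite -meanB; try by apply: uR; exact: ucont2_r.
    apply: norm_mean_le => [|y //].
    by apply: uR; apply: ucontB; exact: ucont2_r.
  have B : `|\sum_i w i * I (G (c i)) - \sum_i \sum_j w i * w j * G (c i) (c j)| <= e.
    rewrite -sumrB; apply: le_trans (ler_norm_sum _ _ _) _.
    rewrite -[leRHS]mul1r -w1 mulr_suml; apply: ler_sum => i _.
    under eq_bigr do rewrite -mulrA.
    rewrite -mulr_sumr -mulrBr normrM (ger0_norm (w0 i)) ler_wpM2l//.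
    by apply: riemann_sum => //; apply: uB; exact: ucont2_r.
  rewrite -[X in `|X|](subrKA (\sum_i w i * I (G (c i)))).
  by rewrite (le_trans (ler_normD _ _))// lerD.
move=> hF; apply/eqP; rewrite -subr_eq0 -normr_le0; apply/ler_addgt0Pr => e e0.
rewrite add0r; have e4 : 0 < e / 4 by lra.
have [a a0 aF] := hF _ e4.
have [n [c [cell [cd mc]]]] := measurable_cells dm Kc a0.
have A : `|I (fun x => I (F x)) - \sum_i \sum_j I (\1_(cell @^-1` [set i])) *
      I (\1_(cell @^-1` [set j])) * F (c i) (c j)| <= e / 4 + e / 4.
  apply: (h F) => //.
    by move=> x y; apply/ltW/aF; rewrite ?(dxx dm)// (d_sym dm).
  by move=> x y; apply/ltW/aF; rewrite ?(dxx dm)// (d_sym dm).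
have B : `|I (fun x => I (F ^~ x)) - \sum_i \sum_j I (\1_(cell @^-1` [set i])) *
      I (\1_(cell @^-1` [set j])) * F (c j) (c i)| <= e / 4 + e / 4.
  apply: (h (fun x y => F y x)) => //; first exact: ucont2C.
    by move=> x y; apply/ltW/aF; rewrite ?(dxx dm)// (d_sym dm).
  by move=> x y; apply/ltW/aF; rewrite ?(dxx dm)// (d_sym dm).
rewrite exchange_big/= in B.
have E : \sum_i \sum_j I (\1_(cell @^-1` [set j])) *
      I (\1_(cell @^-1` [set i])) * F (c i) (c j) = \sum_i \sum_j I (\1_(cell @^-1` [set i])) *
      I (\1_(cell @^-1` [set j])) * F (c i) (c j).
  by apply: eq_bigr => i _; apply: eq_bigr => j _; congr (_ * _); rewrite mulrC.
rewrite E in B; set S := \sum_i _ in A B.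
rewrite -(subrKA S); apply: le_trans (ler_normD _ _) _.
by rewrite (distrC S); rewrite (le_trans (lerD A B))// [leLHS](_ : _ = e)//; field.
Qed.

End HaarIntegral.

(** * Characters of a compact abelian metric group *)

Section Convolution.
Context (R : realType) (K : ptopologicalType) (d : K -> K -> R).
Hypothesis dm : metric_inducing_topology d.
Hypothesis Kc : compact [set: K].
Variables (add : K -> K -> K) (zero : K) (opp : K -> K).
Hypothesis gK : metric_group d add zero opp.
Variable mu : probability (borel K) R.
Hypothesis muK : forall x (A : set (borel K)), measurable A ->
  mu (add x @^-1` A) = mu A.
Implicit Types f g : K -> R.
Local Notation "x +' y" := (add x y) (at level 50, left associativity).
Local Notation I := (@mean R _ (borel K) mu).

Let uB f (uf : ucont d f) : bmeas (f : borel K -> R) := ucont_bmeas dm Kc uf.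
Let uR f (uf : ucont d f) : rint mu (f : borel K -> R) := bmeas_rint mu (uB uf).
Let uM := ucontM dm Kc.

Definition sqn f : R := I (fun x => f x ^+ 2).

Lemma sqn_ge0 f : 0 <= sqn f.
Proof. by apply: mean_ge0 => x; exact: sqr_ge0. Qed.

Lemma ucont_sqr f : ucont d f -> ucont d (fun x => f x ^+ 2).
Proof. by move=> hf; exact: uM. Qed.

Lemma sqn_eq0 f : ucont d f -> sqn f = 0 -> forall x, f x = 0.
Proof.
move=> hf h x; apply/eqP; rewrite -sqrf_eq0; apply/eqP.
apply: (mean_eq0 dm Kc gK muK) h x => [|x]; [exact: ucont_sqr | exact: sqr_ge0].
Qed.

Lemma sqnZ (c : R) f : ucont d f -> sqn (fun x => c * f x) = c ^+ 2 * sqn f.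
Proof.
move=> hf; rewrite /sqn -meanZ; last by apply: uR; exact: ucont_sqr.
by congr mean; apply/funext => x; rewrite exprMn.
Qed.

Lemma sqn_bound f (e : R) : ucont d f -> (forall x, `|f x| <= e) -> sqn f <= e ^+ 2.
Proof.
move=> hf fe; rewrite -[leRHS](mean_cst mu); apply: le_mean.
- by apply: uR; exact: ucont_sqr.
- exact: rint_cst.
by move=> x; rewrite -real_normK ?num_real// ler_pXn2r// nnegrE// (le_trans _ (fe x)).
Qed.

Lemma cauchy_schwarz_bound f g (e : R) : ucont d f -> ucont d g -> 0 <= e ->
  (forall x, `|g x| <= e) -> I (fun x => g x * f x) ^+ 2 <= e ^+ 2 * sqn f.
Proof.
move=> hf hg e0 ge; apply: le_trans (cauchy_schwarz_mean _ (uB hg) (uB hf)) _.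
by apply: ler_wpM2r; [exact: sqn_ge0 | exact: sqn_bound].
Qed.

Variable ker : K -> R.
Hypothesis ker_ucont : ucont d ker.
Hypothesis ker_even : forall x, ker (opp x) = ker x.

(** A compact self-adjoint operator that commutes with translations: its
  eigenspaces are where the characters are found. *)
Definition conv f x : R := I (fun y => ker (x +' opp y) * f y).

Lemma gsub_dist x y x' y' : d (x +' opp y) (x' +' opp y') <= d x x' + d y y'.
Proof.
rewrite (le_trans (d_tri dm _ (x' +' opp y) _))// (gdist_r gK) (mg_dist gK).
by rewrite (gopp_dist dm gK).
Qed.

Lemma ucont2_ker : ucont2 d (fun x y => ker (x +' opp y)).
Proof.
move=> e /ker_ucont[a a0 h]; exists (a / 2); first lra.
by move=> x x' y y' ? ?; apply: h; have := gsub_dist x y x' y'; lra.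
Qed.

Lemma ucont2_prod (F G : K -> K -> R) : ucont2 d F -> ucont2 d G ->
  (exists2 M : R, 0 < M & forall x y, `|F x y| <= M) ->
  (exists2 M : R, 0 < M & forall x y, `|G x y| <= M) ->
  ucont2 d (fun x y => F x y * G x y).
Proof.
move=> hF hG [M M0 FM] [N N0 GN] e e0.
have MN : 0 < M + N by lra.
have e' : 0 < e / (M + N) by exact: divr_gt0.
have [a a0 fa] := hF _ e'; have [b b0 gb] := hG _ e'.
exists (Num.min a b); first by rewrite lt_min a0.
move=> x x' y y'; rewrite !lt_min => /andP[h1 h2] /andP[h3 h4].
have -> : F x y * G x y - F x' y' * G x' y' =
  (F x y - F x' y') * G x y + F x' y' * (G x y - G x' y') by ring.
rewrite (le_lt_trans (ler_normD _ _))// !normrM.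
have -> : e = e / (M + N) * N + M * (e / (M + N)) by field; lra.
apply: ler_ltD; first by rewrite ler_pM// ltW// fa.
rewrite (@le_lt_trans _ _ (M * `|G x y - G x' y'|))// ?ler_wpM2r//.
by rewrite ltr_pM2l// gb.
Qed.

Lemma conv_rint f x : ucont d f -> ucont d (fun y => ker (x +' opp y) * f y).
Proof.
by move=> hf; apply: uM => //; exact: (ucont2_r dm ucont2_ker).
Qed.

Lemma convD f g : ucont d f -> ucont d g ->
  forall x, conv (fun y => f y + g y) x = conv f x + conv g x.
Proof.
move=> hf hg x; rewrite /conv -meanD; try by apply: uR; exact: conv_rint.
by congr mean; apply/funext => y; rewrite mulrDr.
Qed.

Lemma convZ (c : R) f : ucont d f -> forall x, conv (fun y => c * f y) x = c * conv f x.
Proof.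
move=> hf x; rewrite /conv -meanZ; last by apply: uR; exact: conv_rint.
by congr mean; apply/funext => y; rewrite mulrCA.
Qed.

Lemma convB f g : ucont d f -> ucont d g ->
  forall x, conv (fun y => f y - g y) x = conv f x - conv g x.
Proof.
move=> hf hg x; rewrite /conv -meanB; try by apply: uR; exact: conv_rint.
by congr mean; apply/funext => y; rewrite mulrBr.
Qed.

Lemma ex_ker_bound : exists2 M : R, 0 < M & forall x, `|ker x| <= M.
Proof. exact: (ucont_bounded dm Kc). Qed.
Let M : R := sval (cid2 ex_ker_bound).
Let M0 : 0 < M. Proof. by rewrite /M; case: cid2. Qed.
Let kerM x : `|ker x| <= M. Proof. by rewrite /M; case: cid2. Qed.

Lemma sqr_conv_le f x : ucont d f -> conv f x ^+ 2 <= M ^+ 2 * sqn f.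
Proof.
move=> hf; apply: cauchy_schwarz_bound => //; last exact: ltW.
exact: (ucont2_r dm ucont2_ker).
Qed.

Lemma le_sqr (a e : R) : 0 <= e -> a ^+ 2 <= e ^+ 2 -> `|a| <= e.
Proof.
by move=> e0; rewrite -[a ^+ 2]real_normK ?num_real// ler_pXn2r// nnegrE.
Qed.

(** This is the compactness of the operator: it maps the unit ball of [L^2]
  to an equicontinuous family. *)
Lemma conv_equicontinuous (e : R) : 0 < e -> exists2 a : R, 0 < a &
  forall f, ucont d f -> sqn f <= 1 ->
    forall x x', d x x' < a -> `|conv f x - conv f x'| <= e.
Proof.
move=> e0; have [a a0 h] := ucont2_ker e0; exists a => // f hf f1 x x' xx'.
apply: le_sqr; first exact: ltW.
rewrite /conv -meanB; try by apply: uR; exact: conv_rint.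
under [X in mean mu X]eq_fun do rewrite -mulrBl.
rewrite -[leRHS]mulr1; apply: le_trans (@cauchy_schwarz_bound f
  (fun y => ker (x +' opp y) - ker (x' +' opp y)) e hf _ (ltW e0) _) _.
- by apply: ucontB; exact: (ucont2_r dm ucont2_ker).
- by move=> y; apply/ltW/h => //; rewrite (dxx dm).
- by rewrite ler_pM2l// exprn_gt0.
Qed.

Lemma conv_ucont f : ucont d f -> ucont d (conv f).
Proof.
move=> hf; have [N N0 fN] := ucont_bounded dm Kc hf.
have hg : ucont d (fun x => N^-1 * f x) by exact: ucontZ.
have g1 : sqn (fun x => N^-1 * f x) <= 1.
  rewrite -(expr1n _ 2); apply: sqn_bound => // x.
  by rewrite normrM gtr0_norm ?invr_gt0// mulrC ler_pdivrMr// mul1r.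
have -> : conv f = fun x => N * conv (fun y => N^-1 * f y) x.
  by apply/funext => x; rewrite convZ// mulrA divff ?mul1r// gt_eqF.
apply: ucontZ => e e0; have [|a a0 h] := @conv_equicontinuous (e / 2); first lra.
exists a => // x y /(h _ hg g1); lra.
Qed.

(** The kernel is even, so exchanging the integrals moves [conv] across the
  inner product. *)
Lemma conv_sym f g : ucont d f -> ucont d g ->
  I (fun x => conv f x * g x) = I (fun x => f x * conv g x).
Proof.
move=> hf hg; have [F F0 fF] := ucont_bounded dm Kc hf.
have [G G0 gG] := ucont_bounded dm Kc hg.
have h u : ucont d u -> ucont2 d (fun _ y => u y).
  by move=> hu e /hu[a a0 ua]; exists a => // x x' y y' _ /ua.
have hp : ucont2 d (fun x y => ker (x +' opp y) * (f y * g x)).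
  apply: ucont2_prod; [exact: ucont2_ker | | by exists M |].
    apply: ucont2_prod; [exact: h | | by exists F | by exists G].
    exact: (ucont2C (h _ hg)).
  by exists (F * G) => [|x y]; [exact: mulr_gt0 | rewrite normrM ler_pM].
transitivity (I (fun x => I (fun y => ker (x +' opp y) * (f y * g x)))).
  congr mean; apply/funext => x; rewrite mulrC -meanZ; last by apply: uR; exact: conv_rint.
  by congr mean; apply/funext => y; ring.
rewrite (mean_swap dm Kc)//; congr mean; apply/funext => y.
rewrite -meanZ; last by apply: uR; exact: conv_rint.
congr mean; apply/funext => x.
by rewrite -ker_even (goppD gK) (goppK gK) (mg_addC gK (opp x)); ring.
Qed.

Lemma conv_translate f a x : ucont d f ->
  conv (fun y => f (a +' y)) x = conv f (a +' x).
Proof.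
move=> hf; rewrite /conv -(mean_translate dm gK muK a (uB (conv_rint (a +' x) hf))).
congr mean; apply/funext => y; congr (ker _ * _).
rewrite (goppD gK) (gaddCA gK) -!(mg_addA gK) (gaddCA gK _ x) !(mg_addA gK).
congr (_ +' _); by rewrite -(mg_addA gK) (mg_addC gK x) (gaddK gK).
Qed.

Lemma conv_zero f : ucont d f -> conv f zero = I (fun y => ker y * f y).
Proof.
move=> hf; congr mean; apply/funext => y.
by rewrite (mg_add0 gK) ker_even.
Qed.

Hypothesis ker_zero : ker zero != 0.

Lemma sqn_conv_bounded f : ucont d f -> sqn f <= 1 -> sqn (conv f) <= M ^+ 2.
Proof.
move=> hf f1; apply: sqn_bound => [|x]; first exact: conv_ucont.
apply: le_sqr; first exact: ltW.
by rewrite (le_trans (sqr_conv_le _ hf))// ler_piMr// exprn_ge0// ltW.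
Qed.

Let normset := [set sqn (conv f) | f in [set f | ucont d f /\ sqn f <= 1]].

Let normset_sup : has_sup normset.
Proof.
split; last by exists (M ^+ 2) => _ [f [? ?] <-]; exact: sqn_conv_bounded.
exists (sqn (conv (fun=> 0))), (fun=> 0) => //; split; first exact: ucont_cst.
by apply: le_trans (@sqn_bound _ 0 _ _) _; rewrite ?expr0n//;
  [exact: ucont_cst | move=> x; rewrite normr0].
Qed.

(** The squared operator norm of convolution. *)
Let L := sup normset.

Let sqn_conv_le f : ucont d f -> sqn (conv f) <= L * sqn f.
Proof.
move=> hf; have [f0|f0] := eqVneq (sqn f) 0.
  have fz := sqn_eq0 hf f0.
  rewrite f0 mulr0; apply: le_trans (@sqn_bound _ 0 _ _) _; rewrite ?expr0n//.
    exact: conv_ucont.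
  move=> x; apply: le_sqr => //; apply: le_trans (sqr_conv_le _ hf) _.
  by rewrite f0 mulr0 expr0n.
have fp : 0 < sqn f by rewrite lt_def f0 sqn_ge0.
pose s := (Num.sqrt (sqn f))^-1.
have s2 : s ^+ 2 = (sqn f)^-1 by rewrite exprVn sqr_sqrtr// ltW.
have hs : ucont d (fun x => s * f x) by exact: ucontZ.
have : sqn (conv (fun x => s * f x)) <= L.
  apply: ub_le_sup; first by case: normset_sup.
  by exists (fun x => s * f x) => //; split => //; rewrite sqnZ// s2 mulVf.
rewrite (_ : conv _ = fun x => s * conv f x); last by apply/funext => x; rewrite convZ.
by rewrite sqnZ ?s2; [rewrite mulrC ler_pdivrMr | exact: conv_ucont].
Qed.

Let L_gt0 : 0 < L.
Proof.
have h0 : 0 < sqn (conv ker).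
  rewrite lt_def sqn_ge0 andbT; apply/eqP => /sqn_eq0 h.
  have /(_ zero) := h (conv_ucont ker_ucont).
  rewrite conv_zero// => /(mean_eq0 dm Kc gK muK) => /(_ (uM ker_ucont ker_ucont)).
  move=> /(_ (fun x => sqr_ge0 (ker x)) zero) /eqP.
  by rewrite mulf_eq0 orbb; apply/negP.
have := lt_le_trans h0 (sqn_conv_le ker_ucont).
rewrite pmulr_lgt0//; rewrite lt_def sqn_ge0 andbT; apply/eqP => k0.
by have := sqn_eq0 ker_ucont k0 zero; apply/eqP.
Qed.

(** The norm of the operator, here written [A], is attained in the limit:
  along a maximising sequence [u], the functions [A (u n)] approach some [g]
  uniformly while [A (A (u n)) - L * u n] tends to 0 in [L^2], hence [A (A g)
  = L * g]. *)
Lemma exists_conv_sq_eigenfunction :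
  exists lam g, [/\ 0 < lam, ucont d g, exists x, g x != 0 &
    forall x, conv (conv g) x = lam * g x].
Proof.
have adh n : exists f, [/\ ucont d f, sqn f <= 1 & L - n.+1%:R^-1 < sqn (conv f)].
  have n0 : 0 < n.+1%:R^-1 :> R by rewrite invr_gt0 ltr0n.
  by have [_ [f [? ?] <-] ?] := sup_adherent n0 normset_sup; exists f.
have [u uP] := choice adh.
have hu n : ucont d (u n) by case: (uP n).
have u1 n : sqn (u n) <= 1 by case: (uP n).
pose g x := ulim (fun n => conv (u n) x).
have bnd x : bounded_seq (fun n => conv (u n) x).
  exists M => n; apply: le_sqr; first exact: ltW.
  by rewrite (le_trans (sqr_conv_le _ (hu n)))// ler_piMr// exprn_ge0// ltW.
have geq (e a : R) : (forall f, ucont d f -> sqn f <= 1 ->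
    forall x x', d x x' < a -> `|conv f x - conv f x'| <= e) -> 0 < e ->
    forall x x', d x x' < a -> `|g x - g x'| <= e + e.
  move=> ha e0 x x' xx'; have e2 : 0 < e / 2 by lra.
  have [n [nx nx']] : exists n, `|conv (u n) x - g x| < e / 2 /\
      `|conv (u n) x' - g x'| < e / 2.
    have [n [? ?]] := filter_ex (filterI (ulim_near (bnd x) e2) (ulim_near (bnd x') e2)).
    by exists n.
  have := ha _ (hu n) (u1 n) _ _ xx'; move: nx nx'.
  by rewrite !ltr_norml !ler_norml; lra.
have hg : ucont d g.
  move=> e e0; have [|a a0 ha] := @conv_equicontinuous (e / 4); first lra.
  exists a => // x y xy; apply: le_lt_trans (geq _ _ ha _ _ _ xy) _; lra.
(* Equicontinuity makes the pointwise ultrafilter limit uniform. *)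
have unif (e : R) : 0 < e -> ultra [set n | forall x, `|conv (u n) x - g x| <= e].
  move=> e0; have e4 : 0 < e / 4 by lra.
  have [a a0 ha] := conv_equicontinuous e4.
  have [k [c cP]] := finite_net dm Kc a0.
  have : ultra [set n | forall i : 'I_k, `|conv (u n) (c i) - g (c i)| < e / 4].
    have hi (i : 'I_k) : \forall n \near ultra, `|conv (u n) (c i) - g (c i)| < e / 4.
      exact: ulim_near.
    exact: (@filter_forall nat _ _ ultra _ hi).
  apply: filterS => n nc x; have [i ik cx] := cP x.
  have := nc (Ordinal ik); have := ha _ (hu n) (u1 n) _ _ cx.
  have := geq _ _ ha e4 _ _ cx.
  by rewrite /= !ltr_norml !ler_norml; lra.
have pick (e : R) : 0 < e -> exists n, L - e < sqn (conv (u n)) /\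
    forall x, `|conv (u n) x - g x| <= e.
  move=> e0; have near_e : ultra [set n | n.+1%:R^-1 < e].
    by apply: near_ultra; exact: (near_infty_natSinv_lt (PosNum e0)).
  have [n [ne nx]] := filter_ex (filterI near_e (unif _ e0)).
  exists n; split => //; have [_ _ nL] := uP n; apply: le_lt_trans nL.
  by rewrite lerD2l lerN2 ltW.
exists L, g; split => //.
  apply: contrapT => /forallNP g0.
  have gz x : g x = 0 by have /negP/negPn/eqP := g0 x.
(* If [g = 0], then [sqn (conv (u n)) <= e ^+ 2], which is below [L - e]. *)
  pose e := Num.min L 1 / 2.
  have [e0 eL e1] : [/\ 0 < e, e <= L / 2 & e <= 1 / 2].
    have h0 : 0 < Num.min L 1 by rewrite lt_min L_gt0 ltr01.
    have h1 : Num.min L 1 <= L by rewrite ge_min lexx.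
    have h2 : Num.min L 1 <= 1 by rewrite ge_min lexx orbT.
    by rewrite /e; split; lra.
  have [n [nL nx]] := pick e e0.
  have : sqn (conv (u n)) <= e ^+ 2.
    apply: sqn_bound; first exact: conv_ucont.
    by move=> x; have := nx x; rewrite gz subr0.
  have : e ^+ 2 <= e / 2 by rewrite expr2 ler_pM2l//; lra.
  lra.
move=> x; apply/eqP; rewrite -subr_eq0 -sqrf_eq0; apply/eqP.
set X := _ - _.
(* [C] collects the bounds [t1], [t2], [t3] on the three terms of [XE]. *)
pose C := 3 * (M ^+ 4 + M ^+ 2 * L + L ^+ 2).
have C0 : 0 < C by rewrite mulr_gt0// !addr_gt0// ?mulr_gt0 ?exprn_gt0.
suff XC (e : R) : 0 < e -> e <= 1 -> X ^+ 2 <= C * e.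
  apply/eqP; rewrite eq_le sqr_ge0 andbT leNgt; apply/negP => X0.
  pose e := Num.min 1 (X ^+ 2 / (2 * C)).
  have C2 : 0 < 2 * C by lra.
  have e0 : 0 < e by rewrite lt_min ltr01 divr_gt0.
  have e1 : e <= 1 by rewrite ge_min lexx.
  have e2 : C * e <= X ^+ 2 / 2.
    have -> : X ^+ 2 / 2 = C * (X ^+ 2 / (2 * C)) by field; lra.
    by rewrite ler_pM2l// ge_min lexx orbT.
  have := XC e e0 e1; lra.
move=> e0 e1; have [n [nL nx]] := pick e e0.
pose h := conv (u n).
have hh : ucont d h by exact: conv_ucont.
have e2 : e ^+ 2 <= e by rewrite expr2 ler_piMr// ltW.
have hgh : ucont d (fun y => g y - h y) by exact: ucontB.
have hA : ucont d (conv h) by exact: conv_ucont.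
have hLu : ucont d (fun y => L * u n y) by exact: ucontZ.
have hr : ucont d (fun y => conv h y - L * u n y) by exact: ucontB.
have t1 : conv (conv (fun y => g y - h y)) x ^+ 2 <= M ^+ 4 * e.
  apply: le_trans (sqr_conv_le _ (conv_ucont hgh)) _.
  have : sqn (conv (fun y => g y - h y)) <= (M * e) ^+ 2.
    apply: sqn_bound; first exact: conv_ucont.
    move=> y; apply: le_sqr; first by rewrite mulr_ge0// ltW.
    apply: le_trans (sqr_conv_le _ hgh) _; rewrite exprMn ler_pM2l ?exprn_gt0//.
    by apply: sqn_bound => // z; rewrite distrC.
  move=> /(ler_wpM2l (exprn_ge0 2 (ltW M0))) /le_trans; apply.
  have -> : M ^+ 2 * (M * e) ^+ 2 = M ^+ 4 * e ^+ 2 by ring.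
  by rewrite ler_pM2l// exprn_gt0.
have t2 : conv (fun y => conv h y - L * u n y) x ^+ 2 <= M ^+ 2 * (L * e).
  apply: le_trans (sqr_conv_le _ hr) _; rewrite ler_pM2l ?exprn_gt0//.
  have -> : sqn (fun y => conv h y - L * u n y) =
      sqn (conv h) - (2 * L) * sqn h + L ^+ 2 * sqn (u n).
    have E : sqn h = I (fun y => conv h y * u n y) by rewrite conv_sym// /h.
    rewrite E /sqn -!meanZ -?meanB -?meanD.
    - by congr mean; apply/funext => y; ring.
    1-6: apply: uR; repeat first [exact: ucont_sqr | exact: uM | apply: ucontZ |
      apply: ucontB].
  have h1 : sqn (conv h) <= L * sqn h by exact: sqn_conv_le.
  have h2 : L ^+ 2 * sqn (u n) <= L ^+ 2 by rewrite ler_piMr// ?exprn_ge0 ?ltW// ltW.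
  have h3 : L * (L - e) <= L * sqn h by rewrite ler_pM2l// ltW.
  move: h1 h2 h3; rewrite expr2; lra.
have t3 : (L * (h x - g x)) ^+ 2 <= L ^+ 2 * e.
  rewrite exprMn ler_pM2l ?exprn_gt0//; apply: le_trans e2.
  by rewrite -real_normK ?num_real// ler_pXn2r// nnegrE// ltW.
have XE : X = conv (conv (fun y => g y - h y)) x +
    conv (fun y => conv h y - L * u n y) x + L * (h x - g x).
  rewrite /X convB// convZ// -/h.
  have -> : conv (fun y => g y - h y) = fun y => conv g y - conv h y.
    by apply/funext => y; exact: convB.
  by rewrite convB//; [ring | exact: conv_ucont].
have sq3 (a b c : R) : (a + b + c) ^+ 2 <= 3 * (a ^+ 2 + b ^+ 2 + c ^+ 2).
  have := sqr_ge0 (a - b); have := sqr_ge0 (b - c); have := sqr_ge0 (a - c); lra.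
rewrite XE; apply: le_trans (sq3 _ _ _) _; rewrite /C; lra.
Qed.

End Convolution.

Lemma expr_unbounded (R : realType) (B r : R) : 1 < r -> exists k, B < r ^+ k.
Proof.
move=> r1; have h k : 1 + k%:R * (r - 1) <= r ^+ k.
  elim: k => [|k ih]; first by rewrite mul0r addr0 expr0.
  rewrite exprS; apply: (@le_trans _ _ (r * (1 + k%:R * (r - 1)))); last first.
    by rewrite ler_pM2l//; lra.
  have : 0 <= k%:R * (r - 1) * (r - 1) by rewrite !mulr_ge0 ?ler0n//; lra.
  by rewrite -natr1; lra.
exists (Num.truncn (`|B| / (r - 1))).+1; apply: lt_le_trans (h _).
have : `|B| / (r - 1) < (Num.truncn (`|B| / (r - 1))).+1%:R by rewrite truncnS_gt.
by rewrite ltr_pdivrMr ?subr_gt0//; have := ler_norm B; lra.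
Qed.

(** A nonzero common invariant subspace of minimal dimension is, for each
  matrix of the family, contained in one of its eigenspaces. *)
Lemma common_eigenrow (F : closedFieldType) (n : nat) (I : Type) (U : I -> 'M[F]_n) :
  (0 < n)%N -> (forall i j, U i *m U j = U j *m U i) ->
  exists2 v : 'rV[F]_n, v != 0 & forall i, exists c, v *m U i = c *: v.
Proof.
move=> n0 Ucomm.
pose P r := `[< exists V : 'M[F]_n, [/\ \rank V = r, (0 < r)%N &
  forall i, stablemx V (U i)] >].
have Pn : exists r, P r.
  exists n; apply/asboolP; exists 1%:M; split; rewrite ?mxrank1// => i.
  by apply: stablemx_full; rewrite row_full_unit unitmx1.
case: (ex_minnP Pn) => r /asboolP[V [rV r0 sV]] rmin.
have Vn0 : V != 0 by rewrite -mxrank_eq0 rV -lt0n.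
exists (nz_row V) => [|i]; first by rewrite nz_row_eq0.
have sB : stablemx (row_base V) (U i) by rewrite stablemx_row_base.
pose A := mxpoly.conjmx (row_base V) (U i).
have [|a] := @closed_rootP F (char_poly A) _.
  by rewrite size_char_poly rV; case: (r) r0.
rewrite -eigenvalue_root_char => /eigenvalueP[w wA w0].
have wU : (w *m row_base V <= eigenspace (U i) a)%MS.
  rewrite -mxpoly.sub_eigenspace_conjmx ?row_base_free//.
  exact/eigenspaceP.
have u0 : w *m row_base V != 0.
  apply: contra w0 => /eqP h; apply/eqP.
  by apply: (row_free_inj (row_base_free V)); rewrite h mul0mx.
pose W := (V :&: eigenspace (U i) a)%MS.
have W0 : (0 < \rank W)%N.
  rewrite lt0n mxrank_eq0; apply: contra u0 => /eqP W0.
  rewrite -submx0 -W0 sub_capmx wU andbT.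
  by apply: submx_trans (submxMl _ _) _; rewrite eq_row_base.
have rW : (r <= \rank W)%N.
  apply: rmin; apply/asboolP; exists W; split => // j.
  rewrite sub_capmx (submx_trans (submxMr _ (capmxSl _ _)) (sV j)).
  by rewrite (submx_trans (submxMr _ (capmxSr _ _)))// comm_mx_stable_eigenspace.
have VW : (V <= W)%MS.
  by rewrite -(geq_leqif (mxrank_leqif_sup (capmxSl V (eigenspace (U i) a)))) rV.
exists a; apply/eigenspaceP; apply: submx_trans (nz_row_sub V) _.
exact: submx_trans VW (capmxSr _ _).
Qed.

Section MetricChar.
Context (R : realType) (K : ptopologicalType) (d : K -> K -> R) (add : K -> K -> K).

(** Characters, with continuity expressed through the metric. *)
Definition mchar (chi : K -> Cplx R) :=
  [/\ ucont d (fun x => complex.Re (chi x)), ucont d (fun x => complex.Im (chi x)),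
      forall x, Normc.normc (chi x) = 1 &
      forall x y, chi (add x y) = chi x * chi y].

End MetricChar.

Section ExistsCharacter.
Context (R : realType) (K : ptopologicalType) (d : K -> K -> R).
Hypothesis dm : metric_inducing_topology d.
Hypothesis Kc : compact [set: K].
Variables (add : K -> K -> K) (zero : K) (opp : K -> K).
Hypothesis gK : metric_group d add zero opp.
Variable mu : probability (borel K) R.
Hypothesis muK : forall x (A : set (borel K)), measurable A ->
  mu (add x @^-1` A) = mu A.
Implicit Types f g : K -> R.
Local Notation "x +' y" := (add x y) (at level 50, left associativity).
Local Notation I := (@mean R _ (borel K) mu).
Local Notation Re := complex.Re.
Local Notation Im := complex.Im.
Local Notation normc := Normc.normc.

Let uB f (uf : ucont d f) : bmeas (f : borel K -> R) := ucont_bmeas dm Kc uf.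
Let uR f (uf : ucont d f) : rint mu (f : borel K -> R) := bmeas_rint mu (uB uf).
Let uM := ucontM dm Kc.

Variable ker : K -> R.
Hypothesis ker_ucont : ucont d ker.
Hypothesis ker_even : forall x, ker (opp x) = ker x.
Hypothesis ker_zero : ker zero != 0.

Local Notation conv := (conv add opp mu ker).
Local Notation sqn := (sqn mu).
Let convB := convB dm Kc gK mu ker_ucont.
Let convD := convD dm Kc gK mu ker_ucont.
Let convZ := convZ dm Kc gK mu ker_ucont.
Let conv_ucont := conv_ucont dm Kc gK mu ker_ucont.

(** With [s ^+ 2 = L], either [conv g + s * g] does not vanish and is an
  eigenfunction for [s], or [g] is one for [- s]. *)
Lemma exists_conv_eigenfunction : exists (beta : R) g,
  [/\ beta != 0, ucont d g, exists x, g x != 0 & forall x, conv g x = beta * g x].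
Proof.
have [L [g [L0 hg [x0 gx0] AAg]]] :=
  exists_conv_sq_eigenfunction dm Kc gK muK ker_ucont ker_even ker_zero.
pose s := Num.sqrt L; have s0 : 0 < s by rewrite sqrtr_gt0.
have ss : s * s = L by rewrite -expr2 sqr_sqrtr// ltW.
have hA := conv_ucont hg.
have [[x hx]|h0] := pselect (exists x, conv g x + s * g x != 0).
  exists s, (fun x => conv g x + s * g x); split; rewrite ?gt_eqF//.
  - by apply: ucontD => //; exact: ucontZ.
  - by exists x.
  move=> y; rewrite convD//; last exact: ucontZ.
  by rewrite convZ// AAg -ss; ring.
exists (- s), g; split => //; first by rewrite oppr_eq0 gt_eqF.
  by exists x0.
move=> y; apply/eqP; rewrite -subr_eq0 mulNr opprK; apply/negPn/negP => hy.
by apply: h0; exists y.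
Qed.

Section Eigenspace.
Variable beta : R.
Hypothesis beta0 : beta != 0.

Definition eig g := ucont d g /\ forall x, conv g x = beta * g x.

Definition orthonormal_eig n (g : 'I_n -> K -> R) :=
  (forall i, eig (g i)) /\ forall i j, I (fun x => g i x * g j x) = (i == j)%:R.

Lemma eig_sum n (g : 'I_n -> K -> R) (c : 'I_n -> R) : (forall i, eig (g i)) ->
  eig (fun x => \sum_i c i * g i x).
Proof.
move=> hg; split.
  by apply: ucont_sum => i; apply: ucontZ; case: (hg i).
elim: n g c hg => [|n ih] g c hg x.
  rewrite big_ord0 mulr0 (_ : (fun _ => _) = (fun y => 0 * ker y)); last first.
    by apply/funext => y; rewrite big_ord0 mul0r.
  by rewrite convZ// mul0r.
rewrite big_ord_recl mulrDr -(ih (fun i => g (lift ord0 i)) (fun i => c (lift ord0 i)));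
  last by move=> i; exact: hg.
rewrite (_ : (fun y => \sum_i c i * g i y) = fun y => c ord0 * g ord0 y +
    \sum_(i < n) c (lift ord0 i) * g (lift ord0 i) y); last first.
  by apply/funext => y; rewrite big_ord_recl.
have [h0 h0'] := hg ord0.
rewrite convD; [|exact: ucontZ|]; last first.
  by apply: ucont_sum => i; apply: ucontZ; case: (hg (lift ord0 i)).
by rewrite convZ// h0'; ring.
Qed.

Lemma mean_orthonormal_sum n (g : 'I_n -> K -> R) (c : 'I_n -> R) j :
  orthonormal_eig g -> I (fun x => (\sum_i c i * g i x) * g j x) = c j.
Proof.
move=> [hg og].
have E : (fun x : borel K => (\sum_i c i * g i x) * g j x) =
    (fun x => \sum_i c i * (g i x * g j x)).
  by apply/funext => x; rewrite mulr_suml; apply: eq_bigr => i _; rewrite mulrA.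
have hij i : ucont d (fun x => g i x * g j x).
  by apply: uM; [case: (hg i) | case: (hg j)].
rewrite E mean_sum => [|i]; last by apply: uR; exact: ucontZ.
rewrite (bigD1 j)//= meanZ; last exact: uR.
rewrite og eqxx mulr1 big1 ?addr0// => i ij.
by rewrite meanZ ?og ?(negbTE ij) ?mulr0//; exact: uR.
Qed.

Lemma bessel n (g : 'I_n -> K -> R) f : orthonormal_eig g -> ucont d f ->
  \sum_i I (fun x => f x * g i x) ^+ 2 <= sqn f.
Proof.
move=> og hf; have [hg _] := og.
pose c i := I (fun x => f x * g i x); pose p x := \sum_i c i * g i x.
have hgi i : ucont d (g i) by case: (hg i).
have hp : ucont d p by apply: ucont_sum => i; exact: ucontZ.
have fp : I (fun x => f x * p x) = \sum_i c i ^+ 2.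
  rewrite (_ : (fun x => _) = fun x => \sum_i c i * (f x * g i x)); last first.
    by apply/funext => x; rewrite mulr_sumr; apply: eq_bigr => i _; rewrite mulrCA.
  rewrite mean_sum => [|i]; last by apply: uR; apply: ucontZ; exact: uM.
  by apply: eq_bigr => i _; rewrite meanZ// ; apply: uR; exact: uM.
have pp : I (fun x => p x * p x) = \sum_i c i ^+ 2.
  rewrite (_ : (fun x => _) = fun x => \sum_i c i * (p x * g i x)); last first.
    by apply/funext => x; rewrite {2}/p mulr_sumr; apply: eq_bigr => i _; rewrite mulrCA.
  rewrite mean_sum => [|i]; last by apply: uR; apply: ucontZ; exact: uM.
  apply: eq_bigr => i _; rewrite meanZ; last by apply: uR; exact: uM.
  by rewrite /p mean_orthonormal_sum.
have : 0 <= I (fun x => (f x - p x) ^+ 2) by apply: mean_ge0 => x; exact: sqr_ge0.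
rewrite (_ : (fun x => _) = fun x => f x ^+ 2 - 2 * (f x * p x) + p x * p x); last first.
  by apply/funext => x; ring.
have h1 : ucont d (fun x => f x ^+ 2) by exact: ucont_sqr.
have h2 : ucont d (fun x => 2 * (f x * p x)) by apply: ucontZ; exact: uM.
have h3 : ucont d (fun x => p x * p x) by exact: uM.
rewrite meanD ?meanB ?meanZ; try (by apply: uR => //; first [exact: ucontB | exact: uM]).
rewrite fp pp /sqn; lra.
Qed.

(** Bessel's inequality for a translate of [ker] bounds the sum of the
  squares of [beta * g i x], uniformly in [x]; its integral is [n%:R * beta
  ^+ 2]. *)
Lemma orthonormal_eig_size : exists N, forall n (g : 'I_n -> K -> R),
  orthonormal_eig g -> (n <= N)%N.
Proof.
have [M M0 kM] := ucont_bounded dm Kc ker_ucont.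
exists (Num.truncn (M ^+ 2 / beta ^+ 2)) => n g og; have [hg oo] := og.
have b2 : 0 < beta ^+ 2 by rewrite exprn_even_gt0.
suff : n%:R <= M ^+ 2 / beta ^+ 2.
  by move=> h; rewrite -ltnS -(ltr_nat R) (le_lt_trans h)// truncnS_gt.
rewrite ler_pdivlMr//.
have -> : n%:R * beta ^+ 2 = I (fun x => \sum_i beta ^+ 2 * (g i x * g i x)).
  rewrite mean_sum => [|i]; last first.
    by apply: uR; apply: ucontZ; apply: uM; case: (hg i).
  under eq_bigr => i _.
    rewrite meanZ; last by apply: uR; apply: uM; case: (hg i).
    rewrite oo eqxx mulr1; over.
  by rewrite sumr_const card_ord mulr_natl.
rewrite -[leRHS](mean_cst mu); apply: le_mean; last first.
- move=> x.
  have hk : ucont d (fun y => ker (x +' opp y)).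
    exact: (ucont2_r dm (ucont2_ker dm gK ker_ucont)).
  apply: (@le_trans _ _ (sqn (fun y => ker (x +' opp y)))).
    apply: le_trans (bessel og hk); apply: ler_sum => i _.
    have [_ /(_ x)] := hg i; move=> h.
    by rewrite [X in _ <= X ^+ 2](h : _ = beta * g i x) exprMn expr2.
  by apply: (sqn_bound dm Kc) => // y.
- exact: rint_cst.
- by apply: uR; apply: ucont_sum => i; apply: ucontZ; apply: uM; case: (hg i).
Qed.

Lemma eig_translate f a : eig f -> eig (fun x => f (a +' x)).
Proof.
move=> [hf ef]; split.
  by apply: ucont_comp hf => x y; exact: (mg_dist gK).
by move=> x; rewrite (conv_translate dm Kc gK muK ker_ucont)// ef.
Qed.

(** A maximal orthonormal family is finite and spans the eigenspace. *)
Lemma exists_orthonormal_eig_basis g0 : eig g0 -> (exists x, g0 x != 0) ->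
  exists n (g : 'I_n -> K -> R), [/\ (0 < n)%N, orthonormal_eig g &
    forall f, eig f -> forall x, f x = \sum_i I (fun y => f y * g i y) * g i x].
Proof.
move=> eg0 [x0 gx0].
have normalise h : eig h -> (exists x, h x != 0) ->
    exists2 c : R, c != 0 & I (fun x => (c * h x) * (c * h x)) = 1.
  move=> [hh _] [x hx].
  have sp : 0 < sqn h.
    rewrite lt_def sqn_ge0 andbT; apply: contra hx => /eqP h0.
    by rewrite (sqn_eq0 dm Kc gK muK hh h0).
  exists (Num.sqrt (sqn h))^-1; first by rewrite invr_eq0 sqrtr_eq0 -ltNge.
  rewrite -[LHS]/(sqn (fun x => _ * h x)) (sqnZ dm Kc)// exprVn sqr_sqrtr ?ltW//.
  by rewrite mulVf// gt_eqF.
pose P n := `[< exists g : 'I_n -> K -> R, orthonormal_eig g >].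
have eigZ c h : eig h -> eig (fun x => c * h x).
  move=> [hh eh]; split; first exact: ucontZ.
  by move=> x; rewrite convZ// eh mulrCA.
have P1 : P 1%N.
  have [c c0 c1] := normalise _ eg0 (ex_intro _ x0 gx0).
  apply/asboolP; exists (fun _ x => c * g0 x); split => [_|i j]; first exact: eigZ.
  by rewrite c1 !ord1 eqxx.
have [N NP] := orthonormal_eig_size.
have PN n : P n -> (n <= N)%N by move=> /asboolP[g /NP].
case: (ex_maxnP (ex_intro _ 1%N P1) PN) => n /asboolP[g og] nmax.
exists n, g; split => //; first exact: nmax P1.
move=> f ef x; apply/eqP; rewrite -subr_eq0; apply/negPn/negP => rx.
have [hg oo] := og; have [hf _] := ef.
pose c i := I (fun y => f y * g i y).
pose r y := f y + -1 * \sum_i c i * g i y.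
have hgi i : ucont d (g i) by case: (hg i).
have hs : eig (fun y => \sum_i c i * g i y) by exact: eig_sum.
have er : eig r.
  have [h1 h2] := eigZ (-1) _ hs; split; first exact: ucontD.
  move=> y; rewrite convD// h2; case: ef => _ ->; by rewrite /r mulrDr.
have [hr _] := er.
have orth i : I (fun y => r y * g i y) = 0.
  have -> : (fun y : borel K => r y * g i y) =
      fun y => f y * g i y + -1 * ((\sum_i c i * g i y) * g i y).
    by apply/funext => y; rewrite /r; ring.
  have [hs1 _] := hs.
  have h1 : ucont d (fun y => f y * g i y) by exact: uM.
  have h2 : ucont d (fun y => (\sum_i c i * g i y) * g i y) by exact: uM.
  rewrite meanD ?meanZ; try (by apply: uR => //; exact: ucontZ).
  by rewrite mean_orthonormal_sum// /c; ring.
have [k k0 k1] : exists2 k : R, k != 0 & I (fun x => (k * r x) * (k * r x)) = 1.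
  by apply: normalise => //; exists x; rewrite /r mulN1r.
have /nmax : P n.+1; last by rewrite ltnn.
pose g' (i : 'I_n.+1) := match unlift ord_max i with
  Some j => g j | None => fun x => k * r x end.
have orth' j : I (fun x => k * r x * g j x) = 0.
  rewrite (_ : (fun x => _) = fun x => k * (r x * g j x)).
    by rewrite meanZ ?orth ?mulr0//; apply: uR; exact: uM.
  by apply/funext => y; rewrite mulrA.
apply/asboolP; exists g'; split => [i|i j]; rewrite /g'.
  by case: unliftP => [j _|_]; [exact: hg | exact: eigZ].
case: (unliftP ord_max i) => [i' ->|->]; case: (unliftP ord_max j) => [j' ->|->].
- by rewrite oo (inj_eq lift_inj).
- rewrite eq_sym (negbTE (neq_lift _ _)) -[RHS](orth' i').
  by congr mean; apply/funext => y; rewrite mulrC.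
- by rewrite (negbTE (neq_lift _ _)) orth'.
- by rewrite k1 eqxx.
Qed.

(** Translations commute with [conv] and with each other, hence act on the
  eigenspace by commuting matrices. *)
Lemma translation_matrix n (g : 'I_n -> K -> R) : orthonormal_eig g ->
  (forall f, eig f -> forall x, f x = \sum_i I (fun y => f y * g i y) * g i x) ->
  exists U : K -> 'M[R]_n, (forall a b, U a *m U b = U b *m U a) /\
    forall a x j, g j (a +' x) = \sum_i U a j i * g i x.
Proof.
move=> og span; have [hg oo] := og.
pose U a : 'M[R]_n := \matrix_(j, i) I (fun y => g j (a +' y) * g i y).
have Ug a x j : g j (a +' x) = \sum_i U a j i * g i x.
  rewrite (span (fun x => g j (a +' x))); last exact: eig_translate.
  by apply: eq_bigr => i _; rewrite mxE.
exists U; split => // a b; apply/matrixP => j h.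
have key c e x : g j (c +' (e +' x)) = \sum_i (U c *m U e) j i * g i x.
  rewrite Ug; under eq_bigr do rewrite Ug mulr_sumr.
  rewrite exchange_big; apply: eq_bigr => i _; rewrite mxE mulr_suml.
  by apply: eq_bigr => k _; rewrite mulrA.
rewrite -(mean_orthonormal_sum (fun i => (U a *m U b) j i) h og).
rewrite -(mean_orthonormal_sum (fun i => (U b *m U a) j i) h og).
by congr mean; apply/funext => x; rewrite -!key (gaddCA gK).
Qed.

End Eigenspace.

(** A common eigenvector of the translations of an eigenspace is proportional
  to a character. *)
Lemma exists_character_not_orthogonal :
  exists2 chi, mchar d add chi &
    cintegral mu (fun x : borel K => (ker x)%:C * chi x) != 0.
Proof.
have [b [g0 [b0 hg0 g00 Ag0]]] := exists_conv_eigenfunction.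
have [n [g [n0 og span]]] := exists_orthonormal_eig_basis b0 (conj hg0 Ag0) g00.
have [U [Ucomm Ug]] := translation_matrix og span.
have [hg oo] := og.
pose UC a := map_mx (real_complex R) (U a).
have UCcomm a a' : UC a *m UC a' = UC a' *m UC a by rewrite -!map_mxM Ucomm.
have [v v0 vU] := common_eigenrow n0 UCcomm.
pose phi x : Cplx R := \sum_j v 0 j * (g j x)%:C.
have phi_c a : exists c : Cplx R, forall x, phi (a +' x) = c * phi x.
  have [c cP] := vU a; exists c => x.
  rewrite /phi; under eq_bigr do rewrite Ug rmorph_sum mulr_sumr.
  rewrite exchange_big mulr_sumr; apply: eq_bigr => i _.
  have -> : c * (v 0 i * (g i x)%:C) = (c *: v) 0 i * (g i x)%:C.
    by rewrite mxE mulrA.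
  rewrite -cP mxE mulr_suml; apply: eq_bigr => j _.
  by rewrite mxE rmorphM mulrA.
have [c cP] := choice phi_c.
have hgi i : ucont d (g i) by case: (hg i).
have RphiE x : Re (phi x) = \sum_j Re (v 0 j) * g j x.
  by rewrite Re_sum; apply: eq_bigr => j _; rewrite ReM/= mulr0 subr0.
have IphiE x : Im (phi x) = \sum_j Im (v 0 j) * g j x.
  by rewrite Im_sum; apply: eq_bigr => j _; rewrite ImM/= mulr0 add0r.
have hR : ucont d (fun x => Re (phi x)).
  under eq_fun do rewrite RphiE; by apply: ucont_sum => i; exact: ucontZ.
have hI : ucont d (fun x => Im (phi x)).
  under eq_fun do rewrite IphiE; by apply: ucont_sum => i; exact: ucontZ.
have phi0 : phi zero != 0.
  apply/eqP => p0; move/eqP: v0; apply; apply/rowP => j; rewrite mxE.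
  have pz x : phi x = 0 by rewrite -(gaddr0 gK x) cP p0 mulr0.
  apply: cplx_eq => /=.
    rewrite -(mean_orthonormal_sum (fun i => Re (v 0 i)) j og).
    rewrite -[RHS](mean_cst mu); congr mean; apply/funext => x.
    by rewrite -RphiE pz mul0r.
  rewrite -(mean_orthonormal_sum (fun i => Im (v 0 i)) j og).
  rewrite -[RHS](mean_cst mu); congr mean; apply/funext => x.
  by rewrite -IphiE pz mul0r.
have phiE x : phi x = c x * phi zero by rewrite -cP (gaddr0 gK).
have cM x y : c (x +' y) = c x * c y.
  by apply: (mulIf phi0); rewrite -phiE cP phiE mulrA.
have cE x : c x = (phi zero)^-1 * phi x by rewrite [phi x]phiE mulrCA mulVf ?mulr1.
have hcR : ucont d (fun x => Re (c x)).
  under eq_fun do rewrite cE ReM; by apply: ucontB; exact: ucontZ.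
have hcI : ucont d (fun x => Im (c x)).
  under eq_fun do rewrite cE ImM; by apply: ucontD; exact: ucontZ.
have c0 : c zero = 1 by rewrite cE mulVf.
(* A value of modulus greater than 1 would have unbounded powers. *)
have c_le1 x : normc (c x) <= 1.
  rewrite leNgt; apply/negP => cx.
  have [M M0 cM'] := ucont_bounded dm Kc hcR; have [N N0 cN] := ucont_bounded dm Kc hcI.
  pose it k := iter k (add x) zero.
  have itE k : normc (c (it k)) = normc (c x) ^+ k.
    elim: k => [|k ih]; first by rewrite /it/= c0 normc_one.
    by rewrite /it iterS cM normc_mul -/(it k) ih exprS.
  have [k] := expr_unbounded (M + N) cx.
  rewrite -itE ltNge => /negP; apply; apply: le_trans (normc_le_ReIm _) _.
  by rewrite lerD.
have c1 x : normc (c x) = 1.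
  apply/eqP; rewrite eq_le c_le1/=.
  have : normc (c x) * normc (c (opp x)) = 1.
    by rewrite -normc_mul -cM (gaddrN gK) c0 normc_one.
  have := c_le1 (opp x); have := normc_ge0 (c x); nra.
exists c; first by split.
have -> : cintegral mu (fun x : borel K => (ker x)%:C * c x) = b%:C.
  apply: (mulfI phi0); rewrite -cintegralZ; last first.
    apply/cbmeas_cint/cbmeasM; first by apply: cbmeas_real; exact: uB.
    by split; exact: uB.
  have -> : (fun x : borel K => phi zero * ((ker x)%:C * c x)) =
      (fun x : borel K => \sum_j v 0 j * (ker x * g j x)%:C).
    apply/funext => x; rewrite mulrCA [phi zero * _]mulrC -phiE mulr_sumr.
    by apply: eq_bigr => j _; rewrite rmorphM/= mulrCA.
  have hk j : cint mu (fun x : borel K => (ker x * g j x)%:C).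
    by apply/cbmeas_cint/cbmeas_real/uB; exact: uM.
  rewrite cintegral_sum => [|j]; last exact: cintZ.
  rewrite /phi mulr_suml; apply: eq_bigr => j _.
  rewrite cintegralZ// -mulrA; congr (_ * _).
  rewrite cintegralE/= mean_cst -rmorphM/= mulrC.
  have [_ /(_ zero)] := hg j.
  by rewrite (conv_zero gK mu ker_even)// => ->.
by apply/eqP => /(congr1 (@complex.Re R)) /= /eqP; apply/negP.
Qed.

End ExistsCharacter.

(** * Concentrated trigonometric polynomials *)

Section LinearSpan.
Context (R : realType) (K : Type).
Implicit Types (S : set (K -> Cplx R)) (F G : K -> Cplx R).

Inductive lspan S : (K -> Cplx R) -> Prop :=
| lspan0 : lspan S (fun=> 0)
| lspan_base chi of S chi : lspan S chi
| lspanD F G of lspan S F & lspan S G : lspan S (fun x => F x + G x)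
| lspanZ c F of lspan S F : lspan S (fun x => c * F x).

Lemma lspanM S : (forall a b, S a -> S b -> S (fun x => a x * b x)) ->
  forall F G, lspan S F -> lspan S G -> lspan S (fun x => F x * G x).
Proof.
move=> SM F G tF; elim: tF G => {F} [G _|a Sa G tG|F F' _ hF _ hF' G tG|c F _ hF G tG].
- by under eq_fun do rewrite mul0r; exact: lspan0.
- elim: tG => {G} [|b Sb|G G' _ hG _ hG'|c G _ hG].
  + by under eq_fun do rewrite mulr0; exact: lspan0.
  + by apply: lspan_base; exact: SM.
  + by under eq_fun do rewrite mulrDr; exact: lspanD.
  + by under eq_fun do rewrite mulrCA; exact: lspanZ.
- by under eq_fun do rewrite mulrDl; apply: lspanD; [exact: hF | exact: hF'].
- by under eq_fun do rewrite -mulrA; apply: lspanZ; exact: hF.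
Qed.

Lemma lspan_cst S (c : Cplx R) : S (fun=> 1) -> lspan S (fun=> c).
Proof.
move=> S1; have := lspanZ c (lspan_base S1).
by congr lspan; apply/funext => x; rewrite mulr1.
Qed.

End LinearSpan.

Section MChar.
Context (R : realType) (K : ptopologicalType) (d : K -> K -> R).
Hypothesis dm : metric_inducing_topology d.
Hypothesis Kc : compact [set: K].
Variables (add : K -> K -> K) (zero : K) (opp : K -> K).
Hypothesis gK : metric_group d add zero opp.
Local Notation "x +' y" := (add x y) (at level 50, left associativity).
Local Notation Re := complex.Re.
Local Notation Im := complex.Im.
Local Notation normc := Normc.normc.
Local Notation mchar := (mchar d add).
Implicit Types (chi : K -> Cplx R).

Lemma mchar1 : mchar (fun=> 1).
Proof.
by split=> *; rewrite ?normc_one ?mulr1//; exact: ucont_cst.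
Qed.

Lemma mcharM chi chi' : mchar chi -> mchar chi' -> mchar (fun x => chi x * chi' x).
Proof.
move=> [h1 h2 h3 h4] [h1' h2' h3' h4']; split.
- by under eq_fun do rewrite ReM; apply: ucontB; exact: (ucontM dm Kc).
- by under eq_fun do rewrite ImM; apply: ucontD; exact: (ucontM dm Kc).
- by move=> x; rewrite normc_mul h3 h3' mulr1.
- by move=> x y; rewrite h4 h4' mulrACA.
Qed.

Lemma mchar_conj chi : mchar chi -> mchar (fun x => (chi x)^*)%C.
Proof.
move=> [h1 h2 h3 h4]; split.
- by under eq_fun do rewrite ReJ.
- by under eq_fun do rewrite ImJ; exact: ucontN.
- by move=> x; rewrite normc_conj.
- by move=> x y; rewrite h4 rmorphM.
Qed.

Lemma mchar_neq0 chi x : mchar chi -> chi x != 0.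
Proof.
move=> [_ _ h _]; apply/eqP => c0; have := h x.
by rewrite c0 normc_zero => /esym/eqP; rewrite oner_eq0.
Qed.

Lemma mchar_zero chi : mchar chi -> chi zero = 1.
Proof.
move=> hchi; apply: (mulfI (mchar_neq0 zero hchi)).
by case: hchi => _ _ _ h; rewrite -h (mg_add0 gK) mulr1.
Qed.

Lemma mcharN chi x : mchar chi -> chi (opp x) = ((chi x)^*)%C.
Proof.
move=> hchi; have [_ _ h1 h] := hchi; rewrite -normc1_inv//.
apply: (mulfI (mchar_neq0 x hchi)).
by rewrite -h (gaddrN gK) mchar_zero// mulfV// (mchar_neq0 x hchi).
Qed.

Lemma unimodular_Re_lt1 (z : Cplx R) : normc z = 1 -> z <> 1 -> Re z < 1.
Proof.
move=> z1 zn1; have z2 : Re z ^+ 2 + Im z ^+ 2 = 1 by rewrite -sqr_normcE z1 expr1n.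
rewrite lt_neqAle (le_trans (ler_norm _)) ?andbT -?z1 ?le_Re_normc// z1.
apply: contra_not_neq zn1 => Rz.
move: z2; rewrite Rz expr1n => /(canRL (addKr _)); rewrite addNr => /eqP.
by rewrite sqrf_eq0 => /eqP Iz; apply: cplx_eq.
Qed.

Lemma mchar_cbmeas chi : mchar chi -> cbmeas (chi : borel K -> Cplx R).
Proof. by move=> [? ? _ _]; split; exact: (ucont_bmeas dm Kc). Qed.

Variable mu : probability (borel K) R.
Hypothesis muK : forall x (A : set (borel K)), measurable A ->
  mu (add x @^-1` A) = mu A.

Lemma cintegral_translate (h : K -> Cplx R) a : cbmeas (h : borel K -> Cplx R) ->
  cintegral mu (fun x : borel K => h (a +' x)) = cintegral mu (h : borel K -> Cplx R).
Proof.
move=> [hR hI]; rewrite !cintegralE.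
by congr (_ +i* _); exact: (mean_translate dm gK muK a).
Qed.

Lemma cintegral_mchar_shift (h chi : K -> Cplx R) a :
  cbmeas (h : borel K -> Cplx R) -> mchar chi ->
  cintegral mu (fun x : borel K => h (a +' x) * chi x)
    = ((chi a)^*)%C * cintegral mu (fun x : borel K => h x * chi x).
Proof.
move=> hh hchi; have [_ _ c1 cM] := hchi.
have hc := mchar_cbmeas hchi.
rewrite -cintegralZ; last by apply/cbmeas_cint/cbmeasM.
rewrite -(@cintegral_translate (fun x => ((chi a)^*)%C * (h x * chi x)) a); last first.
  by apply/cbmeasZ/cbmeasM.
congr cintegral; apply/funext => x; rewrite cM.
transitivity ((chi a * ((chi a)^*)%C) * (h (a +' x) * chi x)); last by ring.
by rewrite mulcJ c1 expr1n mul1r.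
Qed.

(** Translating by [x0] multiplies the integral by [chi x0]. *)
Lemma mchar_orthogonal chi x0 : mchar chi -> chi x0 <> 1 ->
  cintegral mu (chi : borel K -> Cplx R) = 0.
Proof.
move=> hchi n1; have hc := mchar_cbmeas hchi; have [_ _ c1 cM] := hchi.
have := cintegral_translate x0 hc.
under [X in cintegral mu X]eq_fun do rewrite cM.
rewrite cintegralZ; last exact: cbmeas_cint.
move=> /eqP; rewrite -subr_eq0 -{2}[cintegral mu chi]mul1r -mulrBl mulf_eq0.
by rewrite subr_eq0 => /orP[/eqP //|/eqP].
Qed.

(** Convolution with [2 phi - phi (. - k) - phi (. + k)] kills every character
  that takes the value 1 at [k]. *)
Lemma mchar_separates k : k <> zero -> exists2 chi, mchar chi & chi k <> 1.
Proof.
move=> k0.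
have dk : 0 < d zero k.
  by rewrite lt_def (d_ge0 dm) andbT; apply/eqP => /(d_eq0 dm) /esym.
pose phi x := Num.max 0 (d zero k - d x zero).
have phi_c : ucont d phi.
  apply: ucont_max; first exact: ucont_cst.
  by apply: ucontB; [exact: ucont_cst | exact: ucont_dist].
have phi_even x : phi (opp x) = phi x.
  by rewrite /phi -{2}(gopp0 gK) (gopp_dist dm gK).
have phi_ge0 x : 0 <= phi x by rewrite le_max lexx.
have phik x : x = k \/ x = opp k -> phi x = 0.
  have h : phi k = 0 by rewrite /phi (d_sym dm k) subrr maxxx.
  by move=> [->//|->]; rewrite phi_even.
pose ker x := 2 * phi x - phi (opp k +' x) - phi (k +' x).
have tr a : ucont d (fun x => phi (a +' x)).
  by apply: ucont_comp phi_c => x y; exact: (mg_dist gK).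
have ker_c : ucont d ker.
  by apply: ucontB => //; apply: ucontB => //; exact: ucontZ.
have ker_even x : ker (opp x) = ker x.
  rewrite /ker phi_even -(goppD gK) phi_even.
  rewrite [X in _ - phi X](_ : _ = opp (opp k +' x)) ?phi_even 1?addrAC//.
  by rewrite (goppD gK) (goppK gK).
have ker0 : ker zero != 0.
  rewrite /ker !(gaddr0 gK) (phik (opp k)); last by right.
  rewrite (phik k); last by left.
  rewrite !subr0 mulf_neq0//; rewrite /phi (dxx dm) subr0.
  by rewrite gt_eqF// lt_max dk orbT.
have [chi hchi] := exists_character_not_orthogonal dm Kc gK muK ker_c ker_even ker0.
move=> int0; exists chi => // chik; move/eqP: int0; apply.
pose phiC x : Cplx R := (phi x)%:C.
have hp : cbmeas (phiC : borel K -> Cplx R).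
  by apply: cbmeas_real; exact: (ucont_bmeas dm Kc).
have hpa a : cbmeas (fun x : borel K => phiC (a +' x)).
  by apply: cbmeas_real; exact: (ucont_bmeas dm Kc).
have hc := mchar_cbmeas hchi.
have -> : (fun x : borel K => (ker x)%:C * chi x) = fun x => 2 * (phiC x * chi x)
    - phiC (opp k +' x) * chi x - phiC (k +' x) * chi x.
  apply/funext => x; rewrite /ker !rmorphB rmorphM/= rmorph_nat.
  by rewrite /phiC; ring.
have c1 : cint mu (fun x : borel K => phiC x * chi x) by apply/cbmeas_cint/cbmeasM.
have ca a : cint mu (fun x : borel K => phiC (a +' x) * chi x).
  by apply/cbmeas_cint/cbmeasM.
rewrite !cintegralB ?cintegralZ//; try (by apply: cintB => //; exact: cintZ); try exact: cintZ.
rewrite !cintegral_mchar_shift// mcharN// chik.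
have -> : (((1 : Cplx R)^*)^*)%C = 1 by apply: cplx_eq; rewrite //= ?oppr0.
have -> : ((1 : Cplx R)^*)%C = 1 by apply: cplx_eq; rewrite //= ?oppr0.
ring.
Qed.

Definition char_group (S : set (K -> Cplx R)) :=
  [/\ S `<=` mchar, S (fun=> 1),
      forall a b, S a -> S b -> S (fun x => a x * b x) &
      forall a, S a -> S (fun x => (a x)^*)%C].

Lemma mchar_group : char_group [set chi | mchar chi].
Proof.
split=> //=; [exact: mchar1 | by move=> *; exact: mcharM | by move=> *; exact: mchar_conj].
Qed.

(** Large powers of the product of the factors [(1 + Re chi) / 2], where the
  characters [chi] separate the complement of a ball from the neutral element. *)
Lemma concentrated_polynomial S (eta : R) : char_group S ->
  (forall k, k <> zero -> exists2 chi, S chi & chi k <> 1) -> 0 < eta ->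
  exists eta' : R, [/\ 0 < eta', eta' <= eta & forall e : R, 0 < e ->
    exists f : K -> R, [/\ lspan S (fun x => (f x)%:C), ucont d f,
      forall x, 0 <= f x,
      forall x, eta <= d zero x -> f x <= e &
      forall x, d zero x < eta' -> 1 <= f x]].
Proof.
move=> [Sm S1 SM SJ] Ssep eta0.
have P x : exists t : (K -> Cplx R) * (R * R), [/\ S t.1, 0 < t.2.1, 0 < t.2.2 <= 1 &
    forall y, d x y < t.2.1 -> eta <= d zero y -> Re (t.1 y) <= 1 - t.2.2].
  have [xeta|xeta] := ltP (d zero x) eta.
    exists (fun=> 1, (eta - d zero x, 1)) => /=; split => //; first lra.
      by rewrite ltr01 lexx.
    by move=> y xy; have := d_tri dm zero x y; lra.
  have [|chi Schi chix] := Ssep x.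
    by move=> x0; move: xeta; rewrite x0 (dxx dm); lra.
  have [hR _ h1 _] := Sm _ Schi.
  have Rx := unimodular_Re_lt1 (h1 x) chix.
  have [|rho rho0 hrho] := hR ((1 - Re (chi x)) / 2); first lra.
  exists (chi, (rho, (1 - Re (chi x)) / 2)) => /=; split => //.
    by have := le_Re_normc (chi x); rewrite h1 ler_norml; lra.
  by move=> y /hrho + _; rewrite ltr_norml; lra.
have [t tP] := choice P.
have t0 x : 0 < (t x).2.1 by case: (tP x).
have [l lP] := compact_ball_cover dm Kc t0.
pose fac (chi : K -> Cplx R) y : R := (1 + Re (chi y)) / 2.
have fac01 x y : 0 <= fac (t x).1 y <= 1.
  have [/Sm[_ _ h _] _ _ _] := tP x.
  have := le_Re_normc ((t x).1 y); rewrite h ler_norml /fac; lra.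
pose q s y := \prod_(x <- s) fac (t x).1 y.
have q01 s y : 0 <= q s y <= 1.
  rewrite /q; elim: s => [|x s]; first by rewrite big_nil ler01 lexx.
  rewrite big_cons; have /andP[a0 a1] := fac01 x y => /andP[b0 b1].
  by rewrite mulr_ge0// mulr_ile1.
have facu x : ucont d (fac (t x).1).
  have [/Sm[h _ _ _] _ _ _] := tP x.
  rewrite /fac; under eq_fun do rewrite mulrC.
  by apply: ucontZ; apply: ucontD => //; exact: ucont_cst.
have qu s : ucont d (q s).
  elim: s => [|x s ih]; rewrite /q.
    by under eq_fun do rewrite big_nil; exact: ucont_cst.
  by under eq_fun do rewrite big_cons; exact: (ucontM dm Kc).
have qt s : lspan S (fun y => (q s y)%:C).
  elim: s => [|x s ih]; rewrite /q.
    under eq_fun do rewrite big_nil; exact: lspan_cst.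
  under eq_fun do rewrite big_cons rmorphM/=; apply: lspanM => //.
  have [Sx _ _ _] := tP x.
  rewrite (_ : (fun y => _) = fun y => 2^-1 + (4^-1 * (t x).1 y + 4^-1 * (((t x).1 y)^*)%C)).
    apply: lspanD; first exact: lspan_cst.
    by apply: lspanD; apply: lspanZ; apply: lspan_base => //; exact: SJ.
  apply/funext => y; have -> : (((t x).1 y)^*)%C = (Re ((t x).1 y))%:C *+ 2 - (t x).1 y.
    by apply: cplx_eq; rewrite !ReImE/= ?mulr2n; ring.
  by rewrite /fac rmorphM rmorphD fmorphV rmorph_nat rmorph1; field.
have q_zero : q l zero = 1.
  rewrite /q big1// => x _; rewrite /fac.
  have [/Sm/mchar_zero -> _ _ _] := tP x; by rewrite /=; field.
pose s0 := \big[Order.min/1]_(x <- l) (t x).2.2.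
have s00 : 0 < s0.
  by apply: lt_bigmin => // x _; case: (tP x) => _ _ /andP[].
have s01 : s0 <= 1 by exact: bigmin_le_id.
pose th := 1 - s0 / 2.
have qfar y : eta <= d zero y -> q l y <= th.
  move=> ey; have [x xl xy] := lP y; have [_ _ _ /(_ _ xy ey) h] := tP x.
  have qx : q l y <= fac (t x).1 y.
    rewrite /q (perm_big _ (perm_to_rem xl)) big_cons/= ler_piMr//.
      by case/andP: (fac01 x y).
    by case/andP: (q01 (rem x l) y).
  apply: (le_trans qx); have : s0 <= (t x).2.2 by rewrite ge_bigmin_seq.
  by rewrite /fac /th; lra.
(* [q l] is at most [th] off the ball and equals 1 at [zero], so the powers
   of [q l / th'] tend to 0 off the ball and are at least 1 near [zero]. *)
pose th' := (1 + th) / 2.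
have thP : [/\ 0 < th, th < th' & th' < 1] by rewrite /th' /th; split; lra.
have [th0 thth' th'1] := thP.
have [|a a0 ha] := qu l (1 - th'); first lra.
have th'0 : 0 < th' by lra.
exists (Num.min a eta); split; first by rewrite lt_min a0.
  by rewrite ge_min lexx orbT.
move=> e e0; have [|n hn] := @expr_unbounded R e^-1 (th' / th).
  by rewrite ltr_pdivlMr// mul1r.
exists (fun y => (q l y / th') ^+ n); split.
- elim: n {hn} => [|n ih].
    by under eq_fun do rewrite expr0; exact: lspan_cst.
  under eq_fun do rewrite exprS rmorphM/=; apply: lspanM => //.
  under eq_fun do rewrite mulrC rmorphM/=; exact: lspanZ.
- elim: n {hn} => [|n ih].
    by under eq_fun do rewrite expr0; exact: ucont_cst.
  under eq_fun do rewrite exprS; apply: (ucontM dm Kc) => //.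
  by under eq_fun do rewrite mulrC; exact: ucontZ.
- by move=> y; have [q0 _] := andP (q01 l y); rewrite exprn_ge0// (divr_ge0 q0 (ltW th'0)).
- move=> y /qfar qy; apply: (@le_trans _ _ ((th / th') ^+ n)).
    have [q0 _] := andP (q01 l y); apply: lerXn2r; rewrite ?nnegrE.
    - exact: divr_ge0 q0 (ltW th'0).
    - exact: divr_ge0 (ltW th0) (ltW th'0).
    - by rewrite ler_pM2r ?invr_gt0.
  have hp : 0 < (th' / th) ^+ n := exprn_gt0 _ (divr_gt0 th'0 th0).
  by rewrite -invf_div exprVn invf_ple ?posrE// ltW.
- move=> y; rewrite lt_min => /andP[/ha + _]; rewrite q_zero ltr_norml => /andP[_ h].
  by rewrite exprn_ege1// ler_pdivlMr// mul1r; lra.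
Qed.

End MChar.

(** * Square-integrable functions *)

Lemma cvge_exists_lt (R : realType) (u : nat -> \bar R) (l e : \bar R) :
  u n @[n --> \oo] --> l -> (l < e)%E -> exists n, (u n < e)%E.
Proof.
move=> ul le; have [n _ hn] := ul _ (open_nbhs_nbhs (conj (@open_ereal_lt_ereal R e) le)).
by exists n; exact: hn n (leqnn n).
Qed.

Import HBNNSimple.

Section SquareNorm.
Context (R : realType) (dT : measure_display) (T : measurableType dT).
Variable P : probability T R.
Notation Re := complex.Re.
Notation Im := complex.Im.
Notation normc := Normc.normc.
Implicit Types (f g h : T -> Cplx R).
Local Notation cmeas := (@cmeasurable R dT T).

(** The square of the [L^2] norm.  The parallelogram-type bound [sqnormD]
  replaces the triangle inequality in all approximation arguments. *)
Definition sqnorm f : \bar R := \int[P]_x (normc (f x) ^+ 2)%:E.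

Lemma sqnorm_ge0 f : (0 <= sqnorm f)%E.
Proof. by apply: integral_ge0 => x _; rewrite lee_fin sqr_ge0. Qed.

Lemma L2normE f : exists N : \bar R, [/\ L2norm P f = N, (0 <= N)%E &
  sqnorm f = (N * N)%E].
Proof.
exists (L2norm P f); split => //; first exact: Lnorm_ge0.
have := powR_Lnorm P (fun x => (normc (f x))%:E) (r := 2) _.
rewrite pnatr_eq0 => /(_ isT).
have := Lnorm_ge0 P 2%:E (fun x => (normc (f x))%:E).
rewrite -/(L2norm P f); case: (L2norm P f) => [r| |//] r0.
  rewrite poweR_EFin powR_mulrn// expr2 -EFinM => ->.
  by apply: eq_integral => x _; rewrite /= ger0_norm ?normc_ge0// powR_mulrn ?normc_ge0.
rewrite poweRyr ?pnatr_eq0// mulyy => ->.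
by apply: eq_integral => x _; rewrite /= ger0_norm ?normc_ge0// powR_mulrn ?normc_ge0.
Qed.

Lemma L2norm_lt f (e : R) : 0 < e ->
  (L2norm P f < e%:E)%E <-> (sqnorm f < (e ^+ 2)%:E)%E.
Proof.
move=> e0; have [N [-> N0 ->]] := L2normE f.
case: N N0 => [r| |//]; last by rewrite mulyy.
rewrite lee_fin -EFinM !lte_fin => r0; rewrite -expr2.
by rewrite ltr_pXn2r// nnegrE// ltW.
Qed.

Lemma L2norm_lty f : (L2norm P f < +oo)%E <-> (sqnorm f < +oo)%E.
Proof.
have [N [-> N0 ->]] := L2normE f.
by case: N N0 => [r| |//] _; rewrite ?mulyy// -EFinM !ltry.
Qed.

Lemma measurable_sqnormc f : cmeasurable f ->
  measurable_fun setT (fun x => (normc (f x) ^+ 2)%:E).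
Proof.
move=> [mr mi]; apply/measurable_EFinP.
under eq_fun do rewrite sqr_normcE.
by apply: measurable_funD; apply: measurable_funX.
Qed.

Lemma cmeasurable_cst (c : Cplx R) : cmeasurable (fun _ : T => c).
Proof. by split; exact: measurable_cst. Qed.

Lemma cmeasurableD f g : cmeasurable f -> cmeasurable g ->
  cmeasurable (fun x => f x + g x).
Proof.
move=> [? ?] [? ?]; split.
- by under eq_fun do rewrite ReD; exact: measurable_funD.
- by under eq_fun do rewrite ImD; exact: measurable_funD.
Qed.

Lemma cmeasurableM f g : cmeasurable f -> cmeasurable g ->
  cmeasurable (fun x => f x * g x).
Proof.
move=> [? ?] [? ?]; split.
- by under eq_fun do rewrite ReM; apply: measurable_funB; exact: measurable_funM.
- by under eq_fun do rewrite ImM; apply: measurable_funD; exact: measurable_funM.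
Qed.

Lemma cmeasurableZ (c : Cplx R) f : cmeasurable f -> cmeasurable (fun x => c * f x).
Proof. by apply: cmeasurableM; exact: cmeasurable_cst. Qed.

Lemma cmeasurableB f g : cmeasurable f -> cmeasurable g ->
  cmeasurable (fun x => f x - g x).
Proof.
move=> [? ?] [? ?]; split.
- by under eq_fun do rewrite ReB; exact: measurable_funB.
- by under eq_fun do rewrite ImB; exact: measurable_funB.
Qed.

Lemma sqnormD f g : cmeasurable f -> cmeasurable g ->
  (sqnorm (fun x => f x + g x)%R <= 2%:E * sqnorm f + 2%:E * sqnorm g)%E.
Proof.
move=> mf mg; have h x : 0 <= normc (f x) ^+ 2 /\ 0 <= normc (g x) ^+ 2.
  by rewrite !sqr_ge0.
rewrite -!ge0_integralZl//; try exact: measurable_sqnormc;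
  try by move=> x _; rewrite lee_fin sqr_ge0.
rewrite -ge0_integralD//; last 4 first.
- by move=> x _; rewrite -EFinM lee_fin mulr_ge0 ?sqr_ge0.
- by apply: measurable_funeM; exact: measurable_sqnormc.
- by move=> x _; rewrite -EFinM lee_fin mulr_ge0 ?sqr_ge0.
- by apply: measurable_funeM; exact: measurable_sqnormc.
apply: ge0_le_integral => //.
- by move=> x _; rewrite lee_fin sqr_ge0.
- by apply: measurable_sqnormc; exact: cmeasurableD.
- by apply: emeasurable_funD; apply: measurable_funeM; exact: measurable_sqnormc.
- by move=> x _; rewrite -!EFinM -EFinD lee_fin normc_sqrD.
Qed.

Lemma sqnormZ (c : Cplx R) f : cmeasurable f ->
  sqnorm (fun x => c * f x) = ((normc c ^+ 2)%:E * sqnorm f)%E.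
Proof.
move=> mf; rewrite -ge0_integralZl//.
- by apply: eq_integral => x _; rewrite normc_mul exprMn.
- exact: measurable_sqnormc.
- by move=> x _; rewrite lee_fin sqr_ge0.
- by rewrite lee_fin sqr_ge0.
Qed.

Lemma sqnorm_tri f g h (e : R) : cmeasurable f -> cmeasurable g -> cmeasurable h ->
  (sqnorm (fun x => f x - g x)%R < (e / 4)%:E)%E ->
  (sqnorm (fun x => g x - h x)%R < (e / 4)%:E)%E ->
  (sqnorm (fun x => f x - h x)%R < e%:E)%E.
Proof.
move=> mf mg mh h1 h2.
have -> : (fun x => f x - h x) = fun x => (f x - g x) + (g x - h x).
  by apply/funext => x; rewrite subrKA.
apply: le_lt_trans (sqnormD (cmeasurableB mf mg) (cmeasurableB mg mh)) _.
move: h1 h2 (sqnorm_ge0 (fun x => f x - g x)) (sqnorm_ge0 (fun x => g x - h x)).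
case: (sqnorm _) => [a| |]//; case: (sqnorm _) => [b| |]//.
rewrite -!EFinM -EFinD !lte_fin; lra.
Qed.

Lemma sqnorm_bounded f : cbmeas f ->
  sqnorm f = (mean P (fun x => normc (f x) ^+ 2))%:E.
Proof.
move=> hf; rewrite /mean /Rintegral fineK//.
exact: (integrable_fin_num measurableT (bmeas_rint P (bmeas_normc2 hf))).
Qed.

Lemma cbmeas_memL2 f : cbmeas f -> memL2 P f.
Proof.
by move=> hf; split; [case: hf => [[? _] [? _]] |
  apply/L2norm_lty; rewrite sqnorm_bounded// ltry].
Qed.

(** Membership in the [L^2]-closure of the span of [E]. *)
Definition approx (E : set (T -> Cplx R)) f := cmeasurable f /\
  forall e : R, 0 < e -> exists g, lspan E g /\
    (sqnorm (fun x => f x - g x)%R < e%:E)%E.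

Lemma lspan_cmeasurable E g : E `<=` cmeas -> lspan E g -> cmeasurable g.
Proof.
by move=> mE; elim=> {g} [|g /mE|g g' _ ? _ ?|c g _ ?] //;
  [exact: cmeasurableD | exact: cmeasurableZ].
Qed.

Lemma sqnorm0 : sqnorm (fun=> 0) = 0%E.
Proof.
by rewrite /sqnorm (_ : (fun _ => _) = fun=> 0%E) ?integral0//; apply/funext => x;
  rewrite normc_zero expr0n.
Qed.

Lemma approx_span E g : E `<=` cmeas -> lspan E g -> approx E g.
Proof.
move=> mE tg; split; first exact: lspan_cmeasurable tg.
move=> e e0; exists g; split => //.
by under eq_fun do rewrite subrr; rewrite sqnorm0 lte_fin.
Qed.

Lemma approxD E f g : E `<=` cmeas -> approx E f -> approx E g ->
  approx E (fun x => f x + g x).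
Proof.
move=> mE [mf hf] [mg hg]; split; first exact: cmeasurableD.
move=> e e0; have e4 : 0 < e / 4 by lra.
have [f' [tf hf']] := hf _ e4; have [g' [tg hg']] := hg _ e4.
have mf' := lspan_cmeasurable mE tf; have mg' := lspan_cmeasurable mE tg.
exists (fun x => f' x + g' x); split; first exact: lspanD.
apply: (@sqnorm_tri _ (fun x => f' x + g x)); try exact: cmeasurableD.
- by under eq_fun do rewrite opprD addrACA subrr addr0.
- by under eq_fun do rewrite opprD addrACA subrr add0r.
Qed.

Lemma approxZ E (c : Cplx R) f : E `<=` cmeas -> approx E f ->
  approx E (fun x => c * f x).
Proof.
move=> mE [mf hf]; split; first exact: cmeasurableZ.
move=> e e0; have c0 : 0 < normc c ^+ 2 + 1 by have := sqr_ge0 (normc c); lra.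
have [|f' [tf hf']] := hf (e / (normc c ^+ 2 + 1)); first exact: divr_gt0.
have mf' := lspan_cmeasurable mE tf.
exists (fun x => c * f' x); split; first exact: lspanZ.
under eq_fun do rewrite -mulrBr; rewrite sqnormZ; last exact: cmeasurableB.
move: hf' (sqnorm_ge0 (fun x => f x - f' x)); case: (sqnorm _) => [a| |]//.
rewrite -EFinM !lte_fin lee_fin ltr_pdivlMr// => h a0.
apply: le_lt_trans h; rewrite mulrC ler_wpM2l//; lra.
Qed.

Lemma approx_lim E f : E `<=` cmeas -> cmeasurable f ->
  (forall e : R, 0 < e -> exists g, approx E g /\
    (sqnorm (fun x => f x - g x)%R < e%:E)%E) -> approx E f.
Proof.
move=> mE mf h; split => // e e0; have e4 : 0 < e / 4 by lra.
have [g [[mg hg] fg]] := h _ e4; have [g' [tg gg']] := hg _ e4.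
exists g'; split => //; apply: (sqnorm_tri mf mg) => //.
exact: lspan_cmeasurable tg.
Qed.

Lemma indicB (A B : set T) x : B `<=` A -> \1_(A `\` B) x = \1_A x - \1_B x :> R.
Proof.
move=> BA; rewrite !indicE in_setD; have [xB|xB] := boolP (x \in B).
  by rewrite (mem_set (BA _ (set_mem xB))) /= subrr.
by rewrite /= subr0 andbT.
Qed.

Definition cind (A : set T) : T -> Cplx R := fun x => (\1_A x)%:C.

Lemma cbmeas_cind A : measurable A -> cbmeas (cind A).
Proof. by move=> mA; apply: cbmeas_real; exact: bmeas_ind. Qed.

Lemma sqnorm_cind A : measurable A -> sqnorm (cind A) = P A.
Proof.
move=> mA; rewrite -[A in RHS]setIT -integral_indic//; apply: eq_integral => x _.
rewrite normc_real real_normK ?num_real// indicE.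
by case: (_ \in _); rewrite ?expr1n ?expr0n.
Qed.

(** The sets with approximable indicators form a lambda-system. *)
Lemma approx_cind E (G : set (set T)) : E `<=` cmeas -> setI_closed G ->
  @measurable _ T = <<s G >> -> G setT ->
  (forall A, G A -> approx E (cind A)) ->
  forall A, measurable A -> approx E (cind A).
Proof.
move=> mE GI Gm GT GE A mA.
pose H := [set B : set T | measurable B /\ approx E (cind B)].
suff : <<s G >> `<=` H by rewrite -Gm => /(_ _ mA) [].
apply: lambda_system_subset => //; last first.
  by move=> B GB; split; [rewrite Gm; exact: sub_gen_smallest | exact: GE].
split => //.
- by split => //; exact: GE.
- move=> B C CB [mB aB] [mC aC]; split; first exact: measurableD.
  have -> : cind (B `\` C) = fun x => cind B x + -1 * cind C x.
    by apply/funext => x; rewrite /cind indicB// mulN1r -rmorphB.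
  by apply: approxD => //; exact: approxZ.
- move=> F ndF HF; have mF n : measurable (F n) by case: (HF n).
  have mU : measurable (\bigcup_n F n) by exact: bigcup_measurable.
  split => //; apply: approx_lim => //; first exact/cbmeas_measurable/cbmeas_cind.
  move=> e e0.
  pose D n := (\bigcup_n F n) `\` F n.
  have mD n : measurable (D n) by exact: measurableD.
  have D0 : \bigcap_n D n = set0.
    apply/seteqP; split => // x Dx; have [[k _ Fkx] _] := Dx 0%N I.
    by have [_] := Dx k I; exact.
  have : P (D n) @[n --> \oo] --> P (\bigcap_n D n).
    apply: nonincreasing_cvg_mu => //.
    - by rewrite (le_lt_trans (probability_le1 _ _))// ltry.
    - by rewrite D0.
    - by move=> i j ij; apply/subsetPset => x [Ux Fx]; split => // /(subsetPset _ _ (ndF _ _ ij)).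
  have e0' : (0 < e%:E)%E by rewrite lte_fin.
  rewrite D0 measure0 => /cvge_exists_lt /(_ e0')[n hn].
  exists (cind (F n)); split; first by case: (HF n).
  rewrite (_ : (fun x => _) = cind (D n)) ?sqnorm_cind//.
  apply/funext => x; rewrite /cind -rmorphB/= -indicB//.
  by move=> y Fy; exists n.
Qed.

Lemma approx_sum E I (s : seq I) (F : I -> T -> Cplx R) : E `<=` cmeas ->
  (forall i, approx E (F i)) ->
  approx E (fun x => \sum_(i <- s) F i x).
Proof.
move=> mE hF; elim: s => [|i s ih].
  by under eq_fun do rewrite big_nil; apply: approx_span => //; exact: lspan0.
by under eq_fun do rewrite big_cons; exact: approxD.
Qed.

Lemma approx_nnsfun E (h : {nnsfun T >-> R}) : E `<=` cmeas ->
  (forall A, measurable A -> approx E (cind A)) -> approx E (fun x => (h x)%:C).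
Proof.
move=> mE hE.
rewrite (_ : (fun x => _) = fun x => \sum_(y <- finmap.enum_fset (fset_set (range h)))
    (y%:C * cind (h @^-1` [set y]) x)).
  by apply: approx_sum => // y; apply: approxZ => //; exact: hE.
apply/funext => x; rewrite [h x]fimfunE fsbig_finite//= rmorph_sum.
by apply: eq_bigr => y _; rewrite rmorphM.
Qed.

(** Simple functions increase to [u], and [u ^+ 2] dominates the squared
  errors. *)
Lemma approx_nonneg E (u : T -> R) : E `<=` cmeas ->
  (forall A, measurable A -> approx E (cind A)) ->
  measurable_fun setT u -> (forall x, 0 <= u x) ->
  (\int[P]_x (u x ^+ 2)%:E < +oo)%E -> approx E (fun x => (u x)%:C).
Proof.
move=> mE hE mu u0 ui; apply: approx_lim => //.
move=> e e0; have meu : measurable_fun setT (EFin \o u) by exact/measurable_EFinP.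
pose h := nnsfun_approx measurableT meu.
have hu x : h n x @[n --> \oo] --> u x.
  have := @cvg_nnsfun_approx _ _ _ _ measurableT _ meu (fun x _ => u0 x) x I.
  by move/fine_cvgP => [_]; apply: cvg_trans.
have hle n x : h n x <= u x.
  have cu : cvg (h n x @[n --> \oo]) by apply/cvg_ex; exists (u x); exact: hu.
  rewrite -(cvg_lim (@Rhausdorff R) (hu x)); apply: nondecreasing_cvgn_le => //.
  by move=> i j ij; have /lefP := nd_nnsfun_approx measurableT meu ij; exact.
have mh n : measurable_fun setT (fun x => ((u x - h n x) ^+ 2)%:E).
  by apply/measurable_EFinP/measurable_funX/measurable_funB.
have [||||_ _] := @dominated_convergence _ _ _ P setT measurableT
    (fun n x => ((u x - h n x) ^+ 2)%:E) (fun=> 0%E) (fun x => (u x ^+ 2)%:E) mh.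
- exact: measurable_cst.
- apply: aeW => x _; apply/cvg_EFin; first exact: nearW.
  have : (u x - h n x) ^+ 2 @[n --> \oo] --> (u x - u x) ^+ 2.
    rewrite expr2; under eq_fun do rewrite expr2.
    by apply: cvgM; apply: cvgB => //; exact: cvg_cst.
  by rewrite subrr expr0n.
- apply/integrableP; split; first exact/measurable_EFinP/measurable_funX.
  by under eq_integral do rewrite gee0_abs ?lee_fin ?sqr_ge0//.
- apply: aeW => x n _; rewrite gee0_abs ?lee_fin ?sqr_ge0//.
  by rewrite ler_pXn2r ?nnegrE// ?subr_ge0// gerBl.
have e0' : (0 < e%:E)%E by rewrite lte_fin.
rewrite integral0 => /cvge_exists_lt /(_ e0')[n hn].
exists (fun x => (h n x)%:C); split; first exact: approx_nnsfun.
apply: le_lt_trans hn; rewrite le_eqVlt; apply/orP; left; apply/eqP.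
apply: eq_integral => x _; rewrite -rmorphB normc_real real_normK ?num_real//.
Qed.

(** Real and imaginary part are differences of nonnegative functions. *)
Lemma memL2_approx E f : E `<=` cmeas ->
  (forall A, measurable A -> approx E (cind A)) -> memL2 P f -> approx E f.
Proof.
move=> mE hE [[mr mi] /L2norm_lty fi].
have part (u : T -> R) : measurable_fun setT u -> (forall x, `|u x| <= normc (f x)) ->
    approx E (fun x => (u x)%:C).
  move=> mu uf.
  have pos (v : T -> R) : measurable_fun setT v -> (forall x, `|v x| <= normc (f x)) ->
      approx E (fun x => (Num.max (v x) 0)%:C).
    move=> mv vf; apply: approx_nonneg => //.
    - by apply: measurable_maxr => //; exact: measurable_cst.
    - by move=> x; rewrite le_max lexx orbT.
    apply: le_lt_trans fi; apply: ge0_le_integral => //.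
    - by move=> x _; rewrite lee_fin sqr_ge0.
    - apply/measurable_EFinP/measurable_funX/measurable_maxr => //.
    - exact: measurable_sqnormc.
    move=> x _; rewrite lee_fin ler_pXn2r ?nnegrE ?normc_ge0 ?le_max ?lexx ?orbT//.
    by rewrite ge_max (le_trans (ler_norm _) (vf x)) normc_ge0.
  have -> : (fun x => (u x)%:C : Cplx R) =
      fun x => (Num.max (u x) 0)%:C + -1 * (Num.max (- u x) 0)%:C.
    apply/funext => x; rewrite mulN1r -rmorphB/=; congr (_ %:C).
    rewrite /Num.max; case: ifPn; case: ifPn; rewrite -?leNgt; lra.
  apply: approxD => //; first exact: pos.
  apply: approxZ => //; apply: pos; first exact: measurableT_comp.
  by move=> x; rewrite normrN.
have -> : f = fun x => (Re (f x))%:C + 'i%C * (Im (f x))%:C.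
  by apply/funext => x; exact: complexE.
apply: approxD => //; first by apply: part => // x; exact: le_Re_normc.
by apply: approxZ => //; apply: part => // x; exact: le_Im_normc.
Qed.

Lemma lspan_sum E g : lspan E g -> exists (n : nat) (c : 'I_n -> Cplx R)
  (e : 'I_n -> T -> Cplx R), (forall i, E (e i)) /\
    forall x, g x = \sum_(i < n) c i * e i x.
Proof.
elim=> {g} [|g Eg|g g' _ [n [c [e [Ee ge]]]] _ [n' [c' [e' [Ee' ge']]]]|k g _ [n [c [e [Ee ge]]]]].
- by exists 0%N, (fun=> 0), (fun=> (fun=> 0)); split => [[]//|x]; rewrite big_ord0.
- by exists 1%N, (fun=> 1), (fun=> g); split => // x; rewrite big_ord1 mul1r.
- exists (n + n')%N, (fun i => match fintype.split i with inl j => c j | inr j => c' j end),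
    (fun i => match fintype.split i with inl j => e j | inr j => e' j end).
  split=> [i|x]; first by case: fintype.split.
  rewrite ge ge' big_split_ord/=; congr (_ + _); apply: eq_bigr => i _.
    by have := unsplitK (inl i : 'I_n + 'I_n'); rewrite /= => ->.
  by have := unsplitK (inr i : 'I_n + 'I_n'); rewrite /= => ->.
- exists n, (fun i => k * c i), e; split => // x.
  by rewrite ge mulr_sumr; apply: eq_bigr => i _; rewrite mulrA.
Qed.

End SquareNorm.

(** * Limits of uniformly bounded sequences in [L^2] *)

Section RieszFischer.
Context (R : realType) (dT : measure_display) (T : measurableType dT).
Variable P : probability T R.
Notation Re := complex.Re.
Notation Im := complex.Im.
Notation normc := Normc.normc.

(** If [2^n (u_(n+1) - u_n)^2] is almost everywhere summable, then so is
  [|u_(n+1) - u_n| <= 2^-n + 2^n (u_(n+1) - u_n)^2]. *)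
Lemma summable_increments_cvg (u : nat -> R) :
  (\sum_(0 <= n <oo) (2 ^+ n * (u n.+1 - u n) ^+ 2)%:E < +oo)%E -> cvgn u.
Proof.
set S := limn _ => Soo.
have S0 : (0 <= S)%E.
  by apply: nneseries_ge0 => n _ _; rewrite lee_fin mulr_ge0 ?sqr_ge0 ?exprn_ge0.
have Sfin : S \is a fin_num by rewrite ge0_fin_numE.
have SP n : \sum_(i < n) (2 ^+ i * (u i.+1 - u i) ^+ 2) <= fine S.
  rewrite -lee_fin fineK// -sumEFin.
  rewrite -(big_mkord xpredT (fun i => (2 ^+ i * (u i.+1 - u i) ^+ 2)%:E)).
  by apply: nneseries_lim_ge => i _ _; rewrite lee_fin mulr_ge0 ?sqr_ge0 ?exprn_ge0.
have geo n : \sum_(i < n) 2^-1 ^+ i <= 2 :> R.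
  suff -> : \sum_(i < n) 2^-1 ^+ i = 2 - 2 * 2^-1 ^+ n :> R.
    by rewrite gerBl mulr_ge0// exprn_ge0.
  elim: n => [|n ih]; first by rewrite big_ord0 expr0; ring.
  by rewrite big_ord_recr/= ih exprS; field.
have cs : cvgn (series (telescope u)).
  apply: normed_cvg; apply: nondecreasing_is_cvgn.
    by apply: nondecreasing_series => n _ _; exact: normr_ge0.
  exists (2 + fine S) => _ [n _ <-]; 
  rewrite [leLHS](_ : _ = \sum_(i < n) `|telescope u i|); last exact: big_mkord.
  apply: le_trans (lerD (geo n) (SP n)); rewrite -big_split/=; apply: ler_sum => i _.
  rewrite /telescope exprVn; set a := `|_|.
  have -> : (u i.+1 - u i) ^+ 2 = a ^+ 2 by rewrite /a real_normK ?num_real.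
  have p0 : 0 < 2 ^+ i :> R by rewrite exprn_gt0.
  have a0 : 0 <= a by exact: normr_ge0.
  have [a1|a1] := leP (2 ^+ i * a) 1.
    rewrite -[a]mulr1 -ler_pdivlMl// in a1.
    have : 0 <= 2 ^+ i * a ^+ 2 by rewrite mulr_ge0 ?sqr_ge0 ?ltW.
    move: a1; rewrite !mulr1; lra.
  have : a <= 2 ^+ i * a ^+ 2 by rewrite expr2 mulrA ler_peMl// ltW.
  have : 0 <= (2 ^+ i)^-1 :> R by rewrite invr_ge0 ltW.
  lra.
have -> : u = fun n => u 0%N + series (telescope u) n.
  by apply/funext => n; exact: eq_sum_telescope.
by apply: is_cvgD => //; exact: is_cvg_cst.
Qed.

(** The sequence converges almost everywhere by [summable_increments_cvg].
  The limit is defined everywhere as an upper limit, truncated to stay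
  bounded, and dominated convergence turns it into a limit in [L^2]. *)
Lemma real_riesz_fischer (u : nat -> T -> R) (M : R) :
  (forall n, measurable_fun setT (u n)) -> (forall n x, `|u n x| <= M) ->
  (forall n, \int[P]_x ((u n.+1 x - u n x) ^+ 2)%:E <= (8^-1 ^+ n)%:E)%E ->
  exists F : T -> R, [/\ measurable_fun setT F, forall x, `|F x| <= M &
    forall e : R, 0 < e -> exists N, forall n, (N <= n)%N ->
      (\int[P]_x ((u n x - F x) ^+ 2)%:E < e%:E)%E].
Proof.
move=> mu uM ui.
pose F x := Num.max (- M) (Num.min M (limn_sup (u ^~ x))).
have ub x : has_ubound (range (u ^~ x)).
  by exists M => _ [n _ <-]; rewrite (le_trans (ler_norm _)).
have lb x : has_lbound (range (u ^~ x)).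
  by exists (- M) => _ [n _ <-]; have := uM n x; rewrite ler_norml => /andP[].
have mF : measurable_fun setT F.
  apply: measurable_maxr; first exact: measurable_cst.
  apply: measurable_minr; first exact: measurable_cst.
  exact: measurable_fun_limn_sup.
pose S x := (\sum_(0 <= n <oo) (2 ^+ n * (u n.+1 x - u n x) ^+ 2)%:E)%E.
have mt n : measurable_fun setT (fun x => (2 ^+ n * (u n.+1 x - u n x) ^+ 2)%:E).
  apply/measurable_EFinP/measurable_funM => //.
  by apply/measurable_funX/measurable_funB.
have t0 n x : (0 <= (2 ^+ n * (u n.+1 x - u n x) ^+ 2)%:E)%E.
  by rewrite lee_fin mulr_ge0 ?sqr_ge0 ?exprn_ge0.
have iS : (\int[P]_x S x < +oo)%E.
  rewrite integral_nneseries//.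
  apply: (@le_lt_trans _ _ (\sum_(0 <= n <oo) (2 / (2 ^ n.+1)%:R)%:E)%E); last first.
    by apply: le_lt_trans (@epsilon_trick0 R 2 xpredT _) _ => //; exact: ltry.
  apply: lee_nneseries => n _; first by move=> _; exact: integral_ge0.
  under eq_integral do rewrite EFinM.
  rewrite ge0_integralZl//.
  - apply: (@le_trans _ _ ((2 ^+ n)%:E * (8^-1 ^+ n)%:E)%E).
      by rewrite lee_pmul2l// lte_fin exprn_gt0.
    rewrite -EFinM lee_fin -exprMn natrX exprS invfM mulrA divff// mul1r -exprVn.
    by rewrite lerXn2r ?nnegrE//; lra.
  - by apply/measurable_EFinP/measurable_funX/measurable_funB.
  - by move=> x _; rewrite lee_fin sqr_ge0.
have aeF : {ae P, forall x, u n x @[n --> \oo] --> F x}.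
  have : {ae P, forall x, setT x -> S x \is a fin_num}.
    apply: integrable_ae => //; apply/integrableP; split.
      apply: ge0_emeasurable_sum => //.
    by under eq_integral do rewrite gee0_abs ?nneseries_ge0//.
  apply: filterS => x /(_ I) Sx.
  have cu : cvgn (u ^~ x).
    by apply: summable_increments_cvg; rewrite -/(S x) ltey_eq Sx.
  have lM : `|limn (u ^~ x)| <= M.
    rewrite ler_norml; apply/andP; split.
      by apply: limr_ge => //; apply: nearW => n; have := uM n x; rewrite ler_norml => /andP[].
    by apply: limr_le => //; apply: nearW => n; have := uM n x; rewrite ler_norml => /andP[].
  move: lM; rewrite ler_norml => /andP[l1 l2].
  by rewrite /F cvg_limn_supE// (min_idPr l2) (max_idPr l1).
have FM x : `|F x| <= M.
  have h : 0 <= M by exact: le_trans (normr_ge0 _) (uM 0%N x).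
  by rewrite /F ler_norml le_max lexx/= ge_max ge_min lexx andbT; lra.
exists F; split => //.
have [|||||_ _] := @dominated_convergence _ _ _ P setT measurableT
    (fun n x => ((u n x - F x) ^+ 2)%:E) (fun=> 0%E) (fun x => ((2 * M) ^+ 2)%:E).
- by move=> n; apply/measurable_EFinP/measurable_funX/measurable_funB.
- exact: measurable_cst.
- apply: filterS aeF => x uF _; apply/cvg_EFin; first exact: nearW.
  have : (u n x - F x) * (u n x - F x) @[n --> \oo] --> (F x - F x) * (F x - F x).
    by apply: cvgM; apply: cvgB => //; exact: cvg_cst.
  by rewrite subrr mulr0.
- exact: finite_measure_integrable_cst.
- apply: aeW => x n _; rewrite gee0_abs ?lee_fin ?sqr_ge0//.
  have := FM x; have := uM n x; have h : 0 <= M by exact: le_trans (normr_ge0 _) (FM x).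
  rewrite -[(_ - _) ^+ 2]real_normK ?num_real// => ? ?.
  rewrite ler_pXn2r ?nnegrE ?mulr_ge0//.
  by apply: le_trans (ler_normB _ _) _; lra.
rewrite integral0 => cv e e0.
have e0' : (0 < e%:E)%E by rewrite lte_fin.
have [N _ hN] := cv _ (open_nbhs_nbhs (conj (@open_ereal_lt_ereal R e%:E) e0')).
by exists N => n /hN.
Qed.

End RieszFischer.

Section InnerProduct.
Context (R : realType) (dT : measure_display) (T : measurableType dT).
Variable P : probability T R.
Notation Re := complex.Re.
Notation Im := complex.Im.
Notation normc := Normc.normc.
Implicit Types (f g h : T -> Cplx R).

Lemma riesz_fischer (S : nat -> T -> Cplx R) (M : R) :
  (forall n, cmeasurable (S n)) -> (forall n x, normc (S n x) <= M) ->
  (forall n, sqnorm P (fun x => S n.+1 x - S n x)%R <= (8^-1 ^+ n)%:E)%E ->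
  exists F, cbmeas F /\ forall e : R, 0 < e -> exists N, forall n, (N <= n)%N ->
    (sqnorm P (fun x => S n x - F x)%R < e%:E)%E.
Proof.
move=> mS SM Si.
have mD n k : cmeasurable (fun x => S n x - S k x) by exact: cmeasurableB.
have part (p : Cplx R -> R) : (forall z, `|p z| <= normc z) ->
    (forall z w, p (z - w) = p z - p w) -> (forall n, measurable_fun setT (fun x => p (S n x))) ->
    exists F : T -> R, [/\ measurable_fun setT F, forall x, `|F x| <= M &
    forall e : R, 0 < e -> exists N, forall n, (N <= n)%N ->
      (\int[P]_x ((p (S n x) - F x) ^+ 2)%:E < e%:E)%E].
  move=> pn pB mp; apply: real_riesz_fischer => // [n x|n].
    by rewrite (le_trans (pn _)).
  apply: le_trans (Si n); apply: ge0_le_integral => //.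
  - by move=> x _; rewrite lee_fin sqr_ge0.
  - by apply/measurable_EFinP/measurable_funX/measurable_funB.
  - exact: measurable_sqnormc.
  - move=> x _; rewrite lee_fin -pB -real_normK ?num_real//.
    by rewrite ler_pXn2r ?nnegrE ?normc_ge0.
have [FR [mFR FRM FRi]] := part (@complex.Re R) (@le_Re_normc R) (@ReB R) (fun n => (mS n).1).
have [FI [mFI FIM FIi]] := part (@complex.Im R) (@le_Im_normc R) (@ImB R) (fun n => (mS n).2).
exists (fun x => FR x +i* FI x); split.
  by split; split => //; exists M.
move=> e e0; have e2 : 0 < e / 2 by lra.
have [N hN] := FRi _ e2; have [N' hN'] := FIi _ e2.
exists (maxn N N') => n; rewrite geq_max => /andP[/hN h1 /hN' h2].
rewrite (_ : sqnorm _ _ = \int[P]_x ((Re (S n x) - FR x) ^+ 2)%:E +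
   \int[P]_x ((Im (S n x) - FI x) ^+ 2)%:E)%E.
  have -> : e%:E = ((e / 2)%:E + (e / 2)%:E)%E by rewrite -EFinD -splitr.
  exact: lteD.
have [mR mI] := mS n.
rewrite -ge0_integralD//.
- by apply: eq_integral => x _; rewrite sqr_normcE !ReImE.
- by move=> x _; rewrite lee_fin sqr_ge0.
- by apply/measurable_EFinP/measurable_funX/measurable_funB.
- by move=> x _; rewrite lee_fin sqr_ge0.
- by apply/measurable_EFinP/measurable_funX/measurable_funB.
Qed.

Local Notation ip := (L2inner P).

Lemma ip_cint f g : cbmeas f -> cbmeas g -> cint P (fun x => f x * (g x)^*%C).
Proof. by move=> hf hg; apply/cbmeas_cint/cbmeasM => //; exact: cbmeas_conj. Qed.

Lemma ipDl f g h : cbmeas f -> cbmeas g -> cbmeas h ->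
  ip (fun x => f x + g x) h = ip f h + ip g h.
Proof.
move=> hf hg hh; rewrite /L2inner -cintegralD; try exact: ip_cint.
by congr cintegral; apply/funext => x; rewrite mulrDl.
Qed.

Lemma ipZl (c : Cplx R) f h : cbmeas f -> cbmeas h -> ip (fun x => c * f x) h = c * ip f h.
Proof.
move=> hf hh; rewrite /L2inner -cintegralZ; last exact: ip_cint.
by congr cintegral; apply/funext => x; rewrite mulrA.
Qed.

Lemma ip_conj f g : cbmeas f -> cbmeas g -> ip g f = ((ip f g)^*)%C.
Proof.
move=> hf hg; rewrite /L2inner -cintegral_conj; last exact: ip_cint.
congr cintegral; apply/funext => x; apply: cplx_eq; rewrite !ReImE; ring.
Qed.

Lemma ipZr (c : Cplx R) f h : cbmeas f -> cbmeas h ->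
  ip f (fun x => c * h x) = (c^*)%C * ip f h.
Proof.
move=> hf hh; rewrite ip_conj//; last exact: cbmeasZ.
rewrite ipZl// (ip_conj hh hf); apply: cplx_eq; rewrite !ReImE; ring.
Qed.

Lemma ipBl f g h : cbmeas f -> cbmeas g -> cbmeas h ->
  ip (fun x => f x - g x) h = ip f h - ip g h.
Proof.
move=> hf hg hh; rewrite -[in RHS]mulN1r -ipZl// -ipDl//; last exact: cbmeasZ.
by rewrite (_ : (fun x => _) = fun x => f x - g x)//; apply/funext => x; rewrite mulN1r.
Qed.

Lemma ip_suml n (F : 'I_n -> T -> Cplx R) h : (forall i, cbmeas (F i)) -> cbmeas h ->
  ip (fun x => \sum_i F i x) h = \sum_i ip (F i) h.
Proof.
move=> hF hh; rewrite /L2inner -cintegral_sum => [|i]; last exact: ip_cint.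
by congr cintegral; apply/funext => x; rewrite mulr_suml.
Qed.

Definition sqmean f : R := mean P (fun x => normc (f x) ^+ 2).

Lemma ip_self f : cbmeas f -> ip f f = (sqmean f)%:C.
Proof.
move=> hf; rewrite /L2inner cintegralE; apply: cplx_eq => /=.
  congr mean; apply/funext => x; rewrite ReM ReJ ImJ sqr_normcE; ring.
rewrite -[RHS](mean_cst P); congr mean; apply/funext => x.
by rewrite ImM ReJ ImJ; ring.
Qed.

Lemma sqmean_ge0 f : 0 <= sqmean f.
Proof. by apply: mean_ge0 => x; exact: sqr_ge0. Qed.

(** * Orthonormalisation *)
Section GramSchmidt.
Variables (I : Type) (V : I -> set (T -> Cplx R)).
Hypothesis V0 : forall i, V i (fun=> 0).
Hypothesis V_lin : forall i c f g, V i f -> V i g -> V i (fun x => f x + c * g x).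
Hypothesis V_orth : forall i j f g, i <> j -> V i f -> V j g ->
  cbmeas f -> cbmeas g -> ip f g = 0.
Variables (e : nat -> T -> Cplx R) (ix : nat -> I).
Hypothesis e_bmeas : forall n, cbmeas (e n).
Hypothesis eV : forall n, V (ix n) (e n).

Definition residual (s : seq (T -> Cplx R)) f : T -> Cplx R :=
  fun x => f x - \sum_(w <- s) ip f w * w x.

(** A null residual is sent to the zero function, because 0^-1 = 0. *)
Definition normalised_residual s f : T -> Cplx R := fun x =>
  ((Num.sqrt (sqmean (residual s f)))^-1)%:C * residual s f x.

Fixpoint gs_seq n : seq (T -> Cplx R) := if n is n'.+1 then
  rcons (gs_seq n') (normalised_residual (gs_seq n') (e n')) else [::].

Definition gs n := normalised_residual (gs_seq n) (e n).
Definition gs_res n : T -> Cplx R := fun x => e n x - \sum_(i < n) ip (e n) (gs i) * gs i x.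

Lemma gs_seqE n : gs_seq n = [seq gs i | i <- iota 0 n].
Proof.
elim: n => [//|n ih]; rewrite -addn1 iotaD map_cat -ih cats1.
by rewrite addn1.
Qed.

Lemma residualE n : residual (gs_seq n) (e n) = gs_res n.
Proof.
apply/funext => x; rewrite /residual /gs_res gs_seqE big_map.
by rewrite -/(index_iota 0 n) -(subn0 n) -/(index_iota 0 n) subn0 big_mkord.
Qed.

Lemma gsE n : gs n = fun x => ((Num.sqrt (sqmean (gs_res n)))^-1)%:C * gs_res n x.
Proof. by rewrite /gs /normalised_residual residualE. Qed.

Lemma gs_bmeas n : cbmeas (gs n).
Proof.
elim/ltn_ind: n => n ih; rewrite gsE; apply: cbmeasZ.
apply: cbmeasB => //; apply: cbmeas_sum => i; apply: cbmeasZ; exact: ih.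
Qed.

Lemma gs_res_bmeas n : cbmeas (gs_res n).
Proof.
apply: cbmeasB => //; apply: cbmeas_sum => i; apply: cbmeasZ; exact: gs_bmeas.
Qed.

Lemma V_sum i n (F : 'I_n -> T -> Cplx R) : (forall k, V i (F k)) ->
  V i (fun x => \sum_k F k x).
Proof.
elim: n F => [|n ih] F hF.
  by under eq_fun do rewrite big_ord0; exact: V0.
under eq_fun do rewrite big_ord_recl.
have := V_lin 1 (hF ord0) (ih (fun k => F (lift ord0 k)) (fun k => hF _)).
by congr (V i); apply/funext => x; rewrite mul1r.
Qed.

Lemma VZ i c f : V i f -> V i (fun x => c * f x).
Proof.
move=> Vf; have := V_lin c (V0 i) Vf.
by congr (V i); apply/funext => x; rewrite add0r.
Qed.

(** Only the earlier vectors of the same class contribute to a residual. *)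
Lemma gs_V n : V (ix n) (gs n).
Proof.
elim/ltn_ind: n => n ih; rewrite gsE; apply: VZ.
rewrite /gs_res; have h : V (ix n) (fun x => \sum_(i < n) ip (e n) (gs i) * gs i x).
  apply: V_sum => k; have [<-|ne] := pselect (ix k = ix n).
    by apply: VZ; exact: ih.
  have -> : ip (e n) (gs k) = 0.
    apply: V_orth (eV n) (ih k (ltn_ord k)) (e_bmeas n) (gs_bmeas k).
    by move/esym.
  by under eq_fun do rewrite mul0r; exact: V0.
have := V_lin (-1) (eV n) h.
by congr (V _); apply/funext => x; rewrite mulN1r.
Qed.

Lemma gs_self n : ip (gs n) (gs n) = (sqmean (gs_res n) != 0)%:R.
Proof.
have hr := gs_res_bmeas n.
rewrite gsE ipZl ?ipZr ?ip_self//; last exact: cbmeasZ.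
have [r0|r0] := eqVneq (sqmean (gs_res n)) 0.
  by rewrite r0 !mulr0.
rewrite conjc_real -!rmorphM mulrA -invfM -expr2 sqr_sqrtr ?sqmean_ge0//.
by rewrite mulVf.
Qed.

Lemma gs_orth n i : (i < n)%N -> ip (gs n) (gs i) = 0.
Proof.
elim/ltn_ind: n i => n ih i lin.
rewrite gsE ipZl; [|exact: gs_res_bmeas|exact: gs_bmeas].
rewrite ipBl//; [|by apply: cbmeas_sum => k; apply: cbmeasZ; exact: gs_bmeas|exact: gs_bmeas].
rewrite ip_suml; [|by move=> k; apply: cbmeasZ; exact: gs_bmeas|exact: gs_bmeas].
rewrite (bigD1 (Ordinal lin))//= big1 ?addr0 => [|k ki]; last first.
  rewrite ipZl; [|exact: gs_bmeas|exact: gs_bmeas].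
  have [ltki|ltik|eki] := ltngtP k i.
  - by rewrite (ip_conj (gs_bmeas i) (gs_bmeas k)) (ih i lin k ltki) conjc0 mulr0.
  - by rewrite (ih k (ltn_ord k) i ltik) mulr0.
  - by rewrite -val_eqE /= eki eqxx in ki.
rewrite ipZl; [|exact: gs_bmeas|exact: gs_bmeas].
rewrite gs_self; have [r0|r0] := eqVneq (sqmean (gs_res i)) 0; last first.
  by rewrite mulr1 subrr mulr0.
suff -> : ip (e n) (gs i) = 0 by rewrite mul0r subrr mulr0.
rewrite gsE ipZr; [|exact: e_bmeas|exact: gs_res_bmeas].
by rewrite r0 sqrtr0 invr0 conjc_real mul0r.
Qed.

(** The classes [V i], which will be eigenspaces, are pairwise orthogonal, so
  that the orthonormalised vectors remain in these classes. *)
Lemma gram_schmidt : exists E : set (T -> Cplx R),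
  [/\ forall u, E u -> cbmeas u /\ exists i, V i u,
      forall u, E u -> ip u u = 1,
      forall u u', E u -> E u' -> u <> u' -> ip u u' = 0 &
      forall n, approx P E (e n)].
Proof.
pose E := [set u | exists2 n, u = gs n & sqmean (gs_res n) != 0].
have Eb u : E u -> cbmeas u by move=> [n -> _]; exact: gs_bmeas.
have Em : E `<=` @cmeasurable R dT T by move=> u /Eb /cbmeas_measurable.
exists E; split.
- move=> u Eu; split; first exact: Eb.
  by case: Eu => n -> _; exists (ix n); exact: gs_V.
- by move=> u [n -> r0]; rewrite gs_self r0.
- move=> u u' [n -> _] [n' -> _] nn'.
  have [lt|gt|eq] := ltngtP n n'; last by rewrite eq in nn'.
    by rewrite (ip_conj (gs_bmeas n') (gs_bmeas n)) (gs_orth lt) conjc0.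
  exact: gs_orth gt.
move=> n; have gsE' k : approx P E (gs k).
  have [r0|r0] := eqVneq (sqmean (gs_res k)) 0.
    rewrite gsE r0 sqrtr0 invr0; under eq_fun do rewrite mul0r.
    by apply: approx_span => //; exact: lspan0.
  by apply: approx_span => //; apply: lspan_base; exists k.
have hr : approx P E (gs_res n).
  have [r0|r0] := eqVneq (sqmean (gs_res n)) 0.
    split; first exact/cbmeas_measurable/gs_res_bmeas.
    move=> eps eps0; exists (fun=> 0); split; first exact: lspan0.
    under eq_fun do rewrite subr0.
    by rewrite sqnorm_bounded ?[mean _ _]r0 ?lte_fin//; exact: gs_res_bmeas.
  have -> : gs_res n = fun x => (Num.sqrt (sqmean (gs_res n)))%:C * gs n x.
    apply/funext => x; rewrite gsE mulrA -rmorphM/= divff ?mul1r//.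
    by rewrite sqrtr_eq0 -ltNge lt_def r0 sqmean_ge0.
  exact: approxZ.
have -> : e n = fun x => gs_res n x + \sum_(i < n) ip (e n) (gs i) * gs i x.
  by apply/funext => x; rewrite subrK.
by apply: approxD => //; apply: approx_sum => // i; exact: approxZ.
Qed.

End GramSchmidt.
End InnerProduct.

Section CountablePi.
Context (R : realType) (X : ptopologicalType) (d : X -> X -> R).
Hypothesis dm : metric_inducing_topology d.
Hypothesis Xc : compact [set: X].

(** Finite intersections of balls of radius [n.+1%:R^-1] around the points of a
  finite net of the same fineness, for all [n]. *)
Lemma countable_pi_system : exists D : nat -> set (borel X),
  [/\ setI_closed (range D), range D setT, forall n, measurable (D n) &
      @measurable _ (borel X) = <<s range D >>].
Proof.
have mesh0 n : 0 < (n.+1%:R^-1 : R) by rewrite invr_gt0 ltr0n.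
have net n : exists c : nat -> X, forall y, exists i, d (c i) y < n.+1%:R^-1.
  have [k [c cP]] := finite_net dm Xc (mesh0 n).
  by exists c => y; have [i _ ?] := cP y; exists i.
have [c cP] := choice net.
pose B (p : nat * nat) : set X := mball d (c p.1 p.2) p.1.+1%:R^-1.
pose inter (s : seq (nat * nat)) : set X := foldr (fun p A => B p `&` A) setT s.
pose D n : set (borel X) := if unpickle n is Some s then inter s else setT.
have Bo p : open (B p) by exact: open_mball.
have interD s : D (pickle s) = inter s by rewrite /D pickleK.
have Do n : open (D n : set X).
  rewrite /D; case: unpickle => [s|]; last exact: openT.
  by elim: s => [|p s ih]; [exact: openT | exact: openI].
exists D; split.
- have DP n : exists t, D n = inter t.
    by rewrite /D; case: unpickle => [t|]; [exists t | exists [::]].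
  move=> _ _ [m _ <-] [n _ <-]; have [s ->] := DP m; have [t ->] := DP n.
  exists (pickle (s ++ t)) => //; rewrite interD.
  elim: s => [|p s ih] /=; first by rewrite setTI.
  by rewrite ih setIA.
- by exists (pickle (Nil (nat * nat))) => //; rewrite interD.
- by move=> n; apply: borel_open; exact: Do.
apply/seteqP; split; apply: smallest_sub; try exact: smallest_sigma_algebra.
  move=> U Uo.
  pose F k : set X := if unpickle k is Some p then
    if pselect (B p `<=` U) then B p else set0 else set0.
  have -> : U = \bigcup_k F k.
    apply/seteqP; split => [x Ux|x [k _]]; last first.
      by rewrite /F; case: unpickle => // p; case: pselect => // BU /BU.
    have /(mopenP dm) /(_ _ Ux)[e e0 eU] := Uo.
    have e20 : 0 < e / 2 by lra.
    have [n _ /(_ n (leqnn n)) /= hn] := near_infty_natSinv_lt (PosNum e20).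
    have [i ix] := cP n x.
    exists (pickle (n, i)) => //; rewrite /F pickleK.
    case: pselect => //= nBU; exfalso; apply: nBU => y; rewrite /B/mball/= => iy.
    apply: eU; apply: le_lt_trans (d_tri dm x (c n i) y) _.
    by rewrite (d_sym dm x) [e]splitr ltrD// (lt_trans _ hn).
  have [s0 _ sU] := smallest_sigma_algebra setT (range D).
  suff h k : <<s range D >> (F k) by exact: (sU _ h).
  rewrite /F; case: (unpickle k) => [p|]; last exact: s0.
  case: pselect => a /=; last exact: s0.
  by apply: sub_gen_smallest; exists (pickle [:: p]) => //; rewrite interD /inter/= setIT.
by move=> _ [n _ <-]; apply: sub_gen_smallest; exact: Do.
Qed.

End CountablePi.

(** * The displacement function of a dynamical system *)

Lemma nbhs_ballP_metric (R : realType) (X : ptopologicalType) (d : X -> X -> R) :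
  metric_inducing_topology d -> forall x (A : set X), nbhs x A <->
  exists2 e : R, 0 < e & mball d x e `<=` A.
Proof. by case. Qed.

Lemma lte_half (R : realType) (e : R) (a b : \bar R) :
  (a < (e / 2)%:E)%E -> (b <= (e / 2)%:E)%E -> (a + b < e%:E)%E.
Proof.
move: a b => [a| |] [b| |]//; rewrite ?lte_fin ?lee_fin ?ltNyr//.
by move=> h1 h2; lra.
Qed.

Lemma near_subl (G : topologicalZmodType) (A : set G) t :
  nbhs (0 : G) A -> nbhs t [set s | A (t - s)].
Proof.
have cvg0 : (fun s => t - s) @ t --> (0 : G).
  rewrite -(subrr t); apply: (@continuous2_cvg _ _ _ _ _ _ _ _ (fun a b : G => a - b)).
  - exact: (@sub_continuous G (t, t)).
  - exact: cvg_cst.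
  - exact: cvg_id.
exact: cvg0.
Qed.

Section Dynamics.
Context (R : realType) (X : ptopologicalType) (G : topologicalZmodType).
Variables (act : G -> X -> X) (m : probability (borel X) R) (d : X -> X -> R).
Hypothesis Xc : compact [set: X].
Hypothesis actc : continuous_action act.
Hypothesis minv : invariant_measure act m.
Hypothesis dm : metric_inducing_topology d.
Local Notation Re := complex.Re.
Local Notation Im := complex.Im.
Local Notation normc := Normc.normc.
Local Notation cmeas := (@cmeasurable R _ (borel X)).

Definition disp t : R := mean_displacement act m d t.

Lemma act0 x : act 0 x = x. Proof. by case: actc. Qed.
Lemma actD s t x : act (s + t) x = act s (act t x). Proof. by case: actc. Qed.
Lemma actK t : cancel (act t) (act (- t)).
Proof. by move=> x; rewrite -actD addNr act0. Qed.
Lemma act_metric_continuous t x (e : R) : 0 < e ->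
  exists2 del : R, 0 < del & forall y, d x y < del -> d (act t x) (act t y) < e.
Proof.
move=> e0; have [_ _ ac] := actc.
have /(nbhs_ballP_metric dm) [del del0 h] : nbhs x (act t @^-1` mball d (act t x) e).
  have := ac (t, x) _ (nbhs_mball dm (act t x) e0).
  rewrite nbhs_simpl/= => -[[A B] /= [tA xB] AB].
  by apply: filterS xB => y By; exact: (AB (t, y) (conj (nbhs_singleton tA) By)).
by exists del.
Qed.

Lemma act_measurable t : measurable_fun [set: borel X] (act t : borel X -> borel X).
Proof.
apply: (@measurability _ _ (borel X) (borel X) setT _ open erefl) => // _ [B Bo <-].
rewrite setTI; apply: borel_open; apply/(mopenP dm) => x Bx.
have /(mopenP dm) /(_ _ Bx) [e e0 eB] := Bo.
have [del del0 h] := act_metric_continuous t x e0.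
by exists del => // y /h; exact: eB.
Qed.

Lemma preimage_act_measurable t (A : set (borel X)) : measurable A ->
  measurable (act t @^-1` A : set (borel X)).
Proof. by move=> mA; rewrite -[X in measurable X]setTI; exact: act_measurable. Qed.

Lemma measure_act t (A : set (borel X)) : measurable A -> m (act t @^-1` A) = m A.
Proof. exact: minv. Qed.

Lemma ge0_integral_act t (f : borel X -> \bar R) :
  measurable_fun setT f -> (forall x, (0 <= f x)%E) ->
  (\int[m]_x f (act t x) = \int[m]_x f x)%E.
Proof.
move=> mf f0.
transitivity (\int[pushforward m (act t : borel X -> borel X)]_y f y)%E.
  by rewrite (@ge0_integral_pushforward _ _ (borel X) (borel X) R _ (act_measurable t) m
    setT f)//= ?preimage_setT.
by apply: eq_measure_integral => [|mt A mA _]; [exact: act_measurable | exact: measure_act].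
Qed.

Lemma rint_act t (f : borel X -> R) : rint m f -> rint m (fun x => f (act t x)).
Proof.
move=> /integrableP[mf fi]; apply/integrableP; split.
  exact: (measurableT_comp mf (act_measurable t)).
rewrite (@ge0_integral_act t (fun x => `|(f x)%:E|%E))//.
exact: measurableT_comp.
Qed.

Lemma mean_act t (f : borel X -> R) : rint m f -> mean m (fun x => f (act t x)) = mean m f.
Proof.
move=> hf; rewrite /mean /Rintegral; congr fine.
transitivity (\int[pushforward m (act t : borel X -> borel X)]_y (f y)%:E)%E.
  rewrite (@integral_pushforward _ _ (borel X) (borel X) R _ (act_measurable t) m setT
    (fun y => (f y)%:E))//=.
  - by case/integrableP: hf.
  - rewrite preimage_setT; exact: rint_act.
by apply: eq_measure_integral => [|mt A mA _]; [exact: act_measurable | exact: measure_act].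
Qed.

Lemma cmeasurable_act t f : cmeas f -> cmeas (fun x => f (act t x)).
Proof.
by move=> [hr hi]; split;
  [exact: (measurableT_comp hr (act_measurable t)) |
   exact: (measurableT_comp hi (act_measurable t))].
Qed.

Lemma cbmeas_act t (f : borel X -> Cplx R) : cbmeas f -> cbmeas (fun x : borel X => f (act t x)).
Proof.
move=> hf; have [M fM] := cbmeas_bounded hf.
apply: (@cbmeasP _ _ _ _ M) => [|x]; last exact: fM.
by apply: cmeasurable_act; exact: cbmeas_measurable.
Qed.

Lemma cintegral_act t (f : borel X -> Cplx R) : cint m f ->
  cintegral m (fun x => f (act t x)) = cintegral m f.
Proof.
by move=> [h1 h2]; rewrite !cintegralE; congr (_ +i* _);
  [exact: (mean_act t h1) | exact: (mean_act t h2)].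
Qed.

Lemma sqnorm_act t f : cmeas f -> sqnorm m (fun x => f (act t x)) = sqnorm m f.
Proof.
move=> mf; apply: (ge0_integral_act t (f := fun x => (normc (f x) ^+ 2)%:E)).
  exact: measurable_sqnormc.
by move=> x; rewrite lee_fin sqr_ge0.
Qed.

Lemma disp_ucont t : ucont d (fun x => d x (act t x)).
Proof.
apply: (compact_ucont dm Xc) => x e e0.
have [|a a0 ha] := @act_metric_continuous t x (e / 2); first lra.
exists (Num.min a (e / 2)); first by rewrite lt_min a0; lra.
move=> y; rewrite lt_min => /andP[/ha h1 h2].
by apply: le_lt_trans (d_lip dm _ _ _ _) _; lra.
Qed.

Lemma disp_bmeas t : bmeas (fun x : borel X => d x (act t x)).
Proof. exact: (ucont_bmeas dm Xc (disp_ucont t)). Qed.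

Lemma dispE t : disp t = mean m (fun x : borel X => d x (act t x)). Proof. by []. Qed.

Lemma disp0 : disp 0 = 0.
Proof.
rewrite -[RHS](mean_cst m) dispE; congr mean; apply/funext => x.
by rewrite act0 (dxx dm).
Qed.

Lemma dispN t : disp (- t) = disp t.
Proof.
rewrite dispE -(mean_act t); last exact/bmeas_rint/disp_bmeas.
by congr mean; apply/funext => x; rewrite actK (d_sym dm).
Qed.

Lemma dispD s t : disp (s + t) <= disp s + disp t.
Proof.
rewrite !dispE -(mean_act t (f := fun x => d x (act s x))); last first.
  exact/bmeas_rint/disp_bmeas.
have h1 := bmeas_rint m (disp_bmeas t); have h2 := rint_act t (bmeas_rint m (disp_bmeas s)).
rewrite -meanD//.
apply: le_mean; first exact/bmeas_rint/disp_bmeas.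
  exact: rintD.
by move=> x; rewrite actD addrC; exact: (d_tri dm).
Qed.

(** [disp (s - t)] is a pseudometric on [G], so [disp] is 1-Lipschitz. *)
Lemma disp_lip s t : `|disp s - disp t| <= disp (s - t).
Proof.
have := dispD (s - t) t; have := dispD (t - s) s; rewrite !subrK -opprB dispN.
by rewrite ler_norml; lra.
Qed.

(** Every point of [X] has a ball whose points are moved little by the
  elements near 0, and finitely many such balls cover [X]. *)
Lemma disp_continuous0 (e : R) : 0 < e -> \forall u \near (0 : G), disp u < e.
Proof.
move=> e0; have e4 : 0 < e / 4 by lra.
have [_ _ ac] := actc.
have P x : exists rN : R * set G, [/\ 0 < rN.1, nbhs (0 : G) rN.2 &
    forall u y, rN.2 u -> d x y < rN.1 -> d y (act u y) < e / 2].
  have := ac (0, x) _ (nbhs_mball dm (act 0 x) e4).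
  rewrite nbhs_simpl/= => -[[A B] /= [tA xB] AB].
  have /(nbhs_ballP_metric dm) [r r0 rB] := xB.
  exists (Num.min r (e / 4), A); split => //=; first by rewrite lt_min r0.
  move=> u y Au; rewrite lt_min => /andP[xr xe].
  have := AB (u, y) (conj Au (rB _ xr)); rewrite /mball/= act0.
  have := d_tri dm y x (act u y); rewrite (d_sym dm y x); lra.
have [rN rNP] := choice P.
have r0 x : 0 < (rN x).1 by case: (rNP x).
have [s sP] := compact_ball_cover dm Xc r0.
have : \forall u \near (0 : G), forall x, x \in s -> (rN x).2 u.
  elim: s {sP} => [|x s ih]; first exact: nearW.
  have [_ Nx _] := rNP x.
  near=> u => y; rewrite inE => /orP[/eqP ->|ys].
    by near: u.
  by move: y ys; near: u.
apply: filterS => u hu; apply: (@le_lt_trans _ _ (e / 2)); last lra.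
rewrite dispE -(mean_cst m (e / 2)); apply: le_mean.
- exact/bmeas_rint/disp_bmeas.
- exact: rint_cst.
- move=> y; have [x xs xy] := sP y; have [_ _ h] := rNP x.
  by apply/ltW/h => //; exact: hu.
Unshelve. all: by end_near. Qed.

(** Markov's inequality. *)
Lemma measure_displacement t (e : R) : 0 < e ->
  (m [set x | (e <= d x (act t x))%R] <= (disp t / e)%:E)%E.
Proof.
move=> e0; have mA : measurable ([set x | e <= d x (act t x)] : set (borel X)).
  have := (disp_bmeas t).1 measurableT _ (measurable_itv `[e, +oo[).
  by rewrite setTI (_ : _ @^-1` _ = [set x | e <= d x (act t x)])//;
    apply/seteqP; split => x /=; rewrite in_itv/= andbT.
have : e * mean m (\1_[set x | e <= d x (act t x)] : borel X -> R) <= disp t.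
  rewrite -meanZ; last by apply: bmeas_rint; exact: bmeas_ind.
  apply: le_mean.
  - by apply: bmeas_rint; apply: bmeasM; [exact: bmeas_cst | exact: bmeas_ind].
  - exact/bmeas_rint/disp_bmeas.
  move=> x; rewrite indicE; have [|_] := boolP (x \in _).
    by rewrite inE mulr1.
  by rewrite mulr0 (d_ge0 dm).
rewrite mulrC -ler_pdivlMr// -lee_fin; congr (_ <= _)%E.
rewrite /mean /Rintegral integral_indic// setIT fineK//.
exact: fin_num_measure.
Qed.

(** All measurable sets have this property, by [almost_fixed_measurable]: the
  displacement controls the action in measure. *)
Definition almost_fixed (A : set (borel X)) := forall e : R, 0 < e ->
  exists2 del : R, 0 < del & forall t, disp t < del ->
    (m (A `\` act t @^-1` A) < e%:E)%E.

Lemma almost_fixedC A : measurable A -> almost_fixed A -> almost_fixed (~` A).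
Proof.
move=> mA hA e /hA[del del0 h]; exists del => // t /h.
have mtA := preimage_act_measurable t mA.
have -> : (~` A `\` act t @^-1` (~` A)) = (act t @^-1` A) `\` A.
  by apply/seteqP; split => x /= [h1 h2]; split => //; exact: contrapT.
suff -> : m (act t @^-1` A `\` A) = m (A `\` act t @^-1` A) by [].
rewrite !measureD//; try by rewrite ltey_eq fin_num_measure.
by congr (_ - _)%E; [exact: measure_act | rewrite setIC].
Qed.

(** Up to a set of small measure the union is a finite union. *)
Lemma almost_fixed_bigcup (F : nat -> set (borel X)) :
  (forall n, measurable (F n)) -> (forall n, almost_fixed (F n)) ->
  almost_fixed (\bigcup_n F n).
Proof.
move=> mF hF e e0; have e2 : 0 < e / 2 by lra.
have mU : measurable (\bigcup_n F n) by exact: bigcup_measurable.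
pose D n := (\bigcup_n F n) `\` \big[setU/set0]_(i < n) F i.
have mB n : measurable (\big[setU/set0]_(i < n) F i) by exact: bigsetU_measurable.
have mD n : measurable (D n) by exact: measurableD.
have : m (D n) @[n --> \oo] --> m (\bigcap_n D n).
  apply: nonincreasing_cvg_mu => //.
  - by rewrite ltey_eq fin_num_measure.
  - exact: bigcapT_measurable.
  - move=> i j ij; apply/subsetPset => x [Ux nx]; split => // xi; apply: nx.
    exact: (subset_bigsetU ij).
have -> : \bigcap_n D n = set0.
  apply/seteqP; split => // x Dx; have [[k _ Fkx] _] := Dx 0%N I.
  by have [_] := Dx k.+1 I; apply; rewrite big_ord_recr/=; right.
rewrite measure0 => /cvge_exists_lt; have e20 : (0 < (e / 2)%:E)%E by rewrite lte_fin.
move=> /(_ _ e20)[n Dn].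
have en : 0 < e / (2 * n.+1%:R) by rewrite divr_gt0// mulr_gt0// ltr0n.
have P i : exists del : R, 0 < del /\ forall t, disp t < del ->
    (m (F i `\` act t @^-1` F i) < (e / (2 * n.+1%:R))%:E)%E.
  by have [a ? ?] := hF i _ en; exists a.
have [del delP] := choice P.
exists (\big[Num.min/1]_(i < n) del i).
  by apply: lt_bigmin => // i _; case: (delP i).
move=> t ht; have mt (B : set (borel X)) : measurable B -> measurable (B `\` act t @^-1` B).
  by move=> mB'; apply: measurableD => //; exact: preimage_act_measurable.
apply: (@le_lt_trans _ _ (m (D n `|` \big[setU/set0]_(i < n) (F i `\` act t @^-1` F i)))).
  apply: le_measure; rewrite ?inE; first exact: mt.
    by apply: measurableU => //; apply: bigsetU_measurable => i _; exact: mt.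
  move=> x [Ux nx]; have [Bx|Bx] := pselect ((\big[setU/set0]_(i < n) F i) x); last by left.
  right; move: Bx; rewrite -bigcup_mkord -(bigcup_mkord n (fun i => F i `\` act t @^-1` F i)) => -[i /= ilt Fix].
  by exists i => //; split => // Ftx; apply: nx; exists i.
apply: le_lt_trans (measureU2 _ _ _) _ => //.
  by apply: bigsetU_measurable => i _; exact: mt.
apply: (lte_half Dn); apply: le_trans (Boole_inequality m (fun i _ => mt _ (mF i))) _.
apply: (@le_trans _ _ (\sum_(i < n) (e / (2 * n.+1%:R))%:E)%E).
  apply: lee_sum => i _; apply/ltW/(delP i).2; apply: lt_le_trans ht _.
  exact: bigmin_le.
rewrite sumEFin lee_fin sumr_const card_ord -[leLHS]mulr_natl.
have n0 : 0 < n.+1%:R :> R by rewrite ltr0n.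
have -> : n%:R * (e / (2 * n.+1%:R)) = e / 2 * (n%:R / n.+1%:R) by field; lra.
apply: ler_piMr; first exact: ltW.
by rewrite ler_pdivrMr// mul1r ler_nat.
Qed.

(** A point leaves [A] only if it is close to the complement of [A], which
  holds on a set of small measure, or if it is moved far. *)
Lemma almost_fixed_open (A : set X) : open A -> almost_fixed A.
Proof.
move=> Ao e e0; have e2 : 0 < e / 2 by lra.
pose I n := [set x | mball d x (n.+1%:R^-1) `<=` A].
have n0 n : 0 < n.+1%:R^-1 :> R by rewrite invr_gt0 ltr0n.
have mA : measurable (A : set (borel X)) by exact: borel_open.
have mI n : measurable (I n : set (borel X)).
  rewrite -[I n]setCK; apply: measurableC; apply: borel_open; apply/(mopenP dm) => x /=.
  rewrite /I/= => /existsNP[y /not_implyP[xy nAy]].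
  exists (n.+1%:R^-1 - d x y); first by rewrite subr_gt0.
  move=> x' xx' IA; apply: nAy; apply: IA; rewrite /mball/=.
  have := d_tri dm x' x y; move: xx'; rewrite /mball/= (d_sym dm x' x).
  by move: (n.+1%:R^-1) => z; lra.
pose D n := A `\` I n.
have mD n : measurable (D n : set (borel X)) by exact: measurableD.
have : m (D n) @[n --> \oo] --> m (\bigcap_n D n).
  apply: nonincreasing_cvg_mu => //.
  - by rewrite ltey_eq fin_num_measure.
  - exact: bigcapT_measurable.
  - move=> i j ij; apply/subsetPset => x [Ax nx]; split => // Ii; apply: nx => y xy.
    by apply: Ii; apply: (lt_le_trans xy); rewrite lef_pV2 ?posrE ?ltr0n// ler_nat ltnS.
have -> : \bigcap_n D n = set0.
  apply/seteqP; split => // x Dx; have [Ax _] := Dx 0%N Logic.I.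
  have /(mopenP dm) /(_ _ Ax)[r r0 rA] := Ao.
  have [n _ /(_ n (leqnn n)) /= hn] := near_infty_natSinv_lt (PosNum r0).
  have [_] := Dx n Logic.I; apply => y xy; apply: rA; exact: lt_trans xy hn.
rewrite measure0 => /cvge_exists_lt; have e20 : (0 < (e / 2)%:E)%E by rewrite lte_fin.
move=> /(_ _ e20)[n Dn].
exists (n.+1%:R^-1 * (e / 2)); first exact: mulr_gt0.
move=> t ht.
have mE : measurable ([set x | n.+1%:R^-1 <= d x (act t x)] : set (borel X)).
  have := (disp_bmeas t).1 measurableT _ (measurable_itv `[n.+1%:R^-1, +oo[).
  by rewrite setTI (_ : _ @^-1` _ = [set x | n.+1%:R^-1 <= d x (act t x)])//;
    apply/seteqP; split => x /=; rewrite in_itv/= andbT.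
apply: (@le_lt_trans _ _ (m (D n `|` [set x | n.+1%:R^-1 <= d x (act t x)]))).
  apply: le_measure; rewrite ?inE.
  - by apply: measurableD => //; exact: preimage_act_measurable.
  - exact: measurableU.
  move=> x [Ax nAtx]; have [Ix|Ix] := pselect (I n x); last by left.
  by right; rewrite /= leNgt; apply/negP => /Ix.
apply: le_lt_trans (measureU2 _ _ _) _ => //.
apply: (lte_half Dn); apply: le_trans (measure_displacement t (n0 n)) _.
by rewrite lee_fin ler_pdivrMr// mulrC ltW.
Qed.

Lemma almost_fixed_measurable (A : set (borel X)) : measurable A -> almost_fixed A.
Proof.
move=> mA.
pose H := [set B : set (borel X) | measurable B /\ almost_fixed B].
suff /(_ _ mA) [] : <<s open >> `<=` H by [].
apply: smallest_sub; last first.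
  by move=> U Uo; split; [exact: borel_open | exact: almost_fixed_open].
split.
- by split; [exact: measurable0 | apply: almost_fixed_open; exact: open0].
- move=> B [mB hB]; rewrite setTD; split; first exact: measurableC.
  exact: almost_fixedC.
- move=> F HF; have mF n : measurable (F n : set (borel X)) by case: (HF n).
  split; first exact: bigcup_measurable.
  by apply: almost_fixed_bigcup => // n; case: (HF n).
Qed.

End Dynamics.

(** * Eigenvalues are continuous for the displacement *)

Section Eigenvalues.
Context (R : realType) (X : ptopologicalType) (G : topologicalZmodType).
Variables (act : G -> X -> X) (m : probability (borel X) R) (d : X -> X -> R).
Hypothesis Xc : compact [set: X].
Hypothesis actc : continuous_action act.
Hypothesis minv : invariant_measure act m.
Hypothesis dm : metric_inducing_topology d.
Local Notation Re := complex.Re.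
Local Notation Im := complex.Im.
Local Notation normc := Normc.normc.
Local Notation disp := (disp act m d).

(** The squared distance is the measure of the symmetric difference of [A]
  and its preimage. *)
Lemma orbit_continuous (A : set (borel X)) (e : R) : measurable A -> 0 < e ->
  exists2 del : R, 0 < del & forall t, disp t < del ->
    (sqnorm m (fun x => cind R A (act t x) - cind R A x)%R < e%:E)%E.
Proof.
move=> mA e0; have e4 : 0 < e / 4 by lra.
have [d1 d10 h1] := almost_fixed_measurable Xc actc minv dm mA e4.
have [d2 d20 h2] := almost_fixed_measurable Xc actc minv dm (measurableC mA) e4.
exists (Num.min d1 d2); first by rewrite lt_min d10.
move=> t; rewrite lt_min => /andP[/h1 {}h1 /h2 {}h2].
have mtA := preimage_act_measurable actc dm t mA.
pose B1 : set (borel X) := A `\` act t @^-1` A.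
pose B2 : set (borel X) := ~` A `\` act t @^-1` (~` A).
have mB1 : measurable B1 by exact: measurableD.
have mB2 : measurable B2.
  by apply: measurableD; [exact: measurableC | exact: (preimage_act_measurable actc dm t (measurableC mA))].
have -> : (fun x => cind R A (act t x) - cind R A x) =
    (fun x => cind R B2 x + (-1) * cind R B1 x).
  apply/funext => x.
  have E1 : (x \in B1) = (x \in A) && (act t x \notin A).
    apply/idP/andP => [/set_mem[h3 h4]|[/set_mem h3 /negP h4]].
      by split; [exact: mem_set | apply/negP => /set_mem].
    by apply: mem_set; split => // /mem_set.
  have E2 : (x \in B2) = (x \notin A) && (act t x \in A).
    apply/idP/andP => [/set_mem[h3 h4]|[/negP h3 /set_mem h4]].
      by split; [apply/negP => /set_mem | apply/mem_set; by apply: contrapT].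
    by apply: mem_set; split => [/mem_set//|]; apply.
  rewrite /cind !indicE E1 E2; case: (x \in A); case: (act t x \in A) => /=;
    by rewrite ?(rmorph0, rmorph1) ?(mulr0, mulr1, subr0, sub0r, addr0, add0r, subrr).
apply: le_lt_trans (sqnormD _ _ _) _; last first.
- rewrite sqnormZ; last exact/cbmeas_measurable/cbmeas_cind.
  rewrite normc_opp normc_one expr1n mul1e !sqnorm_cind//.
  move: h1 h2; rewrite -/B1 -/B2.
  have /fineK <- := fin_num_measure m B1 mB1; have /fineK <- := fin_num_measure m B2 mB2.
  by rewrite -!EFinM -EFinD !lte_fin => h1 h2; lra.
- exact/cmeasurableZ/cbmeas_measurable/cbmeas_cind.
- exact/cbmeas_measurable/cbmeas_cind.
Qed.

Lemma dense_complex (z : Cplx R) (e : R) : 0 < e ->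
  exists q : rat * rat, normc (z - (ratr q.1 +i* ratr q.2)) < e.
Proof.
move=> e0; have e2 : 0 < e / 2 by lra.
have P (r : R) : exists q : rat, `|r - ratr q| < e / 2.
  have [|q] := @rat_in_itvoo R (r - e / 2) (r + e / 2); first lra.
  by rewrite in_itv/= => /andP[h1 h2]; exists q; rewrite ltr_norml; lra.
have [q1 h1] := P (Re z); have [q2 h2] := P (Im z); exists (q1, q2).
by apply: le_lt_trans (normc_le_ReIm _) _; rewrite ReB ImB/=; lra.
Qed.

(** The sets where an eigenfunction is relatively close to a given complex
  number cover the set where it does not vanish, so one of them, [A], is not
  null; when [t] moves [A] little, some point of [A] has its [t]-translate in
  [A], where the eigenfunction has changed by the factor [gam t]. *)
Lemma eigenvalue_ucont (gam : G -> Cplx R) f (e : R) :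
  (forall t, normc (gam t) = 1) -> eigenfunction act m gam f -> 0 < e ->
  exists2 del : R, 0 < del &
  forall t, disp t < del -> normc (gam t - 1) < e.
Proof.
move=> gam1 [[mf _] fn0 fgam] e0; pose c := e / 4; have c0 : 0 < c by rewrite /c; lra.
pose z (q : rat * rat) : Cplx R := ratr q.1 +i* ratr q.2.
pose A q : set (borel X) := [set x | normc (f x - z q) ^+ 2 < c ^+ 2 * normc (f x) ^+ 2].
have AP q x : A q x -> normc (f x - z q) < c * normc (f x).
  rewrite /A/= -[ltRHS]exprMn ltr_pXn2r// nnegrE ?normc_ge0//.
  by apply: mulr_ge0; [exact: ltW | exact: normc_ge0].
have msq (h : borel X -> Cplx R) : cmeasurable h ->
    measurable_fun setT (fun x : borel X => normc (h x) ^+ 2).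
  move=> mh; have := measurable_sqnormc mh.
  by move/measurable_EFinP.
have mA q : measurable (A q).
  have mu : measurable_fun setT
      (fun x : borel X => c ^+ 2 * normc (f x) ^+ 2 - normc (f x - z q) ^+ 2).
    apply: measurable_funB; first by apply: measurable_funM => //; exact: msq.
    by apply: msq; apply: cmeasurableB => //; exact: cmeasurable_cst.
  have := mu measurableT _ (measurable_itv `]0, +oo[).
  rewrite setTI (_ : _ @^-1` _ = A q)//.
  by apply/seteqP; split => x /=; rewrite in_itv/= andbT subr_gt0.
have [q Aq] : exists q, m (A q) != 0%E.
  apply: contrapT => /forallNP h; apply: fn0.
  pose B n : set (borel X) := if unpickle n is Some q then A q else set0.
  have : m.-negligible (\bigcup_n B n).
    apply: negligible_bigcup => n; rewrite /B; case: unpickle => [q|].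
      apply/negligibleP => //; apply/eqP; apply: contrapT => /negP; exact: h.
    exact: negligible_set0.
  apply: negligibleS => x /= fx.
  have f0 : 0 < normc (f x) by apply: normc_gt0; apply/eqP.
  have [q qx] := dense_complex (f x) (mulr_gt0 c0 f0).
  have Ax : A q x.
    rewrite /A/= -[ltRHS]exprMn ltr_pXn2r// nnegrE ?normc_ge0//.
    exact/ltW/mulr_gt0.
  have BA : B (pickle q) = A q by rewrite /B pickleK.
  exists (pickle q); [exact: Logic.I | rewrite BA; exact: Ax].
have mq0 : 0 < fine (m (A q)).
  apply: fine_gt0; rewrite lt0e Aq measure_ge0/=.
  by rewrite ltey_eq fin_num_measure.
have [del del0 h] := almost_fixed_measurable Xc actc minv dm (mA q) mq0.
exists del => // t /h; rewrite fineK ?fin_num_measure// => hlt.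
have mtA := preimage_act_measurable actc dm t (mA q).
have [x [[Ax Atx] fx]] : exists x, (A q `&` act t @^-1` A q) x /\ f (act t x) = gam t * f x.
  apply: contrapT => /forallNP hx.
  have : m (A q `&` act t @^-1` A q) = 0%E.
    have mI : measurable (A q `&` act t @^-1` A q : set (borel X)) by exact: measurableI.
    apply: measure_negligible => //.
    by apply: negligibleS (fgam t) => x Ax fx; apply: (hx x).
  move=> I0; move: hlt; rewrite measureD//; last by rewrite ltey_eq fin_num_measure.
  by move: I0 => /= ->; rewrite sube0 ltxx.
have f0 : 0 < normc (f x).
  rewrite lt_neqAle normc_ge0 andbT; apply/negP => /eqP f0.
  by have := AP _ _ Ax; rewrite -f0 mulr0 ltNge normc_ge0.
have : normc ((gam t - 1) * f x) <= 2 * c * normc (f x).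
  have -> : (gam t - 1) * f x = (f (act t x) - z q) - (f x - z q).
    by rewrite mulrBl mul1r -fx opprB addrA subrK.
  have nf : normc (f (act t x)) = normc (f x) by rewrite fx normc_mul gam1 mul1r.
  have := normc_triangle (f (act t x) - z q) (- (f x - z q)).
  rewrite normc_opp; have := AP _ _ Ax; have := AP _ _ Atx; rewrite nf; lra.
by rewrite normc_mul ler_pM2r// /c; lra.
Qed.

End Eigenvalues.

(** * Eigenfunctions as Fourier coefficients of orbits *)

Section WeightedSums.
Context (R : realType).
Local Notation normc := Normc.normc.

(** Jensen's inequality for the square of the modulus. *)
Lemma normc_weighted_sum (J : finType) (a : J -> R) (z : J -> Cplx R) :
  (forall i, 0 <= a i) ->
  normc (\sum_i (a i)%:C * z i) ^+ 2 <= (\sum_i a i) * \sum_i a i * normc (z i) ^+ 2.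
Proof.
move=> a0; set A := \sum_i a i; set s := \sum_i a i * normc (z i).
have s0 : 0 <= s by apply: sumr_ge0 => i _; rewrite mulr_ge0 ?normc_ge0.
have A0 : 0 <= A by exact: sumr_ge0.
have zs : normc (\sum_i (a i)%:C * z i) <= s.
  apply: le_trans (normc_sum _ _ _) _; apply: ler_sum => i _.
  by rewrite normc_mul normc_real ger0_norm.
apply: (@le_trans _ _ (s ^+ 2)); first by rewrite ler_pXn2r ?nnegrE ?normc_ge0.
have [A1|A1] := eqVneq A 0.
  have z0 i : a i = 0.
    apply/eqP; move: A1 => /eqP; rewrite psumr_eq0// => /allP /(_ i).
    by rewrite mem_index_enum => /(_ isT).
  by rewrite A1 mul0r /s big1 ?expr0n// => i _; rewrite z0 mul0r.
have Ap : 0 < A by rewrite lt_neqAle eq_sym A1.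
have : 0 <= \sum_i a i * (normc (z i) - s / A) ^+ 2.
  by apply: sumr_ge0 => i _; rewrite mulr_ge0 ?sqr_ge0.
have -> : \sum_i a i * (normc (z i) - s / A) ^+ 2 =
    (\sum_i a i * normc (z i) ^+ 2) - s ^+ 2 / A.
  transitivity ((\sum_i a i * normc (z i) ^+ 2) - 2 * (s / A) * s + (s / A) ^+ 2 * A).
    rewrite /s /A !mulr_sumr -sumrB -big_split/=.
    by apply: eq_bigr => i _; rewrite -/A -/s; ring.
  by field.
by rewrite subr_ge0 ler_pdivrMr// mulrC.
Qed.

Context (dT : measure_display) (T : measurableType dT) (P : probability T R).

Lemma sqmean_weighted_sum (J : finType) (a : J -> R) (u : J -> T -> Cplx R) :
  (forall i, 0 <= a i) -> (forall i, cbmeas (u i)) ->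
  sqmean P (fun x => \sum_i (a i)%:C * u i x)
    <= (\sum_i a i) * \sum_i a i * sqmean P (u i).
Proof.
move=> a0 hu; rewrite /sqmean.
have hn i : rint P (fun x => a i * normc (u i x) ^+ 2).
  by apply/rintZ/bmeas_rint/bmeas_normc2.
rewrite -(eq_bigr _ (fun i _ => meanZ (a i) (bmeas_rint P (bmeas_normc2 (hu i))))).
rewrite -mean_sum// -meanZ; last exact: rint_sum.
apply: le_mean; last by move=> x; exact: normc_weighted_sum.
  by apply/bmeas_rint/bmeas_normc2/cbmeas_sum => i; exact: cbmeasZ.
exact/rintZ/rint_sum.
Qed.

Lemma sqmeanD f g : cbmeas f -> cbmeas g ->
  sqmean P (fun x => f x + g x) <= 2 * sqmean P f + 2 * sqmean P g.
Proof.
move=> hf hg; rewrite /sqmean -!meanZ; try exact/bmeas_rint/bmeas_normc2.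
rewrite -meanD; try exact/rintZ/bmeas_rint/bmeas_normc2.
apply: le_mean => [||x]; last exact: normc_sqrD.
  exact/bmeas_rint/bmeas_normc2/cbmeasD.
by apply: rintD; exact/rintZ/bmeas_rint/bmeas_normc2.
Qed.

Lemma sqmeanZ (c : Cplx R) f : cbmeas f ->
  sqmean P (fun x => c * f x) = normc c ^+ 2 * sqmean P f.
Proof.
move=> hf; rewrite /sqmean -meanZ; last exact/bmeas_rint/bmeas_normc2.
by congr mean; apply/funext => x; rewrite normc_mul exprMn.
Qed.

Lemma sqmeanN f : sqmean P (fun x => - f x) = sqmean P f.
Proof. by congr mean; apply/funext => x; rewrite normc_opp. Qed.

Lemma sqmean_le (f : T -> Cplx R) (M : R) : cbmeas f -> (forall x, normc (f x) <= M) ->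
  sqmean P f <= M ^+ 2.
Proof.
move=> hf fM; rewrite -(mean_cst P (M ^+ 2)); apply: le_mean.
- exact/bmeas_rint/bmeas_normc2.
- exact: rint_cst.
- move=> x; rewrite ler_pXn2r// nnegrE ?normc_ge0//.
  exact: le_trans (normc_ge0 _) (fM x).
Qed.

Lemma sqmean_ae0 f : cbmeas f -> (forall e : R, 0 < e -> sqmean P f <= e) ->
  {ae P, forall x, f x = 0}.
Proof.
move=> hf h; have s0 : sqmean P f = 0.
  apply/eqP; rewrite eq_le sqmean_ge0 andbT; apply/ler_addgt0Pr => e e0.
  by rewrite add0r; exact: h.
have : sqnorm P f = 0%E by rewrite sqnorm_bounded// -/(sqmean P f) s0.
have mf := measurable_sqnormc (cbmeas_measurable hf).
have -> : sqnorm P f = (\int[P]_x `|(normc (f x) ^+ 2)%:E|)%E.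
  by apply: eq_integral => x _; rewrite gee0_abs// lee_fin sqr_ge0.
move=> /(ae_eq_integral_abs _ measurableT mf); apply: filterS => x /= /(_ Logic.I)[] h0.
by apply: normc_eq0P; apply/eqP; rewrite -sqrf_eq0 h0.
Qed.

End WeightedSums.

Section OrbitIntegral.
Context (R : realType) (X : ptopologicalType) (G : topologicalZmodType).
Variables (act : G -> X -> X) (m : probability (borel X) R) (d : X -> X -> R).
Hypothesis Xc : compact [set: X].
Hypothesis actc : continuous_action act.
Hypothesis minv : invariant_measure act m.
Hypothesis dm : metric_inducing_topology d.
Context (K : ptopologicalType) (dK : K -> K -> R).
Hypothesis dmK : metric_inducing_topology dK.
Hypothesis Kc : compact [set: K].
Variables (add : K -> K -> K) (zero : K) (opp : K -> K).
Hypothesis gK : metric_group dK add zero opp.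
Variable mu : probability (borel K) R.
Hypothesis muK : forall x (A : set (borel K)), measurable A ->
  mu (add x @^-1` A) = mu A.
Variable j : G -> K.
Hypothesis jD : forall s t, j (s + t) = add (j s) (j t).
Hypothesis j_dense : forall k (e : R), 0 < e -> exists t, dK k (j t) < e.
Hypothesis j_iso : forall s t, dK (j s) (j t) = disp act m d (s - t).
Local Notation Re := complex.Re.
Local Notation Im := complex.Im.
Local Notation normc := Normc.normc.
Local Notation disp := (disp act m d).
Local Notation sqm := (@sqmean R _ (borel X) m).
Local Notation mchar := (mchar dK add).

Lemma j0 : j 0 = zero.
Proof.
have := jD 0 0; rewrite addr0 => /(congr1 (add (opp (j 0)))).
by rewrite (mg_addN gK) (mg_addA gK) (mg_addN gK) (mg_add0 gK).
Qed.

Lemma dist_zero t : dK zero (j t) = disp t.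
Proof. by rewrite -j0 j_iso sub0r dispN. Qed.

(** Functions on the dense subgroup [G] of [K] with values in [L^2] are integrated
  over [K] as limits of Riemann sums over these partitions. *)
Record tagged_partition := TaggedPartition {
  tp_size : nat;
  tp_cell : K -> 'I_tp_size;
  tp_tag : 'I_tp_size -> G;
  tp_measurable : forall i, measurable (tp_cell @^-1` [set i] : set (borel K))
}.
Arguments tp_cell : clear implicits.
Arguments tp_tag : clear implicits.

Definition subordinate (p : tagged_partition) (del : R) :=
  forall k, dK k (j (tp_tag p (tp_cell p k))) < del.

Definition weight (p : tagged_partition) i : R :=
  mean mu (\1_(tp_cell p @^-1` [set i]) : borel K -> R).
Arguments weight : clear implicits.

Definition riemann (p : tagged_partition) (v : G -> X -> Cplx R) x : Cplx R :=
  \sum_i (weight p i)%:C * v (tp_tag p i) x.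

Lemma subordinate_le p (a b : R) : a <= b -> subordinate p a -> subordinate p b.
Proof. by move=> ab h k; exact: lt_le_trans (h k) ab. Qed.

Let min_lel (a b : R) : Num.min a b <= a. Proof. by rewrite ge_min lexx. Qed.
Let min_ler (a b : R) : Num.min a b <= b. Proof. by rewrite ge_min lexx orbT. Qed.

Lemma exists_subordinate (del : R) : 0 < del -> exists p, subordinate p del.
Proof.
move=> d0; have d2 : 0 < del / 2 by lra.
have [n [c [cell [h mc]]]] := measurable_cells dmK Kc d2.
have [tag htag] := choice (fun i : 'I_n.+1 => j_dense (c i) d2).
exists (TaggedPartition tag mc) => k /=.
apply: le_lt_trans (d_tri dmK _ (c (cell k)) _) _.
by have := h k; have := htag (cell k); rewrite (d_sym dmK k); lra.
Qed.

Lemma cell_weight_ge0 (J : finType) (cell : K -> J) i :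
  0 <= mean mu (\1_(cell @^-1` [set i]) : borel K -> R).
Proof. by apply: mean_ge0 => k; rewrite indicE ler0n. Qed.

Lemma sum_cell_weight (J : finType) (cell : K -> J) :
  (forall i, measurable (cell @^-1` [set i] : set (borel K))) ->
  \sum_i mean mu (\1_(cell @^-1` [set i]) : borel K -> R) = 1.
Proof.
move=> mc; have [_] := mean_cells mu (fun=> 1) mc.
by rewrite mean_cst => ->; apply: eq_bigr => i _; rewrite mulr1.
Qed.

Lemma cell_weight_empty (J : finType) (cell : K -> J) i :
  (forall k, cell k <> i) -> mean mu (\1_(cell @^-1` [set i]) : borel K -> R) = 0.
Proof.
move=> h; rewrite (_ : _ @^-1` _ = set0); last by apply/seteqP; split => // k /h.
by rewrite indic0 mean_cst.
Qed.

(** Both sums are integrals over [K] of step functions, which are compared on the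
  common refinement of the two partitions. *)
Lemma riemann_compare p p' v v' (e : R) :
  (forall t, cbmeas (v t : borel X -> Cplx R)) ->
  (forall t, cbmeas (v' t : borel X -> Cplx R)) ->
  (forall k, sqm (fun x => v (tp_tag p (tp_cell p k)) x -
                           v' (tp_tag p' (tp_cell p' k)) x) <= e) ->
  sqm (fun x => riemann p v x - riemann p' v' x) <= e.
Proof.
move=> hv hv' h.
pose J := ('I_(tp_size p) * 'I_(tp_size p'))%type.
pose cell k : J := (tp_cell p k, tp_cell p' k).
have mc (i : J) : measurable (cell @^-1` [set i] : set (borel K)).
  rewrite (_ : _ @^-1` _ = tp_cell p @^-1` [set i.1] `&` tp_cell p' @^-1` [set i.2]).
    by apply: measurableI; exact: tp_measurable.
  by apply/seteqP; split => k; rewrite /cell/=; case: i => a b /=; [move=> [-> ->] | move=> [-> ->]].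
pose W (i : J) : R := mean mu (\1_(cell @^-1` [set i]) : borel K -> R).
have E : (fun x => riemann p v x - riemann p' v' x) =
    (fun x => \sum_(i : J) (W i)%:C * (v (tp_tag p i.1) x - v' (tp_tag p' i.2) x)).
  apply/funext => x; rewrite /riemann.
  have S (w w' : 'I_(tp_size p) -> R) (u u' : 'I_(tp_size p') -> R) :
      \sum_i weight p i * w i - \sum_i weight p' i * u i =
      \sum_(i : J) W i * (w i.1 - u i.2).
    have [b1 <-] := mean_cells mu w (@tp_measurable p).
    have [b2 <-] := mean_cells mu u (@tp_measurable p').
    have [_ <-] := mean_cells mu (fun i : J => w i.1 - u i.2) mc.
    by rewrite -meanB//; exact: bmeas_rint.
  have ReZ (a : R) (z : Cplx R) : Re (a%:C * z) = a * Re z.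
    by rewrite ReM/= mul0r subr0.
  have ImZ (a : R) (z : Cplx R) : Im (a%:C * z) = a * Im z.
    by rewrite ImM/= mul0r addr0.
  apply: cplx_eq; rewrite ?ReB ?ImB ?Re_sum ?Im_sum.
    under eq_bigr do rewrite ReZ; under [X in _ - X]eq_bigr do rewrite ReZ.
    under [RHS]eq_bigr do rewrite ReZ ReB.
    exact: (S (fun i => Re (v (tp_tag p i) x)) (fun=> 0) (fun i => Re (v' (tp_tag p' i) x)) (fun=> 0)).
  under eq_bigr do rewrite ImZ; under [X in _ - X]eq_bigr do rewrite ImZ.
  under [RHS]eq_bigr do rewrite ImZ ImB.
  exact: (S (fun i => Im (v (tp_tag p i) x)) (fun=> 0) (fun i => Im (v' (tp_tag p' i) x)) (fun=> 0)).
have W0 i : 0 <= W i by exact: cell_weight_ge0.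
rewrite E; apply: le_trans (sqmean_weighted_sum _ W0 _) _.
  by move=> i; exact: cbmeasB.
rewrite sum_cell_weight// mul1r -[leRHS]mul1r -(sum_cell_weight mc) mulr_suml.
apply: ler_sum => i _; have [[k <-]|ne] := pselect (exists k, cell k = i).
  by apply: ler_wpM2l => //; exact: h.
by rewrite /W cell_weight_empty ?mul0r// => k kE; apply: ne; exists k.
Qed.

Definition uniform_family (v : G -> X -> Cplx R) :=
  [/\ forall t, cbmeas (v t : borel X -> Cplx R),
      exists M : R, forall t x, normc (v t x) <= M &
      forall e : R, 0 < e -> exists2 del : R, 0 < del & forall s t,
        dK (j s) (j t) < del -> sqm (fun x => v s x - v t x) <= e].

Definition riemann_limit v (F : X -> Cplx R) := cbmeas (F : borel X -> Cplx R) /\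
  forall e : R, 0 < e -> exists2 del : R, 0 < del & forall p, subordinate p del ->
    sqm (fun x => riemann p v x - F x) < e.

Lemma riemann_cbmeas p v : (forall t, cbmeas (v t : borel X -> Cplx R)) ->
  cbmeas (riemann p v : borel X -> Cplx R).
Proof. by move=> hv; apply: cbmeas_sum => i; exact: cbmeasZ. Qed.

Lemma weight_ge0 p i : 0 <= weight p i.
Proof. exact: cell_weight_ge0. Qed.

Lemma sum_weight p : \sum_i weight p i = 1.
Proof. exact: (sum_cell_weight (@tp_measurable p)). Qed.

Lemma riemann_le p v (M : R) : (forall t x, normc (v t x) <= M) ->
  forall x, normc (riemann p v x) <= M.
Proof.
move=> vM x; apply: le_trans (normc_sum _ _ _) _.
rewrite -[leRHS]mul1r -(sum_weight p) mulr_suml; apply: ler_sum => i _.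
by rewrite normc_mul normc_real ger0_norm ?weight_ge0// ler_wpM2l ?weight_ge0.
Qed.

(** The Riemann sums of finer and finer partitions form a sequence with the
  increments that [riesz_fischer] asks for, and [riemann_compare] makes the
  limit independent of the partitions. *)
Lemma exists_riemann_limit v : uniform_family v -> exists F, riemann_limit v F.
Proof.
move=> [hv [M vM] vc].
have e0 n : 0 < (8 : R)^-1 ^+ n by rewrite exprn_gt0// invr_gt0; lra.
have P n : exists del : R, 0 < del /\ forall s t,
    dK (j s) (j t) < del -> sqm (fun x => v s x - v t x) <= 8^-1 ^+ n.
  by have [a ? ?] := vc _ (e0 n); exists a.
have [a aP] := choice P.
pose b n := (\big[Num.min/a n]_(i < n) a i) / 2.
have b0 n : 0 < b n.
  by rewrite /b divr_gt0//; apply: lt_bigmin => [|i _]; [case: (aP n) | case: (aP i)].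
have ba n k : (n <= k)%N -> b k <= a n / 2.
  move=> nk; rewrite /b ler_pM2r ?invr_gt0//; have [lt|ge] := ltnP n k.
    exact: (@bigmin_le _ _ _ (a k) (Ordinal lt) (fun i => a i)).
  by rewrite (_ : n = k) ?bigmin_le_id//; apply/eqP; rewrite eqn_leq nk.
have [p pP] := choice (fun n => exists_subordinate (b0 n)).
have close n q (del : R) : subordinate q del -> del <= a n / 2 ->
    forall k, (n <= k)%N -> sqm (fun x => riemann q v x - riemann (p k) v x) <= 8^-1 ^+ n.
  move=> fq da k nk; apply: riemann_compare => // x.
  apply: (aP n).2; apply: le_lt_trans (d_tri dmK _ x _) _.
  by have := fq x; have := pP k x; have := ba n k nk; rewrite (d_sym dmK _ x); lra.
have [|||F [F_bmeas FP]] := @riesz_fischer R _ (borel X) m (fun n => riemann (p n) v) M.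
- by move=> n; exact/cbmeas_measurable/riemann_cbmeas.
- by move=> n x; exact: riemann_le.
- move=> n; rewrite sqnorm_bounded; last by apply: cbmeasB; exact: riemann_cbmeas.
  by rewrite lee_fin; apply: (close n _ _ (pP n.+1)) => //; exact: ba.
exists F; split => // e e1; have e4 : 0 < e / 4 by lra.
have [N NP] := FP _ e4.
have [k1 k1P] : exists k, (8 : R)^-1 ^+ k < e / 4.
  have [|k kP] := @expr_unbounded R (e / 4)^-1 8; first lra.
  by exists k; rewrite exprVn invf_plt ?posrE ?exprn_gt0.
pose k := maxn N k1; exists (a k / 2); first by have [] := aP k; lra.
move=> q fq; rewrite -lte_fin -sqnorm_bounded; last first.
  by apply: cbmeasB => //; exact: riemann_cbmeas.
apply: (@sqnorm_tri _ _ _ m _ (riemann (p k) v)).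
- exact/cbmeas_measurable/riemann_cbmeas.
- exact/cbmeas_measurable/riemann_cbmeas.
- exact: cbmeas_measurable.
- rewrite sqnorm_bounded; last by apply: cbmeasB; exact: riemann_cbmeas.
  rewrite lte_fin; apply: le_lt_trans (close k _ _ fq (lexx _) k (leqnn k)) _.
  apply: le_lt_trans k1P; apply: ler_wiXn2l; last exact: leq_maxr.
    by rewrite invr_ge0; lra.
  by rewrite invf_le1; lra.
- by apply: NP; exact: leq_maxl.
Qed.

Lemma riemann_limit0 : riemann_limit (fun _ _ => 0) (fun=> 0).
Proof.
split; first exact: cbmeas_cst.
move=> e e0; exists 1 => // p _; apply: le_lt_trans e0.
rewrite -[leRHS](mean_cst m) /sqmean le_eqVlt; apply/orP; left; apply/eqP; congr mean.
apply/funext => x; rewrite /riemann big1 ?subrr ?normc_zero ?expr0n// => i _.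
by rewrite mulr0.
Qed.

Lemma riemann_limitD v w F F' :
  (forall t, cbmeas (v t : borel X -> Cplx R)) ->
  (forall t, cbmeas (w t : borel X -> Cplx R)) ->
  riemann_limit v F -> riemann_limit w F' ->
  riemann_limit (fun t x => v t x + w t x) (fun x => F x + F' x).
Proof.
move=> hv hw [bF hF] [bF' hF']; split; first exact: cbmeasD.
move=> e e0; have e4 : 0 < e / 4 by lra.
have [a a0 ha] := hF _ e4; have [b b0 hb] := hF' _ e4.
exists (Num.min a b); first by rewrite lt_min a0.
move=> p hp; have := ha p (subordinate_le (min_lel _ _) hp).
have := hb p (subordinate_le (min_ler _ _) hp).
have := sqmeanD m (cbmeasB (riemann_cbmeas p hv) bF) (cbmeasB (riemann_cbmeas p hw) bF').
have -> : (fun x => riemann p v x - F x + (riemann p w x - F' x)) =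
    (fun x => riemann p (fun t x => v t x + w t x) x - (F x + F' x)).
  apply/funext => x; rewrite /riemann.
  under [X in _ = X - _]eq_bigr do rewrite mulrDr.
  by rewrite big_split/= opprD addrACA.
lra.
Qed.

Lemma riemann_limitZ (c : Cplx R) v F :
  (forall t, cbmeas (v t : borel X -> Cplx R)) ->
  riemann_limit v F -> riemann_limit (fun t x => c * v t x) (fun x => c * F x).
Proof.
move=> hv [bF hF]; split; first exact: cbmeasZ.
move=> e e0; pose C := normc c ^+ 2 + 1.
have C0 : 0 < C by rewrite ltr_wpDl ?sqr_ge0.
have [a a0 ha] := hF _ (divr_gt0 e0 C0).
exists a => // p /ha h; have {}h : sqm (fun x => riemann p v x - F x) * C < e.
  by rewrite -(ltr_pdivlMr _ _ C0).
have -> : (fun x => riemann p (fun t x => c * v t x) x - c * F x) =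
    (fun x => c * (riemann p v x - F x)).
  apply/funext => x; rewrite /riemann mulrBr mulr_sumr; congr (_ - _).
  by apply: eq_bigr => i _; rewrite mulrCA.
rewrite sqmeanZ; last by apply: cbmeasB => //; exact: riemann_cbmeas.
apply: le_lt_trans h; rewrite mulrC; apply: ler_wpM2l; first exact: sqmean_ge0.
by rewrite /C lerDl.
Qed.

Lemma mchar_ucont chi (e : R) : mchar chi -> 0 < e -> exists2 del : R, 0 < del &
  forall x y, dK x y < del -> normc (chi x - chi y) < e.
Proof.
move=> [hr hi _ _] e0; have e2 : 0 < e / 2 by lra.
have [a a0 ha] := hr _ e2; have [b b0 hb] := hi _ e2.
exists (Num.min a b); first by rewrite lt_min a0.
move=> x y; rewrite lt_min => /andP[/ha h1 /hb h2].
by apply: le_lt_trans (normc_le_ReIm _) _; rewrite ReB ImB; lra.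
Qed.

Lemma mchar_dual chi : mchar chi -> dual (chi \o j).
Proof.
move=> hchi; have [_ _ chi1 chiM] := hchi; split.
- move=> t; apply/cvgrPdist_lt => e e0.
  have eE : e = (Re e)%:C.
    by apply: cplx_eq => //=; move: e0; rewrite ltcE/= => /andP[/eqP ->].
  have r0 : 0 < Re e by move: e0; rewrite ltcE/= => /andP[].
  have [del del0 h] := mchar_ucont hchi r0.
  have := near_subl t (disp_continuous0 m Xc actc dm del0).
  apply: filterS => s hs; rewrite normrE eE ltcR; apply: h.
  by rewrite j_iso.
- by move=> t; rewrite normrE chi1.
- by move=> s t; rewrite /= jD chiM.
Qed.

Section Orbit.
Variable f : X -> Cplx R.
Hypothesis f_bmeas : cbmeas (f : borel X -> Cplx R).
Hypothesis f_le1 : forall x, normc (f x) <= 1.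
Hypothesis f_orbit : forall e : R, 0 < e -> exists2 del : R, 0 < del &
  forall t, disp t < del -> sqm (fun x => f (act t x) - f x) < e.

(** The Riemann limit of this family is the integral of [phi k] times the
  translate of [f] by [k]; for a character it is a Fourier coefficient of the
  orbit. *)
Definition character_family (phi : K -> Cplx R) t x := phi (j t) * f (act t x).

Let family_bmeas phi t : cbmeas (character_family phi t : borel X -> Cplx R).
Proof. by apply: cbmeasZ; exact: (cbmeas_act actc dm t f_bmeas). Qed.

Lemma sqmean_act t (g : X -> Cplx R) : cbmeas (g : borel X -> Cplx R) ->
  sqm (fun x => g (act t x)) = sqm g.
Proof.
move=> hg; exact: (mean_act actc minv dm t (bmeas_rint m (bmeas_normc2 hg))).
Qed.

Lemma character_family_uniform chi : mchar chi -> uniform_family (character_family chi).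
Proof.
move=> hchi; have [_ _ chi1 _] := hchi; split => //.
  by exists 1 => t x; rewrite /character_family normc_mul chi1 mul1r.
move=> e e0; have e4 : 0 < e / 4 by lra.
have m0 : 0 < Num.min 1 (e / 4) by rewrite lt_min ltr01.
have [a a0 ha] := f_orbit e4; have [b b0 hb] := mchar_ucont hchi m0.
exists (Num.min a b); first by rewrite lt_min a0.
move=> s t; rewrite lt_min => /andP[]; rewrite j_iso => /ha h1 ; rewrite -j_iso => /hb h2.
have E : (fun x => character_family chi s x - character_family chi t x) =
    (fun x => chi (j s) * (f (act s x) - f (act t x)) + (chi (j s) - chi (j t)) * f (act t x)).
  by apply/funext => x; rewrite /character_family; ring.
have bf u := cbmeas_act actc dm u f_bmeas.
rewrite E; apply: le_trans (sqmeanD m _ _) _; [exact/cbmeasZ/cbmeasB | exact: cbmeasZ|].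
rewrite !sqmeanZ//; last exact: cbmeasB.
rewrite chi1 expr1n mul1r (sqmean_act t f_bmeas).
have -> : sqm (fun x => f (act s x) - f (act t x)) = sqm (fun x => f (act (s - t) x) - f x).
  rewrite -[RHS](sqmean_act t); last exact: cbmeasB.
  by congr mean; apply/funext => x; rewrite -(actD actc) subrK.
have f1 : sqm f <= 1 by rewrite -[leRHS](expr1n _ 2); exact: sqmean_le.
have n4 : normc (chi (j s) - chi (j t)) ^+ 2 <= e / 4.
  move: h2; rewrite lt_min => /andP[h21 h24].
  apply: le_trans (ltW h24); rewrite expr2 ler_piMr ?normc_ge0//; exact: ltW.
have : normc (chi (j s) - chi (j t)) ^+ 2 * sqm f <= e / 4 * 1.
  by apply: ler_pM => //; [exact: sqr_ge0 | exact: sqmean_ge0].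
lra.
Qed.

(** Translating a partition by [j s] replaces each tag [t] by [t + s]. *)
Lemma limit_eigen chi F : mchar chi -> riemann_limit (character_family chi) F ->
  forall s, {ae m, forall x : borel X, F (act s x) = ((chi (j s))^*)%C * F x}.
Proof.
move=> hchi [bF hF] s; have [_ _ chi1 chiM] := hchi.
have bFs := cbmeas_act actc dm s bF.
have bd : cbmeas (fun x : borel X => F (act s x) - ((chi (j s))^*)%C * F x).
  by apply: cbmeasB => //; exact: cbmeasZ.
suff : {ae m, forall x : borel X, F (act s x) - ((chi (j s))^*)%C * F x = 0}.
  by apply: filterS => x /eqP; rewrite subr_eq0 => /eqP.
apply: sqmean_ae0 => // e e0; have e4 : 0 < e / 4 by lra.
have [del del0 h] := hF _ e4; have [p hp] := exists_subordinate del0.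
pose cell k := tp_cell p (add (j (- s)) k).
have cell_m i : measurable (cell @^-1` [set i] : set (borel K)).
  exact: (addr_measurable dmK gK (j (- s)) (@tp_measurable p i)).
pose p' := TaggedPartition (fun i => tp_tag p i + s) cell_m.
have jNs k : add (j s) (add (j (- s)) k) = k.
  by rewrite (mg_addA gK) -jD subrr j0 (mg_add0 gK).
have hp' : subordinate p' del.
  move=> k; rewrite /= jD -{1}(jNs k) (mg_addC gK (j s)) (gdist_r gK).
  exact: hp.
have W i : weight p' i = weight p i.
  rewrite /weight -[RHS](mean_translate dmK gK muK (j (- s))) //.
  exact: bmeas_ind (@tp_measurable p i).
have RS x : riemann p (character_family chi) (act s x) =
    ((chi (j s))^*)%C * riemann p' (character_family chi) x.
  rewrite /riemann mulr_sumr; apply: eq_bigr => i _.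
  rewrite W /character_family/= (actD actc) jD chiM.
  have u : chi (j s) * ((chi (j s))^*)%C = 1 by rewrite mulcJ chi1 expr1n.
  rewrite [RHS](_ : _ = chi (j s) * ((chi (j s))^*)%C * ((weight p i)%:C *
    (chi (j (tp_tag p i)) * f (act (tp_tag p i) (act s x))))); last by ring.
  by rewrite u mul1r.
have h1 : sqm (fun x => F (act s x) - riemann p (character_family chi) (act s x)) < e / 4.
  rewrite (sqmean_act s (g := fun x => F x - riemann p (character_family chi) x)); last first.
    by apply: cbmeasB => //; exact: riemann_cbmeas.
  rewrite -sqmeanN; have := h p hp.
  by congr (mean _ _ < _); apply/funext => x; rewrite opprB.
have h2 := h p' hp'.
have b1 := riemann_cbmeas p (family_bmeas chi); have b2 := riemann_cbmeas p' (family_bmeas chi).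
have E : (fun x => F (act s x) - ((chi (j s))^*)%C * F x) =
   (fun x => (F (act s x) - riemann p (character_family chi) (act s x)) +
    ((chi (j s))^*)%C * (riemann p' (character_family chi) x - F x)).
  by apply/funext => x; rewrite RS; ring.
rewrite E; apply: le_trans (sqmeanD m _ _) _.
- by apply: cbmeasB => //; exact: (cbmeas_act actc dm s b1).
- by apply: cbmeasZ; exact: cbmeasB.
rewrite sqmeanZ; last exact: cbmeasB.
by rewrite normc_conj chi1 expr1n; lra.
Qed.

(** The zero function belongs to this set, because a Fourier coefficient of
  an orbit may vanish. *)
Definition bounded_eigenfunctions : set (borel X -> Cplx R) :=
  [set F : borel X -> Cplx R | cbmeas F /\ exists2 gam : G -> Cplx R, dual gam &
    forall t, {ae m, forall x : borel X, F (act t x) = gam t * F x}].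

Lemma span_limit phi : lspan [set chi | mchar chi] phi ->
  exists F, lspan bounded_eigenfunctions F /\ riemann_limit (character_family phi) F.
Proof.
elim => [|chi hchi|phi1 phi2 _ [F1 [s1 l1]] _ [F2 [s2 l2]]|c phi1 _ [F [s1 l1]]].
- exists (fun=> 0); split; first exact: lspan0.
  have := riemann_limit0; congr riemann_limit.
  by apply/funext => t; apply/funext => x; rewrite /character_family mul0r.
- have [F hF] := exists_riemann_limit (character_family_uniform hchi).
  exists F; split => //; apply: lspan_base; split; first by case: hF.
  exists ((fun x => ((chi x)^*)%C) \o j); first exact: (mchar_dual (mchar_conj hchi)).
  exact: limit_eigen hF.
- exists (fun x => F1 x + F2 x); split; first exact: lspanD.
  have := riemann_limitD (family_bmeas phi1) (family_bmeas phi2) l1 l2.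
  congr riemann_limit; apply/funext => t; apply/funext => x.
  by rewrite /character_family mulrDl.
- exists (fun x => c * F x); split; first exact: lspanZ.
  have := riemann_limitZ c (family_bmeas phi1) l1.
  congr riemann_limit; apply/funext => t; apply/funext => x.
  by rewrite /character_family mulrA.
Qed.

(** Smearing [f] along its orbit with a concentrated trigonometric polynomial
  changes it little and gives a combination of eigenfunctions. *)
Lemma approx_eigenfunctions (e : R) : 0 < e ->
  exists g, lspan bounded_eigenfunctions g /\ sqm (fun x => f x - g x) < e.
Proof.
move=> e0; have e16 : 0 < e / 16 by lra.
have [eta eta0 heta] := f_orbit e16.
have [|eta' [eta'0 _ conc]] := concentrated_polynomial dmK Kc gK (mchar_group dmK Kc add) _ eta0.
  by move=> k k0; exact: (mchar_separates dmK Kc gK muK).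
pose c : R := fine (mu (mball dK zero eta')).
have c0 : 0 < c by exact: (mu_ball_gt0 dmK Kc gK muK).
have e10 : 0 < e * c / 128 by rewrite divr_gt0// mulr_gt0.
have [phi [sphi uphi phi0 phi_far phi_near]] := conc _ e10.
have [F [sF [bF lF]]] := span_limit sphi.
have c2 : 0 < c / 2 by lra.
have [a a0 ha] := uphi _ c2.
have t0 : 0 < (c / 2) ^+ 2 * (e / 8) by rewrite mulr_gt0 ?exprn_gt0//; lra.
have [b b0 hb] := lF _ t0.
have [p hp] : exists p, subordinate p (Num.min a b).
  by apply: exists_subordinate; rewrite lt_min a0.
have hpb := hb p (subordinate_le (min_ler _ _) hp).
have hpa := subordinate_le (min_lel _ _) hp.
(* The total weight [C] is at least [c / 2], where [c] does not depend on how
   small [phi] is off the ball. *)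
pose C : R := \sum_i weight p i * phi (j (tp_tag p i)).
have CE : c / 2 <= C.
  have bphi := ucont_bmeas dmK Kc uphi.
  have : `|mean mu phi - C| <= c / 2.
    have [bm E] := mean_cells mu (fun i => phi (j (tp_tag p i))) (@tp_measurable p).
    rewrite /C -E -meanB; try exact: bmeas_rint.
    apply: norm_mean_le => [|k]; first by apply/bmeas_rint/bmeasB.
    exact/ltW/ha/hpa.
  have : c <= mean mu (phi : borel K -> R).
    have mb : measurable (mball dK zero eta' : set (borel K)).
      exact: (borel_open (open_mball dmK _ _)).
    have -> : c = mean mu (\1_(mball dK zero eta') : borel K -> R).
      by rewrite /c /mean /Rintegral integral_indic// setIT.
    apply: le_mean; [exact/bmeas_rint/bmeas_ind | exact: bmeas_rint|].
    move=> k; rewrite indicE; case: (boolP (_ \in _)) => [/set_mem h|_]; last exact: phi0.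
    exact: phi_near.
  by rewrite ler_norml; lra.
have C0 : 0 < C by lra.
pose w i := weight p i * phi (j (tp_tag p i)).
have w0 i : 0 <= w i by rewrite mulr_ge0 ?weight_ge0.
have bft t := cbmeas_act actc dm t f_bmeas.
have near : sqm (fun x => riemann p (character_family (fun k => (phi k)%:C)) x - C%:C * f x)
    <= C ^+ 2 * (e / 8).
  have -> : (fun x => riemann p (character_family (fun k => (phi k)%:C)) x - C%:C * f x) =
      (fun x => \sum_i (w i)%:C * (f (act (tp_tag p i) x) - f x)).
    apply/funext => x; rewrite /riemann /C.
    under [RHS]eq_bigr do rewrite mulrBr.
    rewrite sumrB -mulr_suml -rmorph_sum; congr (_ - _).
    by apply: eq_bigr => i _; rewrite /character_family /w rmorphM mulrA.
  apply: le_trans (sqmean_weighted_sum m w0 _) _; first by move=> i; exact: cbmeasB.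
  rewrite -/C expr2 -mulrA; apply: ler_wpM2l; first exact: ltW.
  apply: (@le_trans _ _ (\sum_i (w i * (e / 16) + weight p i * (e * c / 128 * 4)))).
    apply: ler_sum => i _; have [lt|ge] := ltP (dK zero (j (tp_tag p i))) eta.
      rewrite -[leLHS]addr0; apply: lerD.
        by apply: ler_wpM2l => //; apply/ltW/heta; rewrite -dist_zero.
      by rewrite mulr_ge0 ?weight_ge0//; lra.
    rewrite -[leLHS]add0r; apply: lerD; first by rewrite mulr_ge0//; lra.
    rewrite /w -mulrA; apply: ler_wpM2l; first exact: weight_ge0.
    apply: ler_pM => //; [exact: sqmean_ge0 | exact: phi_far|].
    rewrite (_ : 4 = 2 ^+ 2 :> R); last by ring.
    apply: sqmean_le => [|x]; first exact: cbmeasB.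
    apply: le_trans (normc_triangle _ _) _; rewrite normc_opp.
    by have := f_le1 x; have := f_le1 (act (tp_tag p i) x); lra.
  rewrite big_split/= -!mulr_suml sum_weight -/C mul1r.
  have : e * c <= e * (2 * C) by apply: ler_wpM2l; [exact: ltW | lra].
  lra.
have cC : (c / 2) ^+ 2 * (e / 8) <= C ^+ 2 * (e / 8).
  by apply: ler_wpM2r; [lra | rewrite ler_pXn2r// nnegrE; lra].
have bR := riemann_cbmeas p (family_bmeas (fun k => (phi k)%:C)).
have FC : sqm (fun x => C%:C * f x - F x) <= C ^+ 2 * (e / 2).
  have -> : (fun x => C%:C * f x - F x) = (fun x =>
      (- (riemann p (character_family (fun k => (phi k)%:C)) x - C%:C * f x)) +
      (riemann p (character_family (fun k => (phi k)%:C)) x - F x)).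
    by apply/funext => x; ring.
  apply: le_trans (sqmeanD m _ _) _.
  - have := cbmeasZ (-1) (cbmeasB bR (cbmeasZ (C%:C) f_bmeas)).
    by congr cbmeas; apply/funext => x; rewrite mulN1r.
  - exact: cbmeasB.
  by rewrite sqmeanN; lra.
exists (fun x => (C^-1)%:C * F x); split; first exact: lspanZ.
have -> : (fun x => f x - (C^-1)%:C * F x) = (fun x => (C^-1)%:C * (C%:C * f x - F x)).
  apply/funext => x; rewrite mulrBr mulrA -rmorphM mulVf ?lt0r_neq0// rmorph1 mul1r //.
rewrite sqmeanZ; last by apply: cbmeasB => //; exact: cbmeasZ.
rewrite normc_real ger0_norm ?invr_ge0 ?ltW//.
apply: (@le_lt_trans _ _ (C^-1 ^+ 2 * (C ^+ 2 * (e / 2)))).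
  by apply: ler_wpM2l => //; exact: sqr_ge0.
have C1 : C != 0 by rewrite gt_eqF.
have -> : C^-1 ^+ 2 * (C ^+ 2 * (e / 2)) = e / 2.
  by rewrite [LHS]mulrA -[X in X * _]exprMn mulVf// expr1n mul1r.
lra.
Qed.

End Orbit.

End OrbitIntegral.

(** * Discrete spectrum from approximation by eigenfunctions *)

Section DiscreteSpectrum.
Context (R : realType) (X : ptopologicalType) (G : topologicalZmodType).
Variables (act : G -> X -> X) (m : probability (borel X) R) (d : X -> X -> R).
Hypothesis Xc : compact [set: X].
Hypothesis actc : continuous_action act.
Hypothesis minv : invariant_measure act m.
Hypothesis dm : metric_inducing_topology d.
Local Notation Re := complex.Re.
Local Notation Im := complex.Im.
Local Notation normc := Normc.normc.
Local Notation BE := (bounded_eigenfunctions act m).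

Lemma dual_normc (gam : G -> Cplx R) t : dual gam -> normc (gam t) = 1.
Proof. by case=> _ /(_ t) + _; rewrite normrE => -[]. Qed.

Lemma dual1 : @dual R G (fun=> 1).
Proof.
split => [|t|s t]; first exact: cst_continuous.
- by rewrite normr1.
- by rewrite mulr1.
Qed.

Lemma cintegral_ae_meas (h k : borel X -> Cplx R) : cmeasurable h -> cmeasurable k ->
  {ae m, forall x, h x = k x} -> cintegral m h = cintegral m k.
Proof.
move=> [hr hi] [kr ki] hk; rewrite /cintegral /Rintegral.
congr (fine _ +i* fine _); apply: ae_eq_integral => //; try exact/measurable_EFinP.
  by apply: filterS hk => x /= -> _.
by apply: filterS hk => x /= -> _.
Qed.

Lemma cintegral_ae (h k : borel X -> Cplx R) : cbmeas h -> cbmeas k ->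
  {ae m, forall x, h x = k x} -> cintegral m h = cintegral m k.
Proof. by move=> bh bk; apply: cintegral_ae_meas; exact: cbmeas_measurable. Qed.

(** The inner product is invariant under the action, which multiplies it by
  [gam t] times the conjugate of [gam' t]. *)
Lemma eigenfunctions_orthogonal (gam gam' : G -> Cplx R) (f g : borel X -> Cplx R) :
  dual gam -> dual gam' -> gam <> gam' -> cbmeas f -> cbmeas g ->
  (forall t, {ae m, forall x : borel X, f (act t x) = gam t * f x}) ->
  (forall t, {ae m, forall x : borel X, g (act t x) = gam' t * g x}) ->
  L2inner m f g = 0.
Proof.
move=> h h' ne bf bg ef eg.
have [t tne] : exists t, gam t <> gam' t.
  apply: contrapT => /forallNP k; apply: ne; apply/funext => t.
  exact: contrapT (k t).
pose w := gam t * ((gam' t)^*)%C.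
have bfg : cbmeas (fun x => f x * ((g x)^*)%C) by apply: cbmeasM => //; exact: cbmeas_conj.
have wE : L2inner m f g = w * L2inner m f g.
  rewrite /L2inner -{1}(cintegral_act actc minv dm t (cbmeas_cint m bfg)).
  rewrite -cintegralZ; last exact: cbmeas_cint.
  apply: cintegral_ae.
  - exact: (cbmeas_act actc dm t bfg).
  - exact: cbmeasZ.
  by apply: filterS2 (ef t) (eg t) => x /= -> ->; rewrite /w rmorphM/=; ring.
have w1 : w <> 1.
  move=> w1; apply: tne; have := congr1 (fun z => z * gam' t) w1.
  by rewrite /w mul1r -mulrA [_^*%C * _]mulrC mulcJ (dual_normc t h') expr1n mulr1.
have : (1 - w) * L2inner m f g = 0 by rewrite mulrBl mul1r -wE subrr.
by move=> /eqP; rewrite mulf_eq0 subr_eq0 => /orP[/eqP/esym//|/eqP].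
Qed.

Lemma zero_bounded_eigenfunction : BE (fun=> 0).
Proof.
split; first exact: cbmeas_cst.
by exists (fun=> 1); [exact: dual1 | move=> t; apply: aeW => x; rewrite mulr0].
Qed.

(** The indicators of a countable pi-system are approximated by countably many
  eigenfunctions, which are then orthonormalised. *)
Lemma discrete_spectrum_of_approx :
  (forall A : set (borel X), measurable A -> approx m BE (cind R A)) ->
  discrete_spectrum act m.
Proof.
move=> hA; have [D [DI DT Dm DE]] := countable_pi_system dm Xc.
have P (q : nat * nat) : exists w : nat -> borel X -> Cplx R, (forall i, BE (w i)) /\
    exists N (c : 'I_N -> Cplx R),
      (sqnorm m (fun x => cind R (D q.1) x - \sum_(i < N) c i * w i x)%R < (q.2.+1%:R^-1)%:E)%E.
  have [_ /(_ (q.2.+1%:R^-1))[]] := hA _ (Dm q.1).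
    by rewrite invr_gt0 ltr0n.
  move=> g [/lspan_sum[N [c [e [eBE gE]]]] gq].
  exists (fun i => if insub i is Some o then e o else fun=> 0); split.
    by move=> i; case: insubP => [k _ _|_]; [exact: eBE | exact: zero_bounded_eigenfunction].
  exists N, c; rewrite (_ : (fun x => _) = (fun x => cind R (D q.1) x - g x))//.
  apply/funext => x; rewrite gE; congr (_ - _); apply: eq_bigr => i _.
  by rewrite valK.
have [W WP] := choice P.
pose e n : borel X -> Cplx R :=
  if unpickle n is Some q then W q.1 q.2 else fun=> 0.
have eBE n : BE (e n).
  by rewrite /e; case: unpickle => [q|]; [exact: (WP q.1).1 | exact: zero_bounded_eigenfunction].
have eb n : cbmeas (e n) by case: (eBE n).
pose I := {gam : G -> Cplx R | dual gam}.
pose V (i : I) : set (borel X -> Cplx R) :=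
  [set f | forall t, {ae m, forall x : borel X, f (act t x) = sval i t * f x}].
have Q n : exists i : I, V i (e n) by have [_ [g hg eg]] := eBE n; exists (exist _ g hg).
have [ix ixP] := choice Q.
have V0 (i : I) : V i (fun=> 0) by move=> t; apply: aeW => x; rewrite mulr0.
have V_lin (i : I) (c : Cplx R) f g : V i f -> V i g -> V i (fun x => f x + c * g x).
  move=> hf hg t; apply: filterS2 (hf t) (hg t) => x /= -> ->; ring.
have V_orth (i k : I) f g : i <> k -> V i f -> V k g -> cbmeas f -> cbmeas g ->
    L2inner m f g = 0.
  move=> ik hf hg bf bg; apply: (@eigenfunctions_orthogonal (sval i) (sval k)) => //.
  - exact: (svalP i).
  - exact: (svalP k).
  - move=> ikE; apply: ik; case: i k ikE {hf hg} => [i hi] [k hk] /= ik.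
    by move: hi; rewrite ik => hi; congr exist; exact: Prop_irrelevance.
have [E [EV E1 Eo Ea]] := gram_schmidt V0 V_lin V_orth eb ixP.
have EB : E `<=` @cmeasurable R _ (borel X).
  by move=> u /EV[bu _]; exact: cbmeas_measurable.
have Wa q i : approx m E (W q i).
  have := Ea (pickle (q, i)); rewrite /e pickleK; exact.
have Da n : approx m E (cind R (D n)).
  apply: approx_lim => //; first exact/cbmeas_measurable/cbmeas_cind.
  move=> z z0; have [k _ /(_ k (leqnn k)) /= hk] := near_infty_natSinv_lt (PosNum z0).
  have [_ [N [c h]]] := WP (n, k).
  exists (fun x => \sum_(i < N) c i * W (n, k) i x); split.
    by apply: approx_sum => // i; apply: approxZ.
  by apply: lt_trans h _; rewrite lte_fin.
have all A : measurable A -> approx m E (cind R A).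
  apply: (@approx_cind _ _ _ m E (range D)) => // _ [n _ <-]; exact: Da.
exists E.
- split => //; first by move=> u /EV[bu _]; exact: cbmeas_memL2.
  move=> f /(memL2_approx EB all)[mf h] z z0.
  have z2 : 0 < z ^+ 2 by rewrite exprn_gt0.
  have [g [/lspan_sum[N [c [u [Eu gE]]]] gz]] := h _ z2.
  exists N, c, u; split => //; apply/(L2norm_lt _ _ z0).
  rewrite (_ : (fun x => _) = (fun x => f x - g x))//.
  by apply/funext => x; rewrite gE.
- move=> u Eu; have [bu [[gam hgam] Vu]] := EV _ Eu; exists gam => //; split => //.
  + exact: cbmeas_memL2.
  + move=> u0; have := E1 _ Eu.
    rewrite /L2inner (@cintegral_ae _ (fun=> 0)).
    * by rewrite cintegral_cst => /eqP; rewrite eq_sym oner_eq0.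
    * by apply: cbmeasM => //; exact: cbmeas_conj.
    * exact: cbmeas_cst.
    * by apply: filterS u0 => x /= ->; rewrite mul0r.
Qed.

End DiscreteSpectrum.

Section DiscreteSpectrumHull.
Context (R : realType) (X : ptopologicalType) (G : topologicalZmodType).
Variables (act : G -> X -> X) (m : probability (borel X) R) (d : X -> X -> R).
Hypothesis Xc : compact [set: X].
Hypothesis actc : continuous_action act.
Hypothesis minv : invariant_measure act m.
Hypothesis dm : metric_inducing_topology d.
Context (K : ptopologicalType) (dK : K -> K -> R).
Hypothesis dmK : metric_inducing_topology dK.
Hypothesis Kc : compact [set: K].
Variables (add : K -> K -> K) (zero : K) (opp : K -> K).
Hypothesis gK : metric_group dK add zero opp.
Variable mu : probability (borel K) R.
Hypothesis muK : forall x (A : set (borel K)), measurable A ->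
  mu (add x @^-1` A) = mu A.
Variable j : G -> K.
Hypothesis jD : forall s t, j (s + t) = add (j s) (j t).
Hypothesis j_dense : forall k (e : R), 0 < e -> exists t, dK k (j t) < e.
Hypothesis j_iso : forall s t, dK (j s) (j t) = disp act m d (s - t).

Lemma discrete_spectrum_of_compact_group : discrete_spectrum act m.
Proof.
apply: (discrete_spectrum_of_approx Xc actc minv dm) => A mA.
have bA := cbmeas_cind R mA; split; first exact: cbmeas_measurable.
move=> e e0.
have A1 x : Normc.normc (cind R A x) <= 1.
  rewrite /cind normc_real indicE.
  by case: (x \in A); rewrite ?normr1 ?normr0.
have orb (z : R) : 0 < z -> exists2 del : R, 0 < del & forall t, disp act m d t < del ->
    sqmean m (fun x => cind R A (act t x) - cind R A x) < z.
  move=> z0; have [del del0 h] := orbit_continuous Xc actc minv dm mA z0.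
  exists del => // t /h; rewrite sqnorm_bounded ?lte_fin//.
  by apply: cbmeasB => //; exact: (cbmeas_act actc dm t bA).
have [g [sg h]] := approx_eigenfunctions Xc actc minv dm dmK Kc gK muK jD j_dense j_iso
  bA A1 orb e0.
exists g; split => //; rewrite sqnorm_bounded ?lte_fin//.
have bg : cbmeas g.
  elim: sg => [|F [//]|F F' _ ? _ ?|c F _ ?].
  - exact: cbmeas_cst.
  - exact: cbmeasD.
  - exact: cbmeasZ.
exact: cbmeasB.
Qed.

End DiscreteSpectrumHull.

(** * Almost periodicity from discrete spectrum *)

Lemma lspan_bigsum (R : realType) (K I : Type) (S : set (K -> Cplx R)) (s : seq I)
    (F : I -> K -> Cplx R) : (forall i, lspan S (F i)) ->
  lspan S (fun x => \sum_(i <- s) F i x).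
Proof.
move=> hF; elim: s => [|i s ih].
  rewrite (_ : (fun x => _) = fun=> 0); first exact: lspan0.
  by apply/funext => x; rewrite big_nil.
rewrite (_ : (fun x => _) = fun x => F i x + \sum_(k <- s) F k x); first exact: lspanD.
by apply/funext => x; rewrite big_cons.
Qed.

Section SquareIntegrable.
Context (R : realType) (dT : measure_display) (T : measurableType dT).
Variable P : probability T R.
Local Notation Re := complex.Re.
Local Notation Im := complex.Im.
Local Notation normc := Normc.normc.

Lemma rint_normc2 (u : T -> Cplx R) : cmeasurable u -> (sqnorm P u < +oo)%E ->
  rint P (fun x => normc (u x) ^+ 2).
Proof.
move=> mu uoo; apply/integrableP; split; first exact: measurable_sqnormc.
rewrite (_ : (\int[P]_x _)%E = sqnorm P u)//.
by apply: eq_integral => x _; rewrite /= ger0_norm ?sqr_ge0.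
Qed.

Lemma rint_le (f g : T -> R) : measurable_fun setT f -> rint P g ->
  (forall x, `|f x| <= g x) -> rint P f.
Proof.
move=> mf hg fg; apply: (le_integrable measurableT _ _ hg).
  exact/measurable_EFinP.
by move=> x _ /=; rewrite lee_fin; apply: le_trans (fg x) _; exact: ler_norm.
Qed.

Lemma cint_le (u : T -> Cplx R) (g : T -> R) : cmeasurable u -> rint P g ->
  (forall x, normc (u x) <= g x) -> cint P u.
Proof.
move=> [mr mi] hg ug; split; apply: (rint_le _ hg) => // x.
  exact: le_trans (le_Re_normc _) (ug x).
exact: le_trans (le_Im_normc _) (ug x).
Qed.

Lemma cint_cind (A : set T) (u : T -> Cplx R) : measurable A -> cmeasurable u ->
  (sqnorm P u < +oo)%E -> cint P (fun x => cind R A x * u x).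
Proof.
move=> mA mu uoo.
apply: (@cint_le _ (fun x => 1 + normc (u x) ^+ 2)).
- by apply: cmeasurableM => //; exact/cbmeas_measurable/cbmeas_cind.
- by apply: rintD; [exact: rint_cst | exact: rint_normc2].
move=> x; rewrite normc_mul /cind normc_real indicE.
have := normc_ge0 (u x); have := sqr_ge0 (normc (u x) - 1).
by case: (x \in A); rewrite ?normr1 ?normr0; move: (normc (u x)) => y; nra.
Qed.

(** This is the integral of [|u| <= k / 2 + |u|^2 / (2 k)]. *)
Lemma normc_cintegral_sqnorm (A : set T) (u : T -> Cplx R) (k : R) : measurable A ->
  cmeasurable u -> 0 < k -> (sqnorm P u < (k ^+ 2)%:E)%E ->
  normc (cintegral P (fun x => cind R A x * u x)) <= k.
Proof.
move=> mA mu k0 uk; have uoo : (sqnorm P u < +oo)%E by apply: lt_trans uk (ltry _).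
have hr := rint_normc2 mu uoo.
have hz : rint P (fun x => (2 * k)^-1 * normc (u x) ^+ 2) by exact: rintZ.
apply: (@le_trans _ _ (mean P (fun x => k / 2 + (2 * k)^-1 * normc (u x) ^+ 2))).
  apply: normc_cintegral_le; first exact: cint_cind.
    by apply: rintD => //; exact: rint_cst.
  move=> x; rewrite normc_mul /cind normc_real indicE.
  have n0 := normc_ge0 (u x).
  have E : k / 2 + (2 * k)^-1 * normc (u x) ^+ 2 - normc (u x) =
      (2 * k)^-1 * (normc (u x) - k) ^+ 2.
    by move: (normc _) => y; field; lra.
  have : 0 <= (2 * k)^-1 * (normc (u x) - k) ^+ 2.
    by rewrite mulr_ge0 ?sqr_ge0// invr_ge0; lra.
  by rewrite -E; case: (x \in A); rewrite ?normr1 ?normr0; lra.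
rewrite meanD//; last exact: rint_cst.
rewrite mean_cst meanZ//.
have : mean P (fun x => normc (u x) ^+ 2) <= k ^+ 2.
  have fu : sqnorm P u \is a fin_num by rewrite ge0_fin_numE// sqnorm_ge0.
  by move: uk; rewrite -[X in (X < _)%E]fineK// lte_fin => /ltW.
move: (mean _ _) => y hy.
have : (2 * k)^-1 * y <= (2 * k)^-1 * k ^+ 2.
  by apply: ler_wpM2l => //; rewrite invr_ge0; lra.
have -> : (2 * k)^-1 * k ^+ 2 = k / 2 by field; lra.
lra.
Qed.

End SquareIntegrable.

Section Displacement.
Context (R : realType) (X : ptopologicalType) (G : topologicalZmodType).
Variables (act : G -> X -> X) (m : probability (borel X) R) (d : X -> X -> R).
Hypothesis Xc : compact [set: X].
Hypothesis actc : continuous_action act.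
Hypothesis minv : invariant_measure act m.
Hypothesis dm : metric_inducing_topology d.
Local Notation Re := complex.Re.
Local Notation Im := complex.Im.
Local Notation normc := Normc.normc.
Local Notation disp := (disp act m d).

Lemma sqnorm_span_lty (E : set (borel X -> Cplx R)) g : E `<=` memL2 m -> lspan E g ->
  cmeasurable g /\ (sqnorm m g < +oo)%E.
Proof.
move=> EL; elim => [|f /EL[mf /L2norm_lty]//|f f' _ [mf fo] _ [mf' fo']|c f _ [mf fo]].
- by split; [exact: cmeasurable_cst | rewrite sqnorm0].
- split; first exact: cmeasurableD.
  apply: le_lt_trans (sqnormD _ mf mf') _; rewrite lte_add_pinfty//;
    by rewrite lte_mul_pinfty// lee_fin.
- split; first exact: cmeasurableZ.
  by rewrite sqnormZ// lte_mul_pinfty// lee_fin sqr_ge0.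
Qed.

(** Correlating an eigenfunction with a fixed function along an orbit gives a
  multiple of its eigenvalue. *)
Lemma correlation_span (E : set (borel X -> Cplx R)) (A : set (borel X)) g :
  E `<=` memL2 m -> (forall e, E e -> exists2 gam, dual gam & eigenfunction act m gam e) ->
  measurable A -> lspan E g ->
  lspan (eigenvalues act m) (fun t => cintegral m (fun x => cind R A x * g (act t x))).
Proof.
move=> EL Ee mA sg.
have int u t : lspan E u -> cint m (fun x => cind R A x * u (act t x)).
  move=> /(sqnorm_span_lty EL)[mu uoo]; apply: cint_cind => //.
    exact: (cmeasurable_act actc dm t mu).
  by rewrite (sqnorm_act actc minv dm t mu).
elim: sg => [|e he|f f' sf hf sf' hf'|c f sf hf].
- rewrite (_ : (fun t => _) = fun=> 0); first exact: lspan0.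
  apply/funext => t; rewrite -[RHS](cintegral_cst m); congr cintegral.
  by apply/funext => x; rewrite mulr0.
- have [gam hg eg] := Ee _ he; have [me _ ee] := eg.
  rewrite (_ : (fun t => _) = fun t =>
      cintegral m (fun x => cind R A x * e x) * gam t).
    by apply: lspanZ; apply: lspan_base; split => //; exists e.
  apply/funext => t; rewrite mulrC.
  have [_ eoo] := me; have /L2norm_lty eoo' := eoo.
  rewrite -cintegralZ; last by apply: cint_cind => //; case: me.
  have mea := cmeasurable_act actc dm t me.1.
  have mA' := cbmeas_measurable (cbmeas_cind R mA).
  apply: cintegral_ae_meas.
  + exact: cmeasurableM.
  + by apply/cmeasurableZ/cmeasurableM => //; case: me.
  + have [B [mB B0 sB]] := ee t; exists B; split => // x nx; apply: sB => /= ex.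
    by apply: nx; rewrite /= ex mulrCA.
- rewrite (_ : (fun t => _) = fun t => cintegral m (fun x => cind R A x * f (act t x)) +
    cintegral m (fun x => cind R A x * f' (act t x))); first exact: lspanD.
  apply/funext => t; rewrite -cintegralD; try exact: int.
  by congr cintegral; apply/funext => x; rewrite mulrDr.
- rewrite (_ : (fun t => _) = fun t => c * cintegral m (fun x => cind R A x * f (act t x))).
    exact: lspanZ.
  apply/funext => t; rewrite -cintegralZ; last exact: int.
  by congr cintegral; apply/funext => x; rewrite mulrCA.
Qed.

(** [d x y] is uniformly close to [\sum_l 1_{A_l} x * d c_l y] for a partition
  [A_l] into small cells, and the functions [d c_l] are close to combinations of
  eigenfunctions. *)
Lemma disp_approx (e : R) : discrete_spectrum act m -> 0 < e ->
  exists Q, lspan (eigenvalues act m) Q /\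
    forall t, normc ((disp t)%:C - Q t) <= e.
Proof.
move=> [E [EL E1 Eo Ed] Ee] e0; have e4 : 0 < e / 4 by lra.
have [n [c [cell [hc mc]]]] := measurable_cells dm Xc e4.
pose N := n.+1; pose k := e / (4 * N%:R).
have N0 : 0 < N%:R :> R by rewrite ltr0n.
have k0 : 0 < k by rewrite divr_gt0// mulr_gt0.
pose h (l : 'I_N) : borel X -> R := fun y => d (c l) y.
have bh l : bmeas (h l).
  rewrite /h (_ : (fun y => _) = fun y => d y (c l)); last first.
    by apply/funext => y; rewrite (d_sym dm).
  exact: (ucont_bmeas dm Xc (ucont_dist dm (c l))).
have P (l : 'I_N) : exists g, lspan E g /\ (sqnorm m (fun x => (h l x)%:C - g x)%R < (k ^+ 2)%:E)%E.
  have [M [cc [u [Eu hu]]]] := Ed _ (cbmeas_memL2 m (cbmeas_real (bh l))) _ k0.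
  exists (fun x => \sum_(i < M) cc i * u i x); split; last exact/(L2norm_lt _ _ k0).
  by apply: lspan_bigsum => i; apply/lspanZ/lspan_base.
have [g gP] := choice P.
pose A l : set (borel X) := cell @^-1` [set l].
pose Q t := \sum_l cintegral m (fun x => cind R (A l) x * g l (act t x)).
exists Q; split.
  by apply: lspan_bigsum => l; apply: (correlation_span EL Ee) => //; [exact: mc | case: (gP l)].
move=> t.
have bht l : bmeas (fun x : borel X => h l (act t x)).
  have [mh [M hM]] := bh l; split; last by exists M => x; exact: hM.
  exact: (measurableT_comp mh (act_measurable actc dm t)).
have bA l : cbmeas (fun x => cind R (A l) x * (h l (act t x))%:C).
  by apply: cbmeasM; [exact: (cbmeas_cind R (mc l)) | exact: cbmeas_real].
pose H := \sum_l cintegral m (fun x => cind R (A l) x * (h l (act t x))%:C).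
have h1 : normc ((disp t)%:C - H) <= e / 4.
  have dE : (disp t)%:C = cintegral m (fun x : borel X => (d x (act t x))%:C).
    by rewrite cintegralE /= mean_cst.
  have bd := disp_bmeas Xc actc dm t.
  rewrite dE /H -cintegral_sum; last by move=> l; exact: cbmeas_cint.
  rewrite -cintegralB; last 2 first.
  - exact/cbmeas_cint/cbmeas_real.
  - by apply: cint_sum => l; exact: cbmeas_cint.
  rewrite -[leRHS](mean_cst m); apply: normc_cintegral_le.
  - apply/cbmeas_cint/cbmeasB; first exact: cbmeas_real.
    exact: cbmeas_sum.
  - exact: rint_cst.
  move=> x; rewrite (bigD1 (cell x))//= big1 ?addr0; last first.
    move=> l lx; rewrite /cind indicE memNset ?rmorph0 ?mul0r// => /= xl.
    by rewrite xl eqxx in lx.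
  rewrite /cind indicE mem_set// rmorph1 mul1r -rmorphB normc_real /h.
  apply: le_trans (d_lip dm _ _ _ _) _.
  by rewrite (dxx dm) addr0 (d_sym dm) ltW.
have h2 : normc (H - Q t) <= e / 4.
  rewrite /H /Q -sumrB; apply: le_trans (normc_sum _ _ _) _.
  have -> : e / 4 = \sum_(l : 'I_N) k.
    by rewrite sumr_const card_ord -[RHS]mulr_natl /k; field; lra.
  apply: ler_sum => l _; have [sg gk] := gP l.
  have [mg goo] := sqnorm_span_lty EL sg.
  have mgt := cmeasurable_act actc dm t mg.
  rewrite -cintegralB; last 2 first.
  - exact: cbmeas_cint.
  - apply: cint_cind => //; first exact: mc.
    by rewrite (sqnorm_act actc minv dm t mg).
  have mhg : cmeasurable (fun x => (h l x)%:C - g l x).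
    by apply: cmeasurableB => //; exact/cbmeas_measurable/cbmeas_real.
  have := @normc_cintegral_sqnorm _ _ _ m (A l) (fun x => (h l (act t x))%:C - g l (act t x))
    k (mc l).
  rewrite (_ : (fun x => cind R (A l) x * _) = (fun x => cind R (A l) x * (h l (act t x))%:C -
    cind R (A l) x * g l (act t x))); last by apply/funext => x; rewrite mulrBr.
  apply => //; first exact: (cmeasurable_act actc dm t mhg).
  by rewrite (sqnorm_act actc minv dm t mhg).
have := normc_triangle ((disp t)%:C - H) (H - Q t).
by rewrite addrA subrK; lra.
Qed.

End Displacement.

Section AlmostPeriodic.
Context (R : realType) (G : topologicalZmodType).
Local Notation Re := complex.Re.
Local Notation Im := complex.Im.
Local Notation normc := Normc.normc.

(** The colour of [t] is the cell of a square grid that contains [gam t]. *)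
Lemma dual_colouring (gam : G -> Cplx R) (e : R) : dual gam -> 0 < e ->
  exists (J : finType) (col : G -> J), forall s t, col s = col t ->
    normc (gam s - gam t) <= e.
Proof.
move=> hg e0; have g1 t : normc (gam t) = 1.
  by case: hg => _ /(_ t) + _; rewrite normrE => -[].
have [M _ /(_ M (leqnn M)) /= hM] : \forall n \near \oo, n.+1%:R^-1 < e / 2.
  have e2 : 0 < e / 2 by lra.
  exact: (near_infty_natSinv_lt (PosNum e2)).
have M0 : 0 < M.+1%:R :> R by rewrite ltr0n.
pose q (x : R) : 'I_(2 * M.+1).+1 := inord (Num.truncn (M.+1%:R * (x + 1))).
have qP (x y : R) : `|x| <= 1 -> `|y| <= 1 -> q x = q y -> `|x - y| <= M.+1%:R^-1.
  have H (z : R) : `|z| <= 1 -> 0 <= M.+1%:R * (z + 1) /\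
      (Num.truncn (M.+1%:R * (z + 1)) < (2 * M.+1).+1)%N.
    rewrite ler_norml => /andP[z1 z2].
    have z0 : 0 <= M.+1%:R * (z + 1) by rewrite mulr_ge0// ?ler0n//; lra.
    split => //; rewrite ltnS -(ler_nat R).
    apply: (@le_trans _ _ (M.+1%:R * (z + 1))); first by rewrite truncn_le.
    rewrite natrM mulrC; apply: ler_wpM2r; [exact: ltW | lra].
  move=> /H[x0 xl] /H[y0 yl] /(congr1 val); rewrite /= !inordK// => xy.
  have /andP[x1 x2] := truncn_itv x0; have /andP[y1 y2] := truncn_itv y0.
  suff : M.+1%:R * `|x - y| <= 1 by rewrite -ler_pdivlMl// mulr1.
  have -> : M.+1%:R * `|x - y| = `|M.+1%:R * (x + 1) - M.+1%:R * (y + 1)|.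
    by rewrite -mulrBr opprD addrACA subrr addr0 normrM gtr0_norm.
  by move: x1 x2 y1 y2; rewrite ler_norml xy -natr1; lra.
exists ('I_(2 * M.+1).+1 * 'I_(2 * M.+1).+1)%type, (fun t => (q (Re (gam t)), q (Im (gam t)))).
move=> s t [hr hi]; apply: le_trans (normc_le_ReIm _) _; rewrite ReB ImB.
have r1 u : `|Re (gam u)| <= 1 by rewrite -(g1 u) le_Re_normc.
have i1 u : `|Im (gam u)| <= 1 by rewrite -(g1 u) le_Im_normc.
have := qP _ _ (r1 s) (r1 t) hr; have := qP _ _ (i1 s) (i1 t) hi.
by move: hM; move: (M.+1%:R^-1) => z; lra.
Qed.

(** The translates of [Q] form a totally bounded set for the supremum norm,
  which survives uniform limits and yields almost periodicity. *)
Lemma span_colouring (S : set (G -> Cplx R)) Q (e : R) : S `<=` @dual R G ->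
  lspan S Q -> 0 < e ->
  exists (J : finType) (col : G -> J), forall s t, col s = col t ->
    forall u, normc (Q (s + u) - Q (t + u)) <= e.
Proof.
move=> SD sQ; elim: sQ e => [|gam /SD hg|F F' _ ih _ ih'|c F _ ih] e e0.
- exists unit, (fun=> tt) => s t _ u.
  by rewrite subrr normc_zero ltW.
- have [J [col h]] := dual_colouring hg e0; exists J, col => s t /h st u.
  have [_ _ gM] := hg; rewrite !gM -mulrBl normc_mul.
  suff -> : normc (gam u) = 1 by rewrite mulr1.
  by case: hg => _ /(_ u) + _; rewrite normrE => -[].
- have e2 : 0 < e / 2 by lra.
  have [J [col h]] := ih _ e2; have [J' [col' h']] := ih' _ e2.
  exists (J * J')%type, (fun t => (col t, col' t)) => s t [st st'] u.
  rewrite opprD addrACA; apply: le_trans (normc_triangle _ _) _.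
  by have := h _ _ st u; have := h' _ _ st' u; lra.
- have c0 : 0 < normc c + 1 by rewrite ltr_wpDl ?normc_ge0.
  have [J [col h]] := ih _ (divr_gt0 e0 c0); exists J, col => s t /h st u.
  rewrite -mulrBr normc_mul; have := st u; rewrite ler_pdivlMr// => st'.
  apply: le_trans st'; rewrite mulrC; apply: ler_wpM2l; first exact: normc_ge0.
  by rewrite lerDl.
Qed.

Lemma almost_periodic_of_span (S : set (G -> Cplx R)) (F : G -> Cplx R) :
  S `<=` @dual R G -> group_uniformly_continuous F ->
  (forall e : R, 0 < e -> exists Q, lspan S Q /\ forall t, normc (F t - Q t) <= e) ->
  almost_periodic F.
Proof.
move=> SD uF hF; split => // e e0; have e3 : 0 < e / 3 by lra.
have [Q [sQ FQ]] := hF _ e3; have [J [col hcol]] := span_colouring SD sQ e3.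
(* A representative of each colour that occurs. *)
pose rep c : G := if pselect (exists t, col t = c) is left h then sval (cid h) else 0.
have repP t : col (rep (col t)) = col t.
  rewrite /rep; case: pselect => [h|[]]; last by exists t.
  by case: cid.
exists (range rep); first exact: finite_compact (finite_image _ finite_finset).
apply/seteqP; split => // t _; exists (t - rep (col t)); last first.
  by exists (rep (col t)); [by exists (col t) | rewrite subrK].
move=> s /=; have := hcol _ _ (esym (repP t)) (s - rep (col t)).
rewrite addrA addrAC [X in _ - Q X]addrC subrK => h.
have h1 := FQ (t - rep (col t) + s); have h2 := FQ s; rewrite normc_distC in h2.
have := normc_triangle (F (t - rep (col t) + s) - Q (t - rep (col t) + s))
  (Q (t - rep (col t) + s) - F s).
have := normc_triangle (Q (t - rep (col t) + s) - Q s) (Q s - F s).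
by rewrite !addrA !subrK; lra.
Qed.

End AlmostPeriodic.

Section DiscreteToAlmostPeriodic.
Context (R : realType) (X : ptopologicalType) (G : topologicalZmodType).
Variables (act : G -> X -> X) (m : probability (borel X) R) (d : X -> X -> R).
Hypothesis Xc : compact [set: X].
Hypothesis actc : continuous_action act.
Hypothesis minv : invariant_measure act m.
Hypothesis dm : metric_inducing_topology d.
Local Notation disp := (disp act m d).

Lemma disp_group_uniformly_continuous :
  group_uniformly_continuous (fun t => (disp t)%:C : Cplx R).
Proof.
move=> e e0; have := disp_continuous0 m Xc actc dm e0.
apply: filterS => u hu t; rewrite -rmorphB normc_real.
apply: le_lt_trans (disp_lip Xc actc minv dm _ _) _.
by rewrite addrAC subrr add0r.
Qed.

Lemma discrete_spectrum_almost_periodic : discrete_spectrum act m ->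
  almost_periodic (fun t => (disp t)%:C : Cplx R).
Proof.
move=> ds; apply: (@almost_periodic_of_span _ _ (eigenvalues act m)).
- by move=> gam [].
- exact: disp_group_uniformly_continuous.
- by move=> e e0; exact: (disp_approx Xc actc minv dm ds e0).
Qed.

End DiscreteToAlmostPeriodic.

(** * Frequencies of the displacement and eigenvalues *)

Section Extension.
Context (R : realType) (G : topologicalZmodType).
Context (K : ptopologicalType) (dK : K -> K -> R).
Hypothesis dmK : metric_inducing_topology dK.
Variables (add : K -> K -> K) (zero : K) (opp : K -> K).
Hypothesis gK : metric_group dK add zero opp.
Variable j : G -> K.
Hypothesis jD : forall s t, j (s + t) = add (j s) (j t).
Hypothesis j_dense : forall k (e : R), 0 < e -> exists t, dK k (j t) < e.
Local Notation Re := complex.Re.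
Local Notation Im := complex.Im.
Local Notation normc := Normc.normc.

(** The value at [k] is the ultrafilter limit of the values along a sequence
  that tends to [k] in the dense subgroup. *)
Lemma extend_real (u : G -> R) (M : R) : (forall t, `|u t| <= M) ->
  (forall e : R, 0 < e -> exists2 del : R, 0 < del &
    forall s t, dK (j s) (j t) < del -> `|u s - u t| < e) ->
  exists U : K -> R, forall e : R, 0 < e -> exists2 del : R, 0 < del &
    forall k t, dK k (j t) < del -> `|U k - u t| < e.
Proof.
move=> uM uc.
have P (q : K * nat) : exists t, dK q.1 (j t) < q.2.+1%:R^-1.
  by apply: j_dense; rewrite invr_gt0 ltr0n.
have [rep repP] := choice P.
have b k : bounded_seq (fun n => u (rep (k, n))) by exists M => n; exact: uM.
exists (fun k => ulim (fun n => u (rep (k, n)))) => e e0.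
have e2 : 0 < e / 2 by lra.
have [del del0 h] := uc _ e2; have del2 : 0 < del / 2 by lra.
exists (del / 2) => // k t kt.
have n1 := ulim_near (b k) e2.
have n2 := near_ultra (near_infty_natSinv_lt (PosNum del2)).
have [n [hn1 hn2]] := @filter_ex _ _ _ _ (filterI n1 n2).
have := repP (k, n); rewrite /= in hn2 * => hr.
have : `|u (rep (k, n)) - u t| < e / 2.
  apply: h; apply: le_lt_trans (d_tri dmK _ k _) _.
  by rewrite (d_sym dmK _ k); move: hn2 hr; move: (n.+1%:R^-1) => z /=; lra.
by move: hn1 => /=; rewrite !ltr_norml; lra.
Qed.

Lemma add_dist x y x' y' : dK (add x y) (add x' y') <= dK x x' + dK y y'.
Proof.
apply: le_trans (d_tri dmK _ (add x' y) _) _.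
by rewrite (gdist_r gK) (mg_dist gK).
Qed.

(** Real and imaginary part are extended separately; modulus and multiplicativity
  pass to the extension by density. *)
Lemma extend_dual (gam : G -> Cplx R) : dual gam ->
  (forall e : R, 0 < e -> exists2 del : R, 0 < del &
    forall t, dK zero (j t) < del -> normc (gam t - 1) < e) ->
  exists2 chi, mchar dK add chi & forall t, chi (j t) = gam t.
Proof.
move=> hg gc; have g1 t := dual_normc t hg; have [_ _ gM] := hg.
have uc (e : R) : 0 < e -> exists2 del : R, 0 < del &
    forall s t, dK (j s) (j t) < del -> normc (gam s - gam t) < e.
  move=> e0; have [del del0 h] := gc _ e0; exists del => // s t st.
  have -> : gam s - gam t = (gam (s - t) - 1) * gam t.
    by rewrite mulrBl -gM subrK mul1r.
  rewrite normc_mul g1 mulr1; apply: h.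
  rewrite -(mg_dist gK (j t)) -jD addrC subrK (mg_addC gK) (mg_add0 gK).
  by rewrite (d_sym dmK).
have [||U hU] := @extend_real (fun t => Re (gam t)) 1.
- by move=> t; rewrite -(g1 t) le_Re_normc.
- move=> e /uc[del del0 h]; exists del => // s t /h; apply: le_lt_trans.
  by rewrite -ReB le_Re_normc.
have [||V hV] := @extend_real (fun t => Im (gam t)) 1.
- by move=> t; rewrite -(g1 t) le_Im_normc.
- move=> e /uc[del del0 h]; exists del => // s t /h; apply: le_lt_trans.
  by rewrite -ImB le_Im_normc.
pose chi k : Cplx R := U k +i* V k.
have near (e : R) : 0 < e -> exists2 del : R, 0 < del &
    forall k t, dK k (j t) < del -> normc (chi k - gam t) < e.
  move=> e0; have e2 : 0 < e / 2 by lra.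
  have [a a0 ha] := hU _ e2; have [b b0 hb] := hV _ e2.
  exists (Num.min a b); first by rewrite lt_min a0.
  move=> k t; rewrite lt_min => /andP[/ha h1 /hb h2].
  by apply: le_lt_trans (normc_le_ReIm _) _; rewrite ReB ImB/=; lra.
have ext t : chi (j t) = gam t.
  apply/eqP; rewrite -subr_eq0; apply/eqP/normc_eq0P/eqP.
  rewrite eq_le normc_ge0 andbT; apply/ler_addgt0Pr => e e0; rewrite add0r.
  by have [del del0 h] := near _ e0; apply/ltW/h; rewrite (dxx dmK).
have chiU (e : R) : 0 < e -> exists2 del : R, 0 < del &
    forall x y, dK x y < del -> normc (chi x - chi y) < e.
  move=> e0; have e2 : 0 < e / 2 by lra.
  have [del del0 h] := near _ e2; have del2 : 0 < del / 2 by lra.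
  exists (del / 2) => // x y xy; have [t ty] := j_dense y del2.
  have h1 : normc (chi x - gam t) < e / 2.
    by apply: h; apply: le_lt_trans (d_tri dmK _ y _) _; lra.
  have h2 : normc (chi y - gam t) < e / 2 by apply: h; lra.
  have := normc_triangle (chi x - gam t) (gam t - chi y).
  by rewrite addrA subrK [X in _ <= _ + X]normc_distC; lra.
exists chi => //; split.
- move=> e /chiU[del del0 h]; exists del => // x y /h; apply: le_lt_trans.
  by rewrite -ReB le_Re_normc.
- move=> e /chiU[del del0 h]; exists del => // x y /h; apply: le_lt_trans.
  by rewrite -ImB le_Im_normc.
- move=> x; apply/eqP; rewrite -subr_eq0 -normr_le0; apply/ler_addgt0Pr => e e0.
  rewrite add0r; have [del del0 h] := near _ e0; have [t tx] := j_dense x del0.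
  have {}h := h _ _ tx.
  have := normc_triangle (chi x - gam t) (gam t); rewrite subrK g1.
  have := normc_triangle (gam t - chi x) (chi x); rewrite subrK g1 normc_distC.
  by rewrite ler_norml; lra.
- have chi_le x : normc (chi x) <= 2.
    have [del del0 h] := near 1 ltr01; have [t tx] := j_dense x del0.
    have := normc_triangle (chi x - gam t) (gam t); rewrite subrK g1.
    by have := h _ _ tx; lra.
  move=> x y; apply/eqP; rewrite -subr_eq0; apply/eqP/normc_eq0P/eqP.
  rewrite eq_le normc_ge0 andbT; apply/ler_addgt0Pr => e e0; rewrite add0r.
  have e4 : 0 < e / 4 by lra.
  have [del del0 h] := near _ e4; have del2 : 0 < del / 2 by lra.
  have [s sx] := j_dense x del2; have [t ty] := j_dense y del2.
  have h1 : normc (chi x - gam s) < e / 4 by apply: h; lra.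
  have h2 : normc (chi y - gam t) < e / 4 by apply: h; lra.
  have h3 : normc (chi (add x y) - gam (s + t)) < e / 4.
    by apply: h; rewrite jD; apply: le_lt_trans (add_dist _ _ _ _) _; lra.
  have -> : chi (add x y) - chi x * chi y = (chi (add x y) - gam (s + t)) +
      ((gam s - chi x) * gam t + chi x * (gam t - chi y)) by rewrite gM; ring.
  apply: le_trans (normc_triangle _ _) _.
  have := normc_triangle ((gam s - chi x) * gam t) (chi x * (gam t - chi y)).
  rewrite !normc_mul g1 mulr1 (normc_distC (gam s)) (normc_distC (gam t)).
  have : normc (chi x) * normc (chi y - gam t) <= 2 * (e / 4).
    by apply: ler_pM; rewrite ?normc_ge0 ?chi_le// ltW.
  lra.
Qed.

End Extension.

Section Frequencies.
Context (R : realType) (X : ptopologicalType) (G : topologicalZmodType).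
Variables (act : G -> X -> X) (m : probability (borel X) R) (d : X -> X -> R).
Hypothesis Xc : compact [set: X].
Hypothesis actc : continuous_action act.
Hypothesis minv : invariant_measure act m.
Hypothesis dm : metric_inducing_topology d.
Context (K : ptopologicalType) (dK : K -> K -> R).
Hypothesis dmK : metric_inducing_topology dK.
Hypothesis Kc : compact [set: K].
Variables (add : K -> K -> K) (zero : K) (opp : K -> K).
Hypothesis gK : metric_group dK add zero opp.
Variable mu : probability (borel K) R.
Hypothesis muK : forall x (A : set (borel K)), measurable A ->
  mu (add x @^-1` A) = mu A.
Variable j : G -> K.
Hypothesis jD : forall s t, j (s + t) = add (j s) (j t).
Hypothesis j_dense : forall k (e : R), 0 < e -> exists t, dK k (j t) < e.
Hypothesis j_iso : forall s t, dK (j s) (j t) = disp act m d (s - t).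
Local Notation Re := complex.Re.
Local Notation Im := complex.Im.
Local Notation normc := Normc.normc.
Local Notation disp := (disp act m d).
Local Notation mchar := (mchar dK add).

(** On the hull this is the evaluation at 0, whose Fourier coefficients
  define the frequencies. *)
Definition dist0 (k : K) : Cplx R := (dK k zero)%:C.

Let dist0_ucont : ucont dK (fun k => dK k zero) := ucont_dist dmK zero.

Lemma dist0_cbmeas : cbmeas (dist0 : borel K -> Cplx R).
Proof. exact/cbmeas_real/(ucont_bmeas dmK Kc dist0_ucont). Qed.

Lemma dist0_j t : dist0 (j t) = (disp t)%:C.
Proof. by rewrite /dist0 -(j0 gK jD) j_iso subr0. Qed.

Definition coefficient chi : Cplx R :=
  cintegral mu (fun k : borel K => dist0 k * ((chi k)^*)%C).

Lemma extend_eigenvalue (gam : G -> Cplx R) : eigenvalues act m gam ->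
  exists2 chi, mchar chi & forall t, chi (j t) = gam t.
Proof.
move=> [hg [f ef]]; apply: (extend_dual dmK gK jD j_dense hg) => e e0.
have [del del0 h] := eigenvalue_ucont Xc actc minv dm (fun t => dual_normc t hg) ef e0.
exists del => // t; rewrite (dist_zero Xc actc minv dm gK jD j_iso); exact: h.
Qed.

Lemma span_mchar_ucont phi (e : R) : lspan [set chi | mchar chi] phi -> 0 < e ->
  exists2 del : R, 0 < del & forall x y, dK x y < del -> normc (phi x - phi y) < e.
Proof.
move=> sphi; elim: sphi e => [|chi hchi|f f' _ ih _ ih'|c f _ ih] e e0.
- by exists 1 => // x y _; rewrite subrr normc_zero.
- exact: (mchar_ucont hchi e0).
- have e2 : 0 < e / 2 by lra.
  have [a a0 ha] := ih _ e2; have [b b0 hb] := ih' _ e2.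
  exists (Num.min a b); first by rewrite lt_min a0.
  move=> x y; rewrite lt_min => /andP[/ha h1 /hb h2].
  rewrite opprD addrACA; apply: le_lt_trans (normc_triangle _ _) _; lra.
- have c0 : 0 < normc c + 1 by rewrite ltr_wpDl ?normc_ge0.
  have [a a0 ha] := ih _ (divr_gt0 e0 c0); exists a => // x y /ha.
  rewrite ltr_pdivlMr// => h; rewrite -mulrBr normc_mul.
  apply: le_lt_trans h; rewrite mulrC; apply: ler_wpM2l; first exact: normc_ge0.
  by rewrite lerDl.
Qed.

Lemma span_mchar_cbmeas (S : set (K -> Cplx R)) phi : S `<=` mchar -> lspan S phi ->
  cbmeas (phi : borel K -> Cplx R).
Proof.
move=> SM; elim => [|chi /SM hchi|f f' _ ? _ ?|c f _ ?].
- exact: cbmeas_cst.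
- exact: (mchar_cbmeas dmK Kc hchi).
- exact: cbmeasD.
- exact: cbmeasZ.
Qed.

Lemma span_orthogonal (S : set (K -> Cplx R)) phi chi : S `<=` mchar -> mchar chi ->
  ~ S chi -> lspan S phi ->
  cintegral mu (fun k : borel K => phi k * ((chi k)^*)%C) = 0.
Proof.
move=> SM hchi nS sphi.
have hc := mchar_cbmeas dmK Kc (mchar_conj hchi).
elim: sphi => [|psi hpsi|f f' sf hf sf' hf'|c f sf hf].
- rewrite -[RHS](cintegral_cst mu); congr cintegral.
  by apply/funext => k; rewrite mul0r.
- have [x xne] : exists x, psi x <> chi x.
    apply: contrapT => /forallNP h; apply: nS; suff <- : psi = chi by [].
    by apply/funext => x; exact: contrapT (h x).
  apply: (mchar_orthogonal dmK Kc gK muK (x0 := x)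
    (mcharM dmK Kc (SM _ hpsi) (mchar_conj hchi))) => h.
  apply: xne; have [_ _ chi1 _] := hchi.
  have := congr1 (fun z => z * chi x) h.
  by rewrite /= mul1r -mulrA [_^*%C * _]mulrC mulcJ chi1 expr1n mulr1.
- rewrite -[RHS]addr0 -{1}hf -hf' -cintegralD.
  + by congr cintegral; apply/funext => k; rewrite mulrDl.
  + by apply/cbmeas_cint/cbmeasM => //; exact: (span_mchar_cbmeas SM).
  + by apply/cbmeas_cint/cbmeasM => //; exact: (span_mchar_cbmeas SM).
- rewrite -[RHS](mulr0 c) -hf -cintegralZ.
  + by congr cintegral; apply/funext => k; rewrite mulrA.
  + by apply/cbmeas_cint/cbmeasM => //; exact: (span_mchar_cbmeas SM).
Qed.

(** The displacement is a uniform limit of combinations of eigenvalues, hence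
  orthogonal to all other characters. *)
Lemma frequency_eigenvalue chi : discrete_spectrum act m -> mchar chi ->
  coefficient chi <> 0 -> eigenvalues act m (chi \o j).
Proof.
move=> ds hchi; apply: contra_notP => ne.
pose S := [set psi | mchar psi /\ eigenvalues act m (psi \o j)].
have SM : S `<=` mchar by move=> psi [].
have nS : ~ S chi by move=> [_ /ne].
have ext Q : lspan (eigenvalues act m) Q -> exists2 phi, lspan S phi &
    forall t, phi (j t) = Q t.
  elim => [|gam hg|F F' _ [f sf fE] _ [f' sf' fE']|c F _ [f sf fE]].
  - by exists (fun=> 0) => //; exact: lspan0.
  - have [psi hpsi psiE] := extend_eigenvalue hg; exists psi => //.
    by apply: lspan_base; split => //; rewrite (_ : _ \o _ = gam)//; apply/funext.
  - by exists (fun k => f k + f' k) => [|t]; [exact: lspanD | rewrite fE fE'].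
  - by exists (fun k => c * f k) => [|t]; [exact: lspanZ | rewrite fE].
apply/normc_eq0P/eqP; rewrite eq_le normc_ge0 andbT; apply/ler_addgt0Pr => e e0.
rewrite add0r; have e4 : 0 < e / 4 by lra.
have [Q [sQ hQ]] := disp_approx Xc actc minv dm ds e4.
have [phi sphi phiE] := ext _ sQ.
have close k : normc (dist0 k - phi k) <= e.
  have sphi' : lspan [set chi | mchar chi] phi.
    elim: sphi {phiE} => [|psi /SM hp|f f' _ ? _ ?|c f _ ?].
    - exact: lspan0.
    - exact: lspan_base.
    - exact: lspanD.
    - exact: lspanZ.
  have [del del0 h] := span_mchar_ucont sphi' e4.
  have [t] : exists t, dK k (j t) < Num.min del (e / 4).
    by apply: j_dense; rewrite lt_min del0.
  rewrite lt_min => /andP[kt kt'].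
  have h1 := h _ _ kt; have h2 := hQ t.
  have h3 : normc (dist0 k - dist0 (j t)) <= e / 4.
    rewrite /dist0 -rmorphB normc_real; apply: le_trans (d_lip dmK _ _ _ _) _.
    by rewrite (dxx dmK) addr0 ltW.
  have -> : dist0 k - phi k = (dist0 k - dist0 (j t)) +
      (((disp t)%:C - Q t) + (phi (j t) - phi k)).
    by rewrite dist0_j phiE; ring.
  apply: le_trans (normc_triangle _ _) _.
  have := normc_triangle ((disp t)%:C - Q t) (phi (j t) - phi k).
  by rewrite (normc_distC (phi (j t))); lra.
have bphi := span_mchar_cbmeas SM sphi; have bd := dist0_cbmeas.
have bc := mchar_cbmeas dmK Kc (mchar_conj hchi).
have -> : coefficient chi =
    cintegral mu (fun k : borel K => (dist0 k - phi k) * ((chi k)^*)%C).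
  rewrite (_ : (fun k => _) = fun k : borel K => dist0 k * ((chi k)^*)%C -
    phi k * ((chi k)^*)%C); last by apply/funext => k; rewrite mulrBl.
  rewrite cintegralB; try by apply/cbmeas_cint/cbmeasM.
  by rewrite (span_orthogonal SM hchi nS sphi) subr0.
rewrite -[leRHS](mean_cst mu); apply: normc_cintegral_le.
- by apply/cbmeas_cint/cbmeasM => //; exact: cbmeasB.
- exact: rint_cst.
- move=> k; have [_ _ chi1 _] := hchi.
  by rewrite normc_mul normc_conj chi1 mulr1.
Qed.

(** If [chi k = 1] whenever the coefficient of [dist0] at [chi] does not vanish,
  then [dist0 (k + .) + dist0 (-k + .) - 2 dist0] has only vanishing
  coefficients, although its value at [zero] is [2 dK k zero]. *)
Lemma frequencies_separate k : k <> zero ->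
  exists2 chi, mchar chi & coefficient chi <> 0 /\ chi k <> 1.
Proof.
move=> k0; pose D x := dK x zero.
pose ker x := D (add k x) + D (add (opp k) x) - 2 * D x.
have uT a : ucont dK (fun x => D (add a x)).
  exact: (ucont_comp (mg_dist gK a) dist0_ucont).
have uker : ucont dK ker.
  by apply: ucontB; [exact: ucontD | exact: ucontZ].
have Dopp x : D (opp x) = D x.
  by rewrite /D -{1}(gopp0 gK) (gopp_dist dmK gK).
have ker_even x : ker (opp x) = ker x.
  rewrite /ker Dopp -[X in add X (opp x)](goppK gK) -!(goppD gK) !Dopp.
  by rewrite [_ + D (add k x)]addrC.
have ker0 : ker zero != 0.
  rewrite /ker !(gaddr0 gK) Dopp {3}/D (dxx dmK) mulr0 subr0.
  have : D k != 0 by apply/eqP => /(d_eq0 dmK).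
  have := d_ge0 dmK k zero; rewrite -/(D k); move: (D k) => z z0 zn.
  by rewrite -mulr2n mulrn_eq0.
have [chi hchi] := exists_character_not_orthogonal dmK Kc gK muK uker ker_even ker0.
move=> /eqP ne.
have bd : cbmeas (dist0 : borel K -> Cplx R) := dist0_cbmeas.
have bt a : cbmeas (fun x : borel K => dist0 (add a x)).
  exact: (cbmeas_real (ucont_bmeas dmK Kc (uT a))).
have bchi := mchar_cbmeas dmK Kc hchi.
pose c := cintegral mu (fun x : borel K => dist0 x * chi x).
have kE : cintegral mu (fun x : borel K => (ker x)%:C * chi x) =
    (((chi k)^*)%C + ((chi (opp k))^*)%C - 2) * c.
  rewrite (_ : (fun x => _) = fun x : borel K =>
    (dist0 (add k x) * chi x + dist0 (add (opp k) x) * chi x) + (- 2) * (dist0 x * chi x)).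
    have b1 a := cbmeasM (bt a) bchi; have b2 := cbmeasM bd bchi.
    have i1 a := cbmeas_cint mu (b1 a); have i2 := cbmeas_cint mu b2.
    rewrite cintegralD; [|exact: cintD|exact: cintZ].
    rewrite cintegralD// cintegralZ//.
    by rewrite !(cintegral_mchar_shift dmK Kc gK muK _ bd hchi) -/c; ring.
  apply/funext => x; rewrite /ker /dist0 -/(D _) -/(D _) -/(D _).
  rewrite rmorphB rmorphD rmorphM /= !mulrBl mulrDl mulNr; congr (_ - _).
  by rewrite rmorph_nat mulrA.
exists (fun x => ((chi x)^*)%C); first exact: mchar_conj.
split.
- rewrite /coefficient (_ : (fun x => _) = fun x : borel K => dist0 x * chi x); last first.
    by apply/funext => x; rewrite conjcK.
  by move=> c0; apply: ne; rewrite kE /c c0 mulr0.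
- move=> ck; apply: ne; rewrite kE (mcharN gK _ hchi).
  by rewrite ck rmorph1; ring.
Qed.

(** A character outside [S] would be orthogonal to the trigonometric polynomials
  with characters in [S], in particular to those concentrated near [zero]. *)
Lemma separating_group_full S : char_group dK add S ->
  (forall k, k <> zero -> exists2 chi, S chi & chi k <> 1) -> mchar `<=` S.
Proof.
move=> hS sep chi hchi; apply: contrapT => nS; have [SM _ _ _] := hS.
have h2 : 0 < 2^-1 :> R by rewrite invr_gt0.
have [eta eta0 heta] := mchar_ucont hchi h2.
have [eta' [eta'0 eta'le conc]] := concentrated_polynomial dmK Kc gK hS sep eta0.
have c0 : 0 < fine (mu (mball dK zero eta')) := mu_ball_gt0 dmK Kc gK muK _ eta'0.
set c : R := fine _ in c0; have c4 : 0 < c / 4 by lra.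
have [f [sf uf f0 ffar fnear]] := conc _ c4.
have := span_orthogonal SM hchi nS sf => /(congr1 (@complex.Re R)).
have bf := ucont_bmeas dmK Kc uf.
have bre : bmeas (fun k : borel K => Re (chi k)) by case: (mchar_cbmeas dmK Kc hchi).
rewrite cintegralE/=.
have -> : (fun k : borel K => Re ((f k)%:C * ((chi k)^*)%C)) = fun k : borel K => f k * Re (chi k).
  by apply/funext => k; rewrite ReM ReJ /= mul0r subr0.
have mb : measurable (mball dK zero eta' : set (borel K)).
  exact: (borel_open (open_mball dmK _ _)).
have bi := bmeas_ind R mb.
have : mean mu (fun k : borel K => 2^-1 * \1_(mball dK zero eta') k - c / 4) <=
    mean mu (fun k : borel K => f k * Re (chi k)).
  apply: le_mean.
  - by apply/bmeas_rint/bmeasB; [apply: bmeasM => //; exact: bmeas_cst | exact: bmeas_cst].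
  - by apply/bmeas_rint/bmeasM.
  move=> k; have r1 : `|Re (chi k)| <= 1.
    by have [_ _ chi1 _] := hchi; rewrite -(chi1 k) le_Re_normc.
  have [lt|ge] := ltP (dK zero k) eta.
    have : 2^-1 <= Re (chi k).
      have := heta _ _ lt; rewrite (mchar_zero gK hchi) => h.
      have := le_lt_trans (le_Re_normc _) h; rewrite ReB ltr_norml/=; lra.
    rewrite indicE; case: (boolP (_ \in _)) => [/set_mem/fnear|_]; have := f0 k.
      by rewrite mulr1; move: (c / 4) c4 (f k) (Re (chi k)) => z z0 a b; nra.
    by rewrite mulr0; move: (c / 4) c4 (f k) (Re (chi k)) => z z0 a b; nra.
  have := ffar _ ge; rewrite indicE memNset; last first.
    by rewrite /mball/=; move: ge eta'le; lra.
  rewrite mulr0; have := f0 k; move: r1; rewrite ler_norml.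
  by move: (c / 4) c4 (f k) (Re (chi k)) => z z0 a b /andP[? ?] ? ?; nra.
rewrite meanB ?meanZ ?mean_cst; try by [exact: bmeas_rint | exact: rint_cst | apply/rintZ/bmeas_rint].
have -> : mean mu (\1_(mball dK zero eta') : borel K -> R) = c.
  by rewrite /c /mean /Rintegral integral_indic// setIT.
by move=> h h'; rewrite h' in h; lra.
Qed.

End Frequencies.

(** * The hull of an almost periodic displacement *)

Section UniformTopology.
Context (R : realType) (G : topologicalZmodType) (F : G -> Cplx R).
Local Notation normc := Normc.normc.

Lemma uniform_nbhs_normc (f : {uniform G -> Cplx R}) (A : set {uniform G -> Cplx R}) :
  nbhs f A <-> exists2 e : R, 0 < e &
    [set h : {uniform G -> Cplx R} | forall t, normc (f t - h t) < e] `<=` A.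
Proof.
rewrite uniform_nbhs; split.
- move=> [E [+ EA]]; rewrite -entourage_from_ballE => -[z /= z0 zE].
  have r0 : 0 < complex.Re z by move: z0; rewrite ltcE/= => /andP[].
  exists (complex.Re z) => // h fh; apply: EA => t _; apply: zE => /=.
  rewrite -ball_normE /ball_/= normrE.
  by move: z0; rewrite !ltcE/= => /andP[/eqP -> _]; rewrite eqxx/= fh.
- move=> [e e0 eA]; exists [set xy | ball xy.1 (e%:C : R[i]) xy.2]; split.
    by rewrite -entourage_from_ballE; exists e%:C => //=; rewrite ltcR.
  move=> h fh; apply: eA => t; have := fh t Logic.I => /=.
  by rewrite -ball_normE /ball_/= normrE ltcR.
Qed.

Lemma hull_nbhs (x : hull F) (A : set (hull F)) : nbhs x A <->
  exists2 e : R, 0 < e & [set y : hull F | forall t, normc (\val x t - \val y t) < e] `<=` A.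
Proof.
split.
- rewrite /nbhs/= => -[B [[U Uo <-] /= Ux UA]].
  have /uniform_nbhs_normc[e e0 eU] : nbhs (\val x : {uniform G -> Cplx R}) U.
    by move: Uo; rewrite openE; exact.
  by exists e => // y xy; apply: UA => /=; exact: eU.
- move=> [e e0 eA].
  have /nbhs_interior : nbhs (\val x : {uniform G -> Cplx R})
      [set h : {uniform G -> Cplx R} | forall t, normc (\val x t - h t) < e].
    by apply/uniform_nbhs_normc; exists e.
  move=> /nbhs_singleton Ix; rewrite /nbhs/=.
  exists (\val @^-1` ([set h : {uniform G -> Cplx R} | forall t, normc (\val x t - h t) < e])^°).
  split => //=; first by exists ([set h : {uniform G -> Cplx R} | forall t, normc (\val x t - h t) < e])^° => //; exact: open_interior.
  by move=> y /= /interior_subset /= h; exact: eA.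
Qed.

End UniformTopology.

Section Hull.
Context (R : realType) (G : topologicalZmodType) (rho : G -> R) (M : R).
Hypothesis rho0 : rho 0 = 0.
Hypothesis rhoN : forall t, rho (- t) = rho t.
Hypothesis rhoD : forall s t, rho (s + t) <= rho s + rho t.
Hypothesis rhoM : forall t, `|rho t| <= M.
Local Notation normc := Normc.normc.
Let F : G -> Cplx R := fun t => (rho t)%:C.
Hypothesis F_ap : almost_periodic F.
Local Notation K := (hull F).
Local Notation j := (hull_map F).

Let rho_lip s t : `|rho s - rho t| <= rho (s - t).
Proof.
have := rhoD (s - t) t; have := rhoD (t - s) s; rewrite !subrK -opprB rhoN.
by rewrite ler_norml; lra.
Qed.

Let rho_ge0 t : 0 <= rho t.
Proof. by have := rhoD t (- t); rewrite subrr rho0 rhoN; lra. Qed.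

Definition hull_dist (x y : K) : R := sup (range (fun t => normc (\val x t - \val y t))).

Lemma hull_near (x : K) (e : R) : 0 < e ->
  exists t, forall u, normc (\val x u - (rho (t + u))%:C) < e.
Proof.
move=> e0; have /set_mem xcl : (\val x : {uniform G -> Cplx R}) \in hull_set F := valP x.
have /xcl[_ [[t _ <-] h]] : nbhs (\val x : {uniform G -> Cplx R})
    [set h : {uniform G -> Cplx R} | forall t, normc (\val x t - h t) < e].
  by apply/uniform_nbhs_normc; exists e.
by exists t.
Qed.

Lemma hull_normc_le (x : K) t : normc (\val x t) <= M + 1.
Proof.
have [s /(_ t) h] := hull_near x ltr01.
have := normc_triangle (\val x t - (rho (s + t))%:C) (rho (s + t))%:C.
by rewrite subrK normc_real; have := rhoM (s + t); lra.
Qed.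

Let dist_has_sup (x y : K) : has_sup (range (fun t => normc (\val x t - \val y t))).
Proof.
split; first by exists (normc (\val x 0 - \val y 0)); exists 0.
exists ((M + 1) + (M + 1)) => _ [t _ <-].
apply: le_trans (normc_triangle _ _) _; rewrite normc_opp.
by apply: lerD; exact: hull_normc_le.
Qed.

Lemma hull_dist_ge (x y : K) t : normc (\val x t - \val y t) <= hull_dist x y.
Proof. by apply: sup_upper_bound; [exact: dist_has_sup | exists t]. Qed.

Lemma hull_dist_le (x y : K) (e : R) : (forall t, normc (\val x t - \val y t) <= e) ->
  hull_dist x y <= e.
Proof.
move=> h; apply: ge_sup; first by case: (dist_has_sup x y).
by move=> _ [t _ <-].
Qed.

Lemma hull_dist_metric : metric_inducing_topology hull_dist.
Proof.
split.
- move=> x y; split => [h|->]; last first.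
    apply/eqP; rewrite eq_le (le_trans (normc_ge0 _) (hull_dist_ge y y 0)) andbT.
    by apply: hull_dist_le => t; rewrite subrr normc_zero.
  apply: val_inj; apply/funext => t; apply/eqP; rewrite -subr_eq0; apply/eqP/normc_eq0P/eqP.
  by rewrite eq_le normc_ge0 andbT -h hull_dist_ge.
- move=> x y; rewrite /hull_dist.
  rewrite (_ : (fun t => normc (\val x t - \val y t)) = fun t => normc (\val y t - \val x t))//.
  by apply/funext => t; exact: normc_distC.
- move=> x y z; apply: hull_dist_le => t.
  have -> : \val x t - \val z t = (\val x t - \val y t) + (\val y t - \val z t).
    by rewrite addrA subrK.
  by apply: le_trans (normc_triangle _ _) _; apply: lerD; exact: hull_dist_ge.
- move=> x A; rewrite hull_nbhs; split => -[e e0 eA].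
    exists e => // y xy; apply: eA => t; apply: le_lt_trans xy; exact: hull_dist_ge.
  have e2 : 0 < e / 2 by lra.
  exists (e / 2) => // y xy; apply: eA => /=; apply: (@le_lt_trans _ _ (e / 2)); last lra.
  by apply: hull_dist_le => t; exact/ltW/xy.
Qed.

Let dm := hull_dist_metric.

Lemma hull_dist_map s t : hull_dist (j s) (j t) = rho (s - t).
Proof.
apply/eqP; rewrite eq_le; apply/andP; split.
  apply: hull_dist_le => u.
  have -> : \val (j s) u - \val (j t) u = (rho (s + u) - rho (t + u))%:C by rewrite rmorphB.
  rewrite normc_real.
  by apply: le_trans (rho_lip _ _) _; rewrite opprD addrACA subrr addr0.
have := hull_dist_ge (j s) (j t) (- t).
have -> : \val (j s) (- t) - \val (j t) (- t) = (rho (s - t))%:C.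
  transitivity ((rho (s - t))%:C - (rho (t - t))%:C : Cplx R); first by [].
  by rewrite subrr rho0 subr0.
by rewrite normc_real ger0_norm.
Qed.

Lemma hull_dense (x : K) (e : R) : 0 < e -> exists t, hull_dist x (j t) < e.
Proof.
move=> e0; have e2 : 0 < e / 2 by lra.
have [t h] := hull_near x e2; exists t; apply: (@le_lt_trans _ _ (e / 2)); last lra.
by apply: hull_dist_le => u; exact/ltW/h.
Qed.

Lemma hull_eval0E (x : K) : hull_eval0 x = (hull_dist x (j 0))%:C.
Proof.
apply/eqP; rewrite -subr_eq0; apply/eqP/normc_eq0P/eqP.
rewrite eq_le normc_ge0 andbT; apply/ler_addgt0Pr => e e0; rewrite add0r.
have e2 : 0 < e / 2 by lra.
have [t xt] := hull_dense x e2.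
have h1 := le_lt_trans (hull_dist_ge x (j t) 0) xt.
have jt : \val (j t) 0 = (hull_dist (j t) (j 0))%:C.
  by rewrite hull_dist_map subr0 /= /translate addr0.
rewrite jt in h1; have := d_lip dm (j t) x (j 0) (j 0).
rewrite (dxx dm) addr0 (d_sym dm (j t) x) => h2.
rewrite /hull_eval0; have -> : \val x 0 - (hull_dist x (j 0))%:C =
    (\val x 0 - (hull_dist (j t) (j 0))%:C) + (hull_dist (j t) (j 0) - hull_dist x (j 0))%:C.
  by rewrite rmorphB addrA subrK.
by apply: le_trans (normc_triangle _ _) _; rewrite normc_real; lra.
Qed.

(** The limit is taken pointwise along an ultrafilter, and the Cauchy
  property makes it uniform. *)
Lemma hull_complete (phi : nat -> G) :
  (forall e : R, 0 < e -> exists N, forall n k, (N <= n)%N -> (N <= k)%N ->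
     rho (phi n - phi k) < e) ->
  exists x : K, forall e : R, 0 < e -> exists N, forall n, (N <= n)%N ->
     hull_dist x (j (phi n)) < e.
Proof.
move=> cauchy; pose E : {uniform G -> Cplx R} :=
  fun t => (ulim (fun n => rho (phi n + t)))%:C.
have bd t : bounded_seq (fun n => rho (phi n + t)) by exists M => n; exact: rhoM.
have close (e : R) : 0 < e -> exists N, forall n, (N <= n)%N ->
    forall t, normc (E t - (rho (phi n + t))%:C) < e.
  move=> e0; have e2 : 0 < e / 2 by lra.
  have [N hN] := cauchy _ e2; exists N => n Nn t.
  have n1 := ulim_near (bd t) e2.
  have n2 := near_ultra (nbhs_infty_ge N).
  have [k [hk1 hk2]] := @filter_ex _ _ _ _ (filterI n1 n2).
  rewrite /E -rmorphB normc_real; move: hk1 => /= hk1.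
  have := le_lt_trans (rho_lip (phi k + t) (phi n + t)) _; rewrite opprD addrACA subrr addr0.
  move=> /(_ _ (hN _ _ hk2 Nn)); move: hk1; rewrite !ltr_norml; lra.
have Ecl : E \in hull_set F.
  apply/mem_set => U /uniform_nbhs_normc[e e0 eU]; have [N hN] := close _ e0.
  exists (translate F (phi N)); split; first by exists (phi N).
  by apply: eU => t; exact: hN.
exists (exist _ E Ecl) => e e0; have e2 : 0 < e / 2 by lra.
have [N hN] := close _ e2; exists N => n Nn; apply: (@le_lt_trans _ _ (e / 2)); last lra.
by apply: hull_dist_le => t; exact/ltW/hN.
Qed.

Lemma rho_near0 (e : R) : 0 < e -> \forall u \near (0 : G), rho u < e.
Proof.
move=> e0; have [/(_ _ e0) h _] := F_ap; apply: filterS h => u /(_ 0).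
by rewrite add0r /F rho0 -rmorphB subr0 normc_real ger0_norm.
Qed.

(** Almost periodicity moves [t] into a compact set, up to an element of
  small [rho]; by continuity of [rho] at 0 finitely many points are dense
  enough in this set. *)
Lemma rho_net (e : R) : 0 < e -> exists s : seq G, forall t, exists2 c, c \in s & rho (t - c) < e.
Proof.
move=> e0; have e3 : 0 < e / 3 by lra.
have [_ /(_ _ e3)[C Cc TC]] := F_ap.
pose U (c : G) : set G := [set x | rho (c - x) < e / 3].
have Un c : nbhs c (U c) := near_subl c (rho_near0 e3).
have [s sP] : exists s : seq G, forall x, C x -> exists2 c, c \in s & U c x.
  apply: contrapT => no.
  have [p [Cp cl]] : C `&` cluster (filter_from setT
      (fun s : seq G => [set x | C x /\ forall c, c \in s -> ~ U c x])) !=set0.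
    apply: Cc; last by exists [::] => // x [].
    apply: filter_from_proper; last first.
      move=> s _; apply: contrapT => /set0P/negP/negPn/eqP s0; apply: no; exists s => x Cx.
      apply: contrapT => nx; have : (set0 : set G) x.
        by rewrite -s0; split => // c cs Ux; apply: nx; exists c.
      by [].
    apply: filter_from_filter; first by exists [::].
    move=> s s' _ _; exists (s ++ s') => // x [Cx h]; split; split => // c cs;
      by apply: h; rewrite mem_cat cs ?orbT.
  have [x [[_ hx] Ux]] : [set x | C x /\ forall c, c \in [:: p] -> ~ U c x] `&` U p !=set0.
    by apply: cl; [exists [:: p] | exact: Un].
  by apply: (hx p) => //; rewrite inE.
exists s => t; have : [set: G] t by [].
rewrite -TC => -[t' ht' [c Cc' <-]]; have [c' cs' Uc'] := sP _ Cc'.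
exists c' => //; have := ht' 0; rewrite addr0 /F rho0 -rmorphB subr0 normc_real ger0_norm// => h.
by have := rhoD t' (c - c'); rewrite addrA; move: Uc'; rewrite /U/= -opprB rhoN; lra.
Qed.

Lemma ultra_seq (T I : eqType) (U : set_system T) (s : seq I) (B : I -> set T) :
  UltraFilter U -> (forall x, exists2 c, c \in s & B c x) -> exists c, U (B c).
Proof.
move=> uU; have pU : ProperFilter U by exact: ultra_proper.
suff H : U [set x | exists2 c, c \in s & B c x] -> exists c, U (B c).
  by move=> h; apply: H; apply: filterS filterT => x _; exact: h.
elim: s => [|c s ih] hs.
  have : U set0 by apply: filterS hs => x [].
  by move=> /filter_not_empty.
have [|nB] := in_ultra_setVsetC (B c) uU; first by exists c.
apply: ih; apply: filterS2 hs nB => x [c' + Bx] nx.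
by rewrite inE => /orP[/eqP c'E|?]; [rewrite c'E in Bx | exists c'].
Qed.

(** An ultrafilter contains, for every [n], a ball of radius [n.+1%:R^-1]
  around a translate; the centres form a Cauchy sequence, and the ultrafilter
  converges to its limit. *)
Lemma hull_compact : compact [set: K].
Proof.
rewrite compact_ultra => U uU _; have pU : ProperFilter U by exact: ultra_proper.
have P n : exists t, U [set x | hull_dist x (j t) < n.+1%:R^-1].
  have n0 : 0 < n.+1%:R^-1 :> R by rewrite invr_gt0 ltr0n.
  have n2 : 0 < n.+1%:R^-1 / 2 :> R by rewrite divr_gt0.
  have [s sP] := rho_net n2.
  apply: (@ultra_seq K G U s (fun t => [set x : K | hull_dist x (j t) < n.+1%:R^-1])) => x.
  have [t xt] := hull_dense x n2; have [c cs tc] := sP t; exists c => //=.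
  apply: le_lt_trans (d_tri dm _ (j t) _) _; rewrite hull_dist_map.
  by move: xt tc; move: (n.+1%:R^-1) => z; lra.
have [phi phiP] := choice P.
have near_phi n k : rho (phi n - phi k) < n.+1%:R^-1 + k.+1%:R^-1.
  have [x [/= h1 h2]] := @filter_ex _ _ _ _ (filterI (phiP n) (phiP k)).
  rewrite -hull_dist_map; apply: le_lt_trans (d_tri dm _ x _) _.
  by rewrite (d_sym dm _ x); move: h1 h2; move: (n.+1%:R^-1) (k.+1%:R^-1) => a b; lra.
have small (e : R) : 0 < e -> exists N, forall n, (N <= n)%N -> n.+1%:R^-1 < e.
  move=> e0; have [N _ hN] := near_infty_natSinv_lt (PosNum e0).
  by exists N => n Nn; exact: (hN n Nn).
have [|x hx] := @hull_complete phi.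
  move=> e e0; have e2 : 0 < e / 2 by lra.
  have [N hN] := small _ e2; exists N => n k /hN h1 /hN h2.
  by apply: lt_trans (near_phi n k) _; move: h1 h2; move: (n.+1%:R^-1) (k.+1%:R^-1) => a b; lra.
exists x; split => // A /(nbhs_ballP_metric dm)[e e0 eA].
have e2 : 0 < e / 2 by lra.
have [N hN] := hx _ e2; have [N' hN'] := small _ e2.
pose n := maxn N N'; apply: filterS (phiP n) => y /= hy; apply: eA.
rewrite /mball/=; apply: le_lt_trans (d_tri dm _ (j (phi n)) _) _.
have := hN n (leq_maxl _ _); have := hN' n (leq_maxr _ _); rewrite (d_sym dm (j (phi n))).
by move: hy; move: (n.+1%:R^-1) => z; lra.
Qed.

End Hull.

(** * The group structure of the hull *)

Section CompletionGroup.
Context (R : realType) (G : zmodType) (rho : G -> R).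
Hypothesis rhoN : forall t, rho (- t) = rho t.
Hypothesis rhoD : forall s t, rho (s + t) <= rho s + rho t.
Context (K : ptopologicalType) (dK : K -> K -> R).
Hypothesis dmK : metric_inducing_topology dK.
Variable j : G -> K.
Hypothesis j_iso : forall s t, dK (j s) (j t) = rho (s - t).
Hypothesis j_dense : forall k (e : R), 0 < e -> exists t, dK k (j t) < e.
Hypothesis j_complete : forall phi : nat -> G,
  (forall e : R, 0 < e -> exists N, forall n k, (N <= n)%N -> (N <= k)%N ->
     rho (phi n - phi k) < e) ->
  exists x : K, forall e : R, 0 < e -> exists N, forall n, (N <= n)%N ->
     dK x (j (phi n)) < e.

Let small (e : R) : 0 < e -> exists N, forall n, (N <= n)%N -> n.+1%:R^-1 < e.
Proof.
move=> e0; have [N _ hN] := near_infty_natSinv_lt (PosNum e0).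
by exists N => n Nn; exact: (hN n Nn).
Qed.

Let exists_rep : exists rep : K -> nat -> G, forall x n, dK x (j (rep x n)) < n.+1%:R^-1.
Proof.
have P (q : K * nat) : exists t, dK q.1 (j t) < q.2.+1%:R^-1.
  by apply: j_dense; rewrite invr_gt0 ltr0n.
by have [r rP] := choice P; exists (fun x n => r (x, n)) => x n; exact: (rP (x, n)).
Qed.

Let rep_cauchy (rep : K -> nat -> G) : (forall x n, dK x (j (rep x n)) < n.+1%:R^-1) ->
  forall x n k, rho (rep x n - rep x k) < n.+1%:R^-1 + k.+1%:R^-1.
Proof.
move=> repP x n k; rewrite -j_iso; apply: le_lt_trans (d_tri dmK _ x _) _.
by rewrite (d_sym dmK _ x) ltrD.
Qed.

(** Since [j] has dense range, the inequality determines [add], and all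
  identities of the subgroup pass to [add] through it. *)
Lemma exists_completion_add : exists add : K -> K -> K, forall x y s t,
  dK (add x y) (j (s + t)) <= dK x (j s) + dK y (j t).
Proof.
have [rep repP] := exists_rep.
suff P (p : K * K) : exists z, forall s t, dK z (j (s + t)) <= dK p.1 (j s) + dK p.2 (j t).
  by have [f fP] := choice P; exists (fun x y => f (x, y)) => x y; exact: (fP (x, y)).
case: p => x y /=; pose phi n := rep x n + rep y n.
have [|z hz] := @j_complete phi.
  move=> e e0; have e4 : 0 < e / 4 by lra.
  have [N hN] := small e4; exists N => n k /hN h1 /hN h2.
  have := rhoD (rep x n - rep x k) (rep y n - rep y k); rewrite addrACA -opprD => h3.
  apply: le_lt_trans h3 _; have := rep_cauchy repP x n k; have := rep_cauchy repP y n k.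
  by move: h1 h2; move: (n.+1%:R^-1) (k.+1%:R^-1) => a b; lra.
exists z => s t; apply/ler_addgt0Pr => e e0; have e4 : 0 < e / 4 by lra.
have [N hN] := hz _ e4; have [N' hN'] := small e4; pose n := maxn N N'.
have h1 := hN n (leq_maxl _ _); have h2 := hN' n (leq_maxr _ _).
apply: le_trans (d_tri dmK _ (j (phi n)) _) _.
have : dK (j (phi n)) (j (s + t)) <= dK (j (rep x n)) (j s) + dK (j (rep y n)) (j t).
  by rewrite !j_iso /phi opprD addrACA.
have := d_tri dmK (j (rep x n)) x (j s); have := d_tri dmK (j (rep y n)) y (j t).
have := repP x n; have := repP y n; rewrite (d_sym dmK _ x) (d_sym dmK _ y).
by move: h2; move: (n.+1%:R^-1) => a; lra.
Qed.

Lemma exists_completion_opp : exists opp : K -> K, forall x s,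
  dK (opp x) (j (- s)) <= dK x (j s).
Proof.
have [rep repP] := exists_rep.
suff P x : exists z, forall s, dK z (j (- s)) <= dK x (j s).
  by have [f fP] := choice P; exists f.

have [|z hz] := @j_complete (fun n => - rep x n).
  move=> e e0; have e2 : 0 < e / 2 by lra.
  have [N hN] := small e2; exists N => n k /hN h1 /hN h2.
  rewrite -opprD rhoN; apply: lt_trans (rep_cauchy repP x n k) _.
  by move: h1 h2; move: (n.+1%:R^-1) (k.+1%:R^-1) => a b; lra.
exists z => s; apply/ler_addgt0Pr => e e0; have e4 : 0 < e / 4 by lra.
have [N hN] := hz _ e4; have [N' hN'] := small e4; pose n := maxn N N'.
have h1 := hN n (leq_maxl _ _); have h2 := hN' n (leq_maxr _ _).
apply: le_trans (d_tri dmK _ (j (- rep x n)) _) _.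
have : dK (j (- rep x n)) (j (- s)) = dK (j (rep x n)) (j s).
  by rewrite !j_iso -opprD rhoN.
have := d_tri dmK (j (rep x n)) x (j s); have := repP x n; rewrite (d_sym dmK _ x).
by move: h2; move: (n.+1%:R^-1) => a; lra.
Qed.

Lemma exists_completion_group : exists (add : K -> K -> K) (opp : K -> K),
  metric_group dK add (j 0) opp /\ forall s t, j (s + t) = add (j s) (j t).
Proof.
have [add addP] := exists_completion_add; have [opp oppP] := exists_completion_opp.
have eqd x y : (forall e : R, 0 < e -> dK x y <= e) -> x = y.
  move=> h; apply: (d_eq0 dmK); apply/eqP; rewrite eq_le (d_ge0 dmK) andbT.
  by apply/ler_addgt0Pr => e e0; rewrite add0r; exact: h.
exists add, opp; split; first split.
- move=> x y z; apply: eqd => e e0; have e6 : 0 < e / 6 by lra.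
  have [s sx] := j_dense x e6; have [t ty] := j_dense y e6; have [u uz] := j_dense z e6.
  apply: le_trans (d_tri dmK _ (j (s + (t + u))) _) _.
  have := addP x (add y z) s (t + u); have := addP y z t u.
  have := addP (add x y) z (s + t) u; have := addP x y s t.
  by rewrite (d_sym dmK (j _)) addrA; lra.
- move=> x y; apply: eqd => e e0; have e4 : 0 < e / 4 by lra.
  have [s sx] := j_dense x e4; have [t ty] := j_dense y e4.
  apply: le_trans (d_tri dmK _ (j (s + t)) _) _.
  have := addP x y s t; have := addP y x t s; rewrite (d_sym dmK (j _)) [t + s]addrC.
  lra.
- move=> x; apply: eqd => e e0; have e2 : 0 < e / 2 by lra.
  have [s sx] := j_dense x e2; apply: le_trans (d_tri dmK _ (j (0 + s)) _) _.
  by have := addP (j 0) x 0 s; rewrite (dxx dmK) add0r (d_sym dmK (j s)); lra.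
- move=> x; apply: eqd => e e0; have e2 : 0 < e / 2 by lra.
  have [s sx] := j_dense x e2; have := addP (opp x) x (- s) s; have := oppP x s.
  by rewrite addNr; lra.
- move=> a x y; suff H (e : R) : 0 < e -> `|dK (add a x) (add a y) - dK x y| <= e.
    apply/eqP; rewrite -subr_eq0 -normr_le0; apply/ler_addgt0Pr => e e0.
    by rewrite add0r; exact: H.
  move=> e0; have e6 : 0 < e / 6 by lra.
  have [s sa] := j_dense a e6; have [t tx] := j_dense x e6; have [u uy] := j_dense y e6.
  have h1 := addP a x s t; have h2 := addP a y s u.
  have E : dK (j (s + t)) (j (s + u)) = dK (j t) (j u).
    by rewrite !j_iso opprD addrACA subrr add0r.
  have := d_lip dmK (add a x) (j (s + t)) (add a y) (j (s + u)).
  have := d_lip dmK x (j t) y (j u); rewrite E !ler_norml; lra.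
- move=> s t; apply/esym/(d_eq0 dmK)/eqP; rewrite eq_le (d_ge0 dmK) andbT.
  by have := addP (j s) (j t) s t; rewrite !(dxx dmK) addr0.
Qed.

End CompletionGroup.

Section Laws.
Context (R : realType) (K : ptopologicalType) (dK : K -> K -> R).
Hypothesis dmK : metric_inducing_topology dK.
Hypothesis Kc : compact [set: K].
Local Notation Re := complex.Re.
Local Notation Im := complex.Im.
Local Notation normc := Normc.normc.

Lemma metric_continuous (f : K -> K) : (forall x y, dK (f x) (f y) <= dK x y) -> continuous f.
Proof.
move=> h x A /(nbhs_ballP_metric dmK)[e e0 eA]; apply/(nbhs_ballP_metric dmK).
by exists e => // y xy; apply: eA; exact: le_lt_trans (h _ _) xy.
Qed.

Lemma metric_group_law (add : K -> K -> K) zero opp : metric_group dK add zero opp ->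
  abelian_topgroup_law add.
Proof.
move=> gK; split.
- exact: mg_addA gK.
- exact: mg_addC gK.
- exists zero, opp; split; [exact: mg_add0 gK | exact: mg_addN gK|].
  by apply: metric_continuous => x y; rewrite (gopp_dist dmK gK).
- move=> [x y] A /(nbhs_ballP_metric dmK)[e e0 eA]; have e2 : 0 < e / 2 by lra.
  exists (mball dK x (e / 2), mball dK y (e / 2)).
    by split; exact: (nbhs_mball dmK).
  move=> [x' y'] /= [xx yy]; apply: eA; rewrite /mball/=.
  apply: le_lt_trans (add_dist dmK gK _ _ _ _) _.
  by move: xx yy; rewrite /mball/=; lra.
Qed.

(** The metric is invariant under any group law that extends the addition of a
  dense subgroup on which it is invariant. *)
Lemma law_metric_group (G : zmodType) (j : G -> K) (add : K -> K -> K) :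
  (forall k (e : R), 0 < e -> exists t, dK k (j t) < e) ->
  (forall s t u, dK (j (s + t)) (j (s + u)) = dK (j t) (j u)) ->
  (forall s t, j (s + t) = add (j s) (j t)) -> abelian_topgroup_law add ->
  exists zero opp, metric_group dK add zero opp.
Proof.
move=> j_dense j_inv jD [addA addC [zero [opp [add0 addN _]]] addc].
exists zero, opp; split => // a x y.
suff H (e : R) : 0 < e -> `|dK (add a x) (add a y) - dK x y| <= e.
  apply/eqP; rewrite -subr_eq0 -normr_le0; apply/ler_addgt0Pr => e e0.
  by rewrite add0r; exact: H.
move=> e0; have e4 : 0 < e / 4 by lra.
have near b z : exists2 del : R, 0 < del & forall b' z', dK b b' < del -> dK z z' < del ->
    dK (add b z) (add b' z') < e / 4.
  have := addc (b, z) _ (nbhs_mball dmK (add b z) e4).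
  rewrite nbhs_simpl/= => -[[A B] /= [/(nbhs_ballP_metric dmK)[p p0 pA]
    /(nbhs_ballP_metric dmK)[q q0 qB]] AB].
  exists (Num.min p q); first by rewrite lt_min p0.
  move=> b' z'; rewrite !lt_min => /andP[bp _] /andP[_ zq].
  by apply: (AB (b', z')); split; [exact: pA | exact: qB].
have [p p0 hp] := near a x; have [q q0 hq] := near a y.
have [s] : exists s, dK a (j s) < Num.min p q by apply: j_dense; rewrite lt_min p0.
rewrite lt_min => /andP[sp sq].
have [t] : exists t, dK x (j t) < Num.min p (e / 4) by apply: j_dense; rewrite lt_min p0.
rewrite lt_min => /andP[tp te].
have [u] : exists u, dK y (j u) < Num.min q (e / 4) by apply: j_dense; rewrite lt_min q0.
rewrite lt_min => /andP[uq ue].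
have h1 := hp _ _ sp tp; have h2 := hq _ _ sq uq; rewrite -!jD in h1 h2.
have := d_lip dmK (add a x) (j (s + t)) (add a y) (j (s + u)).
have := d_lip dmK x (j t) y (j u); rewrite j_inv !ler_norml; lra.
Qed.

Lemma characters_mchar (add : K -> K -> K) (chi : K -> Cplx R) :
  characters add chi <-> mchar dK add chi.
Proof.
have cvgP : continuous chi <-> forall x (e : R), 0 < e -> exists2 del : R, 0 < del &
    forall y, dK x y < del -> normc (chi x - chi y) < e.
  split=> [h x e e0|h x].
    have eC : 0 < (e%:C : R[i]) by rewrite ltcR.
    have /cvgrPdist_lt/(_ _ eC) := h x; move=> /(nbhs_ballP_metric dmK)[del del0 hd].
    by exists del => // y /hd /=; rewrite normrE ltcR.
  apply/cvgrPdist_lt => e e0.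
  have eE : e = (Re e)%:C.
    by apply: cplx_eq => //=; move: e0; rewrite ltcE/= => /andP[/eqP ->].
  have r0 : 0 < Re e by move: e0; rewrite ltcE/= => /andP[].
  have [del del0 hd] := h x _ r0; apply/(nbhs_ballP_metric dmK).
  by exists del => // y /hd /=; rewrite normrE eE ltcR.
split.
- move=> [/cvgP hc h1 hM]; split => //.
  + apply: (compact_ucont dmK Kc) => x e /(hc x)[del del0 h]; exists del => // y /h.
    by apply: le_lt_trans; rewrite -ReB le_Re_normc.
  + apply: (compact_ucont dmK Kc) => x e /(hc x)[del del0 h]; exists del => // y /h.
    by apply: le_lt_trans; rewrite -ImB le_Im_normc.
  + by move=> x; have := h1 x; rewrite normrE => -[].
- move=> hchi; have [_ _ h1 hM] := hchi; split => //.
  + apply/cvgP => x e e0; have [del del0 h] := mchar_ucont hchi e0.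
    by exists del => // y; exact: h.
  + by move=> x; rewrite normrE h1.
Qed.

End Laws.

(** * The group of eigenvalues *)

Section GeneratedSubgroup.
Context (R : realType) (G : topologicalZmodType).
Implicit Type S : set (G -> Cplx R).

Lemma dual_is_subgroup : dual_subgroup (@dual R G).
Proof.
split => //; first exact: dual1.
- move=> a b [ca a1 aM] [cb b1 bM]; split.
  + by move=> t; apply: cvgM; [exact: ca | exact: cb].
  + by move=> t; rewrite normrM a1 b1 mulr1.
  + by move=> s t; rewrite aM bM; ring.
- move=> a [ca a1 aM]; split.
  + by move=> t; apply: cvgV; [rewrite -normr_gt0 a1 | exact: ca].
  + by move=> t; rewrite normfV a1 invr1.
  + by move=> s t; rewrite aM invfM.
Qed.

Lemma generated_dual_subgroup S : S `<=` @dual R G ->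
  dual_subgroup (generated_subgroup S).
Proof.
move=> SD; split.
- by apply: smallest_sub => //; exact: dual_is_subgroup.
- by move=> H [[_ H1 _ _] _].
- by move=> a b ha hb H HH; have [[_ _ HM _] _] := HH; apply: HM; [exact: ha | exact: hb].
- by move=> a ha H HH; have [[_ _ _ HV] _] := HH; apply: HV; exact: ha.
Qed.

Lemma sub_generated S : S `<=` generated_subgroup S.
Proof. by move=> a Sa H [_ SH]; exact: SH. Qed.

End GeneratedSubgroup.

Section MainTheorem.
Context (R : realType) (X : ptopologicalType) (G : topologicalZmodType).
Variables (act : G -> X -> X) (m : probability (borel X) R) (d : X -> X -> R).
Hypothesis Xc : compact [set: X].
Hypothesis actc : continuous_action act.
Hypothesis minv : invariant_measure act m.
Hypothesis dm : metric_inducing_topology d.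
Let d_ : G -> Cplx R := fun t => (disp act m d t)%:C.
Hypothesis ap : almost_periodic d_.
Local Notation K := (hull d_).
Local Notation j := (hull_map d_).
Local Notation dK := (@hull_dist R G (disp act m d)).

Let rho0 := disp0 m actc dm.
Let rhoN := dispN Xc actc minv dm.
Let rhoD := dispD Xc actc minv dm.

Let rho_bounded : exists M : R, forall t, `|disp act m d t| <= M.
Proof.
have [M M0 hM] := ucont_bounded dm Xc (ucont_dist dm (point : X)).
exists (M + M) => t; apply: norm_mean_le; first exact/bmeas_rint/(disp_bmeas Xc actc dm).
move=> x; rewrite ger0_norm ?(d_ge0 dm)//.
apply: le_trans (d_tri dm _ point _) _; rewrite (d_sym dm point).
by apply: lerD; apply: le_trans (ler_norm _) (hM _).
Qed.

Let M : R := sval (cid rho_bounded).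
Let rhoM : forall t, `|disp act m d t| <= M := svalP (cid rho_bounded).

Let dmK : metric_inducing_topology (dK : K -> K -> R) := hull_dist_metric rhoM.
Let Kc : compact [set: K] := hull_compact rho0 rhoN rhoD rhoM ap.
Let j_iso : forall s t, dK (j s) (j t) = disp act m d (s - t) := hull_dist_map rho0 rhoN rhoD rhoM.
Let j_dense : forall k (e : R), 0 < e -> exists t, dK k (j t) < e := hull_dense rhoM.

Let hull_map_continuous : continuous j.
Proof.
move=> t A /(nbhs_ballP_metric dmK)[e e0 eA].
apply: filterS (near_subl t (disp_continuous0 m Xc actc dm e0)) => s hs.
by apply: eA; rewrite /mball/= j_iso.
Qed.

Lemma exists_hull_group : exists (add : K -> K -> K) (opp : K -> K)
    (mu : probability (borel K) R),
  [/\ metric_group dK add (j 0) opp, forall s t, j (s + t) = add (j s) (j t),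
      hull_group_law add & haar_probability add mu].
Proof.
have [add [opp [gK jD]]] := exists_completion_group rhoN rhoD dmK j_iso j_dense
  (hull_complete rhoN rhoD rhoM).
have [mu muK] := exists_isometry_invariant_probability dmK Kc.
exists add, opp, mu; split => //.
  by split => //; exact: (metric_group_law dmK gK).
move=> x A mA; apply: (muK (add x) (add (opp x))).
- exact: (gaddK gK).
- exact: (gaddNK gK).
- exact: (mg_dist gK).
Qed.

Lemma almost_periodic_discrete_spectrum : discrete_spectrum act m.
Proof.
have [add [opp [mu [gK jD _ muK]]]] := exists_hull_group.
exact: (discrete_spectrum_of_compact_group Xc actc minv dm dmK Kc gK muK jD j_dense j_iso).
Qed.

Let coefficientE (mu : probability (borel K) R) chi zero : zero = j 0 ->
  L2inner mu (@hull_eval0 R G d_ : borel K -> Cplx R) chi = coefficient dK zero mu chi.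
Proof.
move=> ->; congr cintegral; apply/funext => k; congr (_ * _).
exact: (hull_eval0E rho0 rhoN rhoD rhoM).
Qed.

(** A frequency comes with its own group law and measure; by [law_metric_group]
  they make the hull a metric group with an invariant probability, to which
  [frequency_eigenvalue] applies. *)
Lemma frequencies_eigenvalues : frequencies d_ `<=` eigenvalues act m.
Proof.
move=> _ [chi [add [mu [[law jc jD] muK chic cne]]] <-].
have j_inv s t u : dK (j (s + t)) (j (s + u)) = dK (j t) (j u).
  by rewrite !j_iso opprD addrACA subrr add0r.
have [zero [opp gK]] := law_metric_group dmK j_dense j_inv jD law.
have hchi := (characters_mchar dmK Kc add chi).1 chic.
apply: (frequency_eigenvalue Xc actc minv dm dmK Kc gK muK jD j_dense j_iso) => //.
  exact: almost_periodic_discrete_spectrum.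
by rewrite -coefficientE// (j0 gK jD).
Qed.

(** The characters of the hull that restrict to elements of the subgroup
  generated by the frequencies separate points, hence they are all
  characters; and every eigenvalue extends to a character of the hull. *)
Lemma eigenvalues_generated : eigenvalues act m `<=` generated_subgroup (frequencies d_).
Proof.
have [add [opp [mu [gK jD law muK]]]] := exists_hull_group.
have FD : frequencies d_ `<=` @dual R G by move=> g /frequencies_eigenvalues[].
have [_ gen1 genM genV] := generated_dual_subgroup FD.
pose S := [set chi | mchar dK add chi /\ generated_subgroup (frequencies d_) (chi \o j)].
have hS : char_group dK add S.
  split.
  - by move=> chi [].
  - by split; [exact: mchar1 | exact: gen1].
  - move=> a b [ha ga] [hb gb]; split; first exact: (mcharM dmK Kc).
    exact: genM ga gb.
  - move=> a [ha ga]; split; first exact: mchar_conj.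
    have := genV _ ga; rewrite (_ : (fun t => _) = (fun k => ((a k)^*)%C) \o j)//.
    by apply/funext => t /=; rewrite normc1_inv//; case: ha.
have sep k : k <> j 0 -> exists2 chi, S chi & chi k <> 1.
  move=> k0; have [chi hchi [c0 ck]] := frequencies_separate dmK Kc gK muK k0.
  exists chi => //; split => //; apply: sub_generated; exists chi => //.
  exists add, mu; split => //; last by rewrite (coefficientE _ _ erefl).
  exact/(characters_mchar dmK Kc).
have full := separating_group_full dmK Kc gK muK hS sep.
move=> gam hgam.
have [chi hchi chiE] := extend_eigenvalue Xc actc minv dm dmK gK jD j_dense j_iso hgam.
have [_] := full _ hchi.
by rewrite (_ : chi \o j = gam)//; apply/funext => t; exact: chiE.
Qed.

Lemma eigenvalue_group_frequencies :
  eigenvalue_group act m = generated_subgroup (frequencies d_).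
Proof.
have ED : eigenvalues act m `<=` @dual R G by move=> g [].
have FD : frequencies d_ `<=` @dual R G by move=> g /frequencies_eigenvalues[].
apply/seteqP; split; apply: smallest_sub.
- exact: generated_dual_subgroup.
- exact: eigenvalues_generated.
- exact: generated_dual_subgroup.
- by move=> g /frequencies_eigenvalues hg; exact: sub_generated.
Qed.

End MainTheorem.

Theorem theorem4p1 (R : realType) (X : ptopologicalType)
    (G : topologicalZmodType) (act : G -> X -> X)
    (m : probability (borel X) R) (d : X -> X -> R)
    (X_compact : compact [set: X])
    (G_locally_compact : locally_compact [set: G])
    (G_sigma_compact : sigma_compact G)
    (act_continuous : continuous_action act)
    (m_invariant : invariant_measure act m)
    (d_metric : metric_inducing_topology d) :
  let d_ : G -> Cplx R := fun t => (mean_displacement act m d t)%:C in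
  (discrete_spectrum act m <-> almost_periodic d_) /\
  (discrete_spectrum act m \/ almost_periodic d_ ->
   eigenvalue_group act m = generated_subgroup (frequencies d_)).
Proof.
move=> d_.
have ds_ap : discrete_spectrum act m -> almost_periodic d_ :=
  discrete_spectrum_almost_periodic X_compact act_continuous m_invariant d_metric.
split; first split => // ap.
  exact: (almost_periodic_discrete_spectrum X_compact act_continuous m_invariant d_metric).
move=> h; have ap : almost_periodic d_ by case: h.
exact: (eigenvalue_group_frequencies X_compact act_continuous m_invariant d_metric).
Qed.
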